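(* Let $\gamma\in(0,2)$, let $K_0>0$, and let $L:(0,\infty)\to(0,\infty)$ be a measurable function slowly varying at infinity. Define $$C(\gamma)=\frac{\Gamma(1+\gamma)\sin\left(\frac{\gamma\pi}{2}\right)}{\pi(2-\gamma)}.$$ Then the following are equivalent: (i) $G(x)\sim C(\gamma)K_0\,x^{2-\gamma}L(1/x)$ as $x\to0^+$; (ii) $\operatorname{Var}(S_n)\sim K_0\,n^{\gamma}L(n)$ as $n\to\infty$. In particular, $\operatorname{Var}(S_n)/n\to K_0$ as $n\to\infty$ if and only if $G(x)/x\to K_0/\pi$ as $x\to0^+$.
   Context: Let $X_1,X_2,\ldots$ be a sequence of centred, weakly stationary, real random variables with finite second moments. Its spectral measure is the finite Borel measure $F$ on $[-\pi,\pi]$ such that $r_k:=\operatorname{Cov}(X_0,X_k)=\int_{-\pi}^{\pi}e^{\mathrm{i}tk}\,F(\mathrm{d}t)$ for all integers $k$; it is assumed that $F$ is symmetric about the origin. Define $G(x)=F([-x,x])$ for $0\le x\le\pi$, and $S_n=X_1+\cdots+X_n$. A positive measurable function $L$ is slowly varying at infinity if $L(\lambda x)/L(x)\to1$ as $x\to\infty$ for every $\lambda>0$. The notation $a\sim b$ means $a/b\to1$. *)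

(* Defs.v *)
From Stdlib Require Import Reals Lra ClassicalEpsilon.
Open Scope R_scope.

Definition borel_set (A : R -> Prop) : Prop :=
  forall S : (R -> Prop) -> Prop,
    (forall a b, S (fun x => a < x < b)) ->
    (forall B, S B -> S (fun x => ~ B x)) ->
    (forall Bn : nat -> R -> Prop, (forall n, S (Bn n)) ->
        S (fun x => exists n, Bn n x)) ->
    S A.

Definition measurable_pos (L : R -> R) : Prop :=
  forall a, borel_set (fun x => 0 < x /\ L x < a).

Definition slowly_varying (L : R -> R) : Prop :=
  (forall x, 0 < x -> 0 < L x) /\
  forall lam, 0 < lam ->
    forall eps, 0 < eps -> exists M, forall x, M < x ->
      Rabs (L (lam * x) / L x - 1) < eps.

Definition is_Gamma (s g : R) : Prop :=
  forall eps, 0 < eps -> exists d, 0 < d /\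
    forall a b, 0 < a < d -> / d < b ->
      exists pr : Riemann_integrable (fun t => Rpower t (s - 1) * exp (- t)) a b,
        Rabs (RiemannInt pr - g) < eps.

Definition Gamma (s : R) : R := epsilon (inhabits 0) (is_Gamma s).

Definition Cgamma (gamma : R) : R :=
  Gamma (1 + gamma) * sin (gamma * PI / 2) / (PI * (2 - gamma)).

(** G(x) = F([-x,x]) for a finite symmetric Borel measure F on [-pi,pi]:
    equivalently G is nonnegative, nondecreasing, right-continuous on [0,pi]. *)
Definition symm_spectral_cdf (G : R -> R) : Prop :=
  0 <= G 0 /\
  (forall x y, 0 <= x -> x <= y -> y <= PI -> G x <= G y) /\
  (forall x, 0 <= x < PI -> forall eps, 0 < eps -> exists d, 0 < d /\
      forall y, x <= y < x + d -> Rabs (G y - G x) < eps).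

Definition RS_cos_sum (G : R -> R) (k N : nat) : R :=
  sum_f_R0 (fun j =>
     let xj1 := INR (S j) * PI / INR (S N) in
     let xj := INR j * PI / INR (S N) in
     cos (INR k * xj1) * (G xj1 - G xj)) N.

(** r_k = int_{[-pi,pi]} e^{itk} F(dt) = F({0}) + int_{(0,pi]} cos(kx) dG(x). *)
Definition is_spectral_cov (G : R -> R) (r : nat -> R) : Prop :=
  forall k, Un_cv (fun N => RS_cos_sum G k N) (r k - G 0).

(** Var(S_n) = sum_{j,l=1}^n r_{|j-l|}. *)
Definition var_S (r : nat -> R) (n : nat) : R :=
  match n with
  | O => 0
  | S m => sum_f_R0 (fun j => sum_f_R0 (fun l => r ((j - l) + (l - j))%nat) m) m
  end.

(* Main.v *)
(** The variance of S_n is the integral of the Fejer kernel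
    sin^2(nx/2) / sin^2(x/2) against dG, and everything is done by comparing G with the model
    distribution function x^(2-gamma).

    From G to the variance: integrate by parts on the scale 1/n, where the slow variation is
    uniform, and bound the tail of the kernel with Potter's inequality.

    From the variance to G: Abel summation of the variances turns the Fejer kernels into
    s^2 / (s^2 + 2 - 2 cos x), a Stieltjes kernel.  Partial fractions and limits give the powers
    of this kernel, and the polynomials 1 - (1 - z^n)^(2^n) in it are close to the indicator
    function of [0, s], which yields Karamata's theorem.

    The constant: for the model, the Abel means of the variances bring in Gamma(1 + gamma), and the
    integral of 1 / (1 + w^(2/beta)), beta = 2 - gamma, is a cosecant by the partial fractions of
    1 / sin, which follow from the Dirichlet kernel.

    The variance only sees L at the integers while G sees it at all reals; this is where the
    measurability of L enters, through the uniform convergence theorem, proved here with the Baire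
    property of Borel sets. *)

Require Import Defs.
From Stdlib Require Import Reals Lra Lia Psatz Classical ClassicalEpsilon Cantor.
From Coquelicot Require Import Coquelicot.
Open Scope R_scope.

(** * Slowly varying functions: uniform convergence by Baire category *)

(** The covariances are given as limits of sums over the uniform grid, and [G] may jump. The
    estimates for [G] are therefore proved for the sums [rs] at finite [N], with the jumps hidden
    behind summation by parts, and [N] goes to infinity last. In the comparison [L] is frozen at
    [L (/ s)]: at scale [s] the measure of [G] is set against a constant multiple of one fixed
    measure, so that estimates for the model transfer by linearity. From the variance to [G], the
    Fejer kernels are an obstacle: they have zeros and exist at the scales 1 / n only, so they do
    not bracket an indicator function. The resolvent kernel is positive, exists at every real scale,
    and its powers are again functions of the single variable [chord2 x / s ^ 2]. The variance
    constant of the model is not found by integrating the Fejer kernel. It stays unknown until the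
    Abel means are applied to the model itself and the outcome is equated with the cosecant. *)

Lemma Rpower_pos x y : 0 < Rpower x y.
Proof. apply exp_pos. Qed.

Ltac pos := repeat first
  [ assumption | lra | apply Rinv_0_lt_compat | apply Rdiv_lt_0_compat | apply Rmult_lt_0_compat
  | apply Rpower_pos | apply exp_pos | apply pow_lt | apply Rmin_glb_lt | apply Rplus_lt_0_compat
  | apply Rdiv_le_0_compat | apply Rmult_le_pos | apply pow_le | apply Rabs_pos | apply pos_INR
  | left ].

Lemma choice (A B : Type) (P : A -> B -> Prop) :
  (forall a, exists b, P a b) -> exists f : A -> B, forall a, P a (f a).
Proof.
intros H. exists (fun a => proj1_sig (constructive_indefinite_description _ (H a))).
intros a. apply proj2_sig.
Qed.

Definition open_R (U : R -> Prop) : Prop :=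
  forall x, U x -> exists d, 0 < d /\ forall y, Rabs (y - x) < d -> U y.

Definition dense_R (U : R -> Prop) : Prop :=
  forall a b, a < b -> exists x, a < x < b /\ U x.

(** The meagre exceptional set of the usual definition is the complement of the intersection of the
    dense open sets [D n]; sequences of such sets are easy to merge. *)
Definition baire_property (A : R -> Prop) : Prop :=
  exists (U : R -> Prop) (D : nat -> R -> Prop),
    open_R U /\ (forall n, open_R (D n) /\ dense_R (D n)) /\
    forall x, (forall n, D n x) -> (A x <-> U x).

Lemma open_baire U : open_R U -> baire_property U.
Proof.
intros HU. exists U, (fun _ _ => True). split; [exact HU|split].
- intros _. split.
  + intros x _. exists 1. split; [lra|auto].
  + intros a b Hab. exists ((a + b) / 2). split; [lra|auto].
- tauto.
Qed.

(** The complement of an open set need not be open; its interior [I] takes its place. The boundary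
    lost in this way is nowhere dense: the union of [U] and [I] is open and dense, and it joins the
    family as index 0. *)
Lemma baire_compl A : baire_property A -> baire_property (fun x => ~ A x).
Proof.
intros (U & D & HU & HD & HA).
set (I := fun x => exists d, 0 < d /\ forall y, Rabs (y - x) < d -> ~ U y).
assert (HI : open_R I).
{ intros x (d & Hd & Hx). exists (d / 2). split; [lra|].
  intros y Hy. exists (d / 2). split; [lra|].
  intros z Hz. apply Hx. replace (z - x) with ((z - y) + (y - x)) by ring.
  apply Rle_lt_trans with (1 := Rabs_triang _ _). lra. }
exists I, (fun n => match n with O => fun x => U x \/ I x | S n => D n end).
split; [exact HI|split].
- intros [|n]; [split|apply HD].
  + intros x [Hx|Hx].
    * destruct (HU x Hx) as (d & Hd & H). exists d. split; auto.
    * destruct (HI x Hx) as (d & Hd & H). exists d. split; auto.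
  + intros a b Hab.
    destruct (classic (exists x, a < x < b /\ U x)) as [(x & Hx & H)|Hn].
    * exists x. auto.
    * exists ((a + b) / 2). split; [lra|]. right. exists ((b - a) / 2). split; [lra|].
      intros y Hy HUy. apply Hn. exists y. split; [|exact HUy].
      apply Rabs_def2 in Hy. lra.
- intros x Hx. specialize (HA x (fun n => Hx (S n))).
  specialize (Hx O). simpl in Hx. rewrite HA. split.
  + tauto.
  + intros (d & Hd & H). apply H. rewrite Rminus_diag, Rabs_R0. exact Hd.
Qed.

(** The Cantor pairing merges countably many families of dense open sets into one. *)
Lemma baire_union (A : nat -> R -> Prop) :
  (forall n, baire_property (A n)) -> baire_property (fun x => exists n, A n x).
Proof.
intros H.
destruct (choice _ _ _ H) as (U & HU).
destruct (choice _ _ _ HU) as (D & HD).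
exists (fun x => exists n, U n x),
  (fun k => D (fst (Cantor.of_nat k)) (snd (Cantor.of_nat k))).
split; [|split].
- intros x (n & Hn). destruct (proj1 (HD n) x Hn) as (d & Hd & Hx).
  exists d. split; [exact Hd|]. intros y Hy. exists n. auto.
- intros k. apply HD.
- intros x Hx.
  assert (E : forall n, A n x <-> U n x).
  { intros n. apply (HD n). intros m. specialize (Hx (Cantor.to_nat (n, m))).
    rewrite Cantor.cancel_of_to in Hx. exact Hx. }
  split; intros (n & Hn); exists n; apply E; exact Hn.
Qed.

Lemma baire_inter (A : nat -> R -> Prop) :
  (forall n, baire_property (A n)) -> baire_property (fun x => forall n, A n x).
Proof.
intros H.
assert (H' := baire_compl _ (baire_union _ (fun n => baire_compl _ (H n)))).
destruct H' as (U & D & HU & HD & HA). exists U, D. split; [exact HU|split; [exact HD|]].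
intros x Hx. rewrite <- (HA x Hx). split.
- intros Hall (n & Hn). apply Hn, Hall.
- intros Hn n. apply NNPP. intros Hc. apply Hn. exists n. exact Hc.
Qed.

Lemma baire_and A B :
  baire_property A -> baire_property B -> baire_property (fun x => A x /\ B x).
Proof.
intros HA HB.
destruct (baire_inter (fun n => match n with O => A | _ => B end)) as (U & D & HU & HD & H).
{ intros [|n]; assumption. }
exists U, D. split; [exact HU|split; [exact HD|]].
intros x Hx. rewrite <- (H x Hx). split.
- intros [Ha Hb] [|n]; assumption.
- intros Hn. split; [exact (Hn 0%nat)|exact (Hn 1%nat)].
Qed.

(** Nested closed intervals, one inside each [D n]; the supremum of the left endpoints lies in all
    of them. *)
Lemma baire_category (D : nat -> R -> Prop) (a b : R) :
  (forall n, open_R (D n) /\ dense_R (D n)) -> a < b ->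
  exists x, a < x < b /\ forall n, D n x.
Proof.
intros HD Hab.
(* Pairs are endpoints. The premise [fst p < snd p] makes the relation total, as [choice] demands.
   The closed interval [q] lies in the open interval [p], which keeps the limit point off the
   endpoints. *)
set (P := fun (n : nat) (p q : R * R) =>
  fst p < snd p -> fst p <= fst q /\ fst q < snd q /\ snd q <= snd p /\
    (forall x, fst q <= x <= snd q -> fst p < x < snd p /\ D n x)).
assert (step : forall np : nat * (R * R), exists q, P (fst np) (snd np) q).
{ intros (n & u & v). unfold P. simpl.
  destruct (Rlt_dec u v) as [Huv|Huv].
  - destruct (HD n) as (Ho & Hd). destruct (Hd u v Huv) as (x & Hx & HDx).
    destruct (Ho x HDx) as (d & Hdp & Hball).
    set (e := Rmin (d / 2) (Rmin ((x - u) / 2) ((v - x) / 2))).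
    assert (0 < e) by pos.
    assert (e <= d / 2) by apply Rmin_l.
    assert (e <= Rmin ((x - u) / 2) ((v - x) / 2)) by apply Rmin_r.
    assert (Rmin ((x - u) / 2) ((v - x) / 2) <= (x - u) / 2) by apply Rmin_l.
    assert (Rmin ((x - u) / 2) ((v - x) / 2) <= (v - x) / 2) by apply Rmin_r.
    exists (x - e, x + e). simpl. intros _. repeat split; try lra.
    apply Hball. apply Rabs_def1; lra.
  - exists (u, v). simpl. intros H; contradiction. }
destruct (choice _ _ _ step) as (f & Hf).
set (I := fix I n := match n with O => (a, b) | S n => f (n, I n) end).
assert (HI : forall n, fst (I n) < snd (I n)).
{ induction n as [|n IH]; simpl; [exact Hab|]. apply (Hf (n, I n)). exact IH. }
assert (HS : forall n, P n (I n) (I (S n))) by (intros n; apply (Hf (n, I n))).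
assert (Hmono : forall n k, fst (I n) <= fst (I (n + k)%nat) /\ snd (I (n + k)%nat) <= snd (I n)).
{ intros n k. induction k as [|k IH].
  - rewrite Nat.add_0_r. lra.
  - rewrite Nat.add_succ_r. destruct (HS (n + k)%nat (HI _)) as (H1 & H2 & H3 & _). lra. }
assert (Hcross : forall n m, fst (I n) <= snd (I m)).
{ intros n m. destruct (Hmono n m) as [H1 _]. destruct (Hmono m n) as [_ H2].
  rewrite (Nat.add_comm m n) in H2. specialize (HI (n + m)%nat). lra. }
destruct (completeness (fun x => exists n, x = fst (I n))) as (x & Hub & Hlub).
- exists b. intros y (n & ->). apply (Hcross n 0%nat).
- exists (fst (I 0%nat)), 0%nat. reflexivity.
- assert (Hx : forall n, fst (I n) <= x <= snd (I n)).
  { intros n. split; [apply Hub; exists n; reflexivity|].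
    apply Hlub. intros y (m & ->). apply Hcross. }
  assert (Hin : forall n, fst (I n) < x < snd (I n) /\ D n x).
  { intros n. destruct (HS n (HI n)) as (_ & _ & _ & H). apply H, (Hx (S n)). }
  exists x. split; [apply (Hin 0%nat)|]. intros n. apply Hin.
Qed.

(** A generic point lies in some [V n], hence in its open representative, and near that point [V n]
    contains all generic points. A countable cover thus has a member that is comeagre in some
    interval. *)
Lemma nonmeager_cover (V : nat -> R -> Prop) (a b : R) :
  (forall n, baire_property (V n)) -> (forall x, exists n, V n x) -> a < b ->
  exists n a' b' (D : nat -> R -> Prop), a <= a' /\ a' < b' /\ b' <= b /\
    (forall k, open_R (D k) /\ dense_R (D k)) /\
    forall x, a' < x < b' -> (forall k, D k x) -> V n x.
Proof.
intros HV Hcov Hab.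
destruct (choice _ _ _ HV) as (U & HU). destruct (choice _ _ _ HU) as (D & HD).
destruct (baire_category (fun k => D (fst (Cantor.of_nat k)) (snd (Cantor.of_nat k))) a b)
  as (x & Hx & Hgen); [intros k; apply HD|exact Hab|].
assert (Hgen' : forall n m, D n m x).
{ intros n m. specialize (Hgen (Cantor.to_nat (n, m))).
  rewrite Cantor.cancel_of_to in Hgen. exact Hgen. }
destruct (Hcov x) as (n & Hn). destruct (HD n) as (Ho & HDn & Heq).
apply Heq in Hn; [|apply Hgen'].
destruct (Ho x Hn) as (d & Hd & Hball).
exists n, (Rmax a (x - d)), (Rmin b (x + d)), (D n).
split; [apply Rmax_l|split].
- apply Rmax_lub_lt; apply Rmin_glb_lt; lra.
- split; [apply Rmin_l|split; [exact HDn|]].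
  intros y [Hy1 Hy2] HDy. apply Heq; [exact HDy|]. apply Hball.
  assert (H1 := Rmax_r a (x - d)). assert (H2 := Rmin_r b (x + d)). apply Rabs_def1; lra.
Qed.

(** [borel_set] quantifies over all families closed like a sigma-algebra, so it is instantiated with
    the sets whose preimage under every [exp (c + u)] has the Baire property. *)
Lemma borel_comp_exp_baire (A : R -> Prop) (c : R) :
  borel_set A -> baire_property (fun u => A (exp (c + u))).
Proof.
intros HA. revert c. apply (HA (fun A => forall c, baire_property (fun u => A (exp (c + u))))).
- intros a b c. apply open_baire. intros u Hu.
  assert (Hc : continuity_pt (fun u => exp (c + u)) u).
  { apply continuity_pt_filterlim. apply (continuous_comp (fun u => c + u) exp).
    - apply (continuous_plus (fun _ => c) (fun u => u)); [apply continuous_const|apply continuous_id].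
    - apply continuous_exp. }
  set (e := Rmin (exp (c + u) - a) (b - exp (c + u))).
  assert (He : 0 < e) by pos.
  destruct (Hc e He) as (d & Hd & H). exists d. split; [exact Hd|].
  intros y Hy. destruct (Req_dec y u) as [->|Hne]; [exact Hu|].
  assert (Hlt : Rabs (exp (c + y) - exp (c + u)) < e).
  { apply (H y). split; [split; [exact I|auto]|exact Hy]. }
  apply Rabs_def2 in Hlt.
  assert (e <= exp (c + u) - a) by apply Rmin_l.
  assert (e <= b - exp (c + u)) by apply Rmin_r. lra.
- intros B HB c. apply (baire_compl (fun u => B (exp (c + u)))), HB.
- intros B HB c. apply (baire_union (fun n u => B n (exp (c + u)))). intros n. apply HB.
Qed.

(* A common point of two shifted comeagre sets lets one compare [h (u_m + v_m)]
   and [h u_m] through a third value. *)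
Lemma uniform_near_zero (h : R -> R)
  (hmeas : forall c a, baire_property (fun u => h (c + u) < a))
  (hsv : forall v eps, 0 < eps -> exists M, forall u, M < u -> Rabs (h (u + v) - h u) < eps)
  (eps : R) (heps : 0 < eps) :
  exists d M, 0 < d /\ forall u v, M <= u -> Rabs v <= d -> Rabs (h (u + v) - h u) <= eps.
Proof.
apply NNPP. intros Hn.
(* A failure yields base points tending to infinity and shifts tending to 0 between which [h] moves
   by more than [eps]. *)
assert (Hseq : forall m : nat, exists p : R * R,
  INR m <= fst p /\ Rabs (snd p) <= / INR (S m) /\ eps < Rabs (h (fst p + snd p) - h (fst p))).
{ intros m. apply NNPP. intros Hm. apply Hn. exists (/ INR (S m)), (INR m).
  split; [apply Rinv_0_lt_compat, lt_0_INR; lia|].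
  intros u v Hu Hv. apply Rnot_lt_le. intros Hlt. apply Hm. exists (u, v). auto. }
destruct (choice _ _ _ Hseq) as (p & Hp).
(* [T c N] collects the shifts that are harmless for every base point from the N-th on; pointwise
   convergence makes these sets cover the line. The half-open condition splits into a sublevel set
   and the complement of one, the sets that [hmeas] covers. *)
set (T := fun (c : nat -> R) (N : nat) (x : R) =>
  forall m, h (c (N + m)%nat) - eps / 2 <= h (c (N + m)%nat + x) < h (c (N + m)%nat) + eps / 2).
assert (HTb : forall c N, baire_property (T c N)).
{ intros c N. apply (baire_inter (fun m x =>
    h (c (N + m)%nat) - eps / 2 <= h (c (N + m)%nat + x) < h (c (N + m)%nat) + eps / 2)).
  intros m. apply (baire_and (fun x => _ <= h (_ + x)) (fun x => h (_ + x) < _)); [|apply hmeas].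
  destruct (baire_compl _ (hmeas (c (N + m)%nat) (h (c (N + m)%nat) - eps / 2)))
    as (U & D & HU & HD & H).
  exists U, D. split; [exact HU|split; [exact HD|]].
  intros x Hx. rewrite <- (H x Hx). split; [apply Rle_not_lt|apply Rnot_lt_le]. }
assert (HTc : forall c : nat -> R, (forall m, INR m - 1 <= c m) -> forall x, exists N, T c N x).
{ intros c Hc x. destruct (hsv x (eps / 2)) as (M & HM); [lra|].
  destruct (INR_unbounded (M + 1)) as (N & HN). exists N. intros m.
  assert (Hlt : Rabs (h (c (N + m)%nat + x) - h (c (N + m)%nat)) < eps / 2).
  { apply HM. specialize (Hc (N + m)%nat). rewrite plus_INR in Hc. generalize (pos_INR m). lra. }
  apply Rabs_def2 in Hlt. lra. }
assert (HTm : forall c N K x, (N <= K)%nat -> T c N x -> T c K x).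
{ intros c N K x HNK H m. replace (K + m)%nat with (N + (K - N + m))%nat by lia. apply H. }
set (c1 := fun m => fst (p m)). set (c2 := fun m => fst (p m) + snd (p m)).
destruct (nonmeager_cover (T c1) 0 1 (HTb c1)) as (N1 & a1 & b1 & D1 & _ & Hab1 & _ & HD1 & HT1);
  [|lra|].
{ apply HTc. intros m. destruct (Hp m). unfold c1. lra. }
(* The second cover is taken inside the interval of the first, so that both sets are comeagre on a
   common interval. *)
destruct (nonmeager_cover (T c2) a1 b1 (HTb c2)) as (N2 & a & b & D2 & Ha & Hab & Hb & HD2 & HT2);
  [|lra|].
{ apply HTc. intros m. destruct (Hp m) as (H1 & H2 & _). unfold c2.
  assert (/ INR (S m) <= 1).
  { rewrite <- Rinv_1. apply Rinv_le_contravar; [lra|]. rewrite S_INR. generalize (pos_INR m). lra. }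
  generalize (Rabs_def2 (snd (p m)) (/ INR (S m) + / 2)).
  assert (Rabs (- snd (p m)) <= / INR (S m)) by (rewrite Rabs_Ropp; exact H2).
  generalize (RRle_abs (- snd (p m))). lra. }
destruct (INR_unbounded (2 / (b - a))) as (N3 & HN3).
set (N := (N1 + N2 + N3)%nat).
set (v := snd (p N)).
assert (Hv : Rabs v < (b - a) / 2).
{ destruct (Hp N) as (_ & H2 & _). apply Rle_lt_trans with (1 := H2).
  replace ((b - a) / 2) with (/ (2 / (b - a))) by (field; lra).
  assert (0 < 2 / (b - a)) by pos.
  assert (INR N3 <= INR (S N)) by (apply le_INR; unfold N; lia).
  apply Rinv_lt_contravar; [apply Rmult_lt_0_compat|]; lra. }
apply Rabs_def2 in Hv.
(* Even indices list [D1], odd ones [D2] shifted by [v]. A generic [x] lies in the first set while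
   [x - v] lies in the second, and both memberships compare with the same value of [h], at the N-th
   base point plus [x]. *)
destruct (baire_category (fun n => if Nat.even n then D1 (Nat.div2 n)
    else fun x => D2 (Nat.div2 n) (x - v)) (Rmax a (a + v)) (Rmin b (b + v))) as (x & Hx & HDx).
{ intros n. destruct (Nat.even n); [apply HD1|].
  destruct (HD2 (Nat.div2 n)) as (Ho & Hd). split.
  - intros y Hy. destruct (Ho _ Hy) as (d & Hd' & H). exists d. split; [exact Hd'|].
    intros z Hz. apply H. replace (z - v - (y - v)) with (z - y) by ring. exact Hz.
  - intros y z Hyz. destruct (Hd (y - v) (z - v)) as (w & Hw & H); [lra|].
    exists (w + v). split; [lra|]. replace (w + v - v) with w by ring. exact H. }
{ apply Rmax_lub_lt; apply Rmin_glb_lt; lra. }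
assert (Hm1 := Rmax_l a (a + v)). assert (Hm2 := Rmax_r a (a + v)).
assert (Hm3 := Rmin_l b (b + v)). assert (Hm4 := Rmin_r b (b + v)).
assert (G1 : T c1 N x).
{ apply (HTm _ N1); [unfold N; lia|]. apply HT1; [lra|]. intros k.
  specialize (HDx (2 * k)%nat). rewrite Nat.even_even, Nat.div2_double in HDx. exact HDx. }
assert (G2 : T c2 N (x - v)).
{ apply (HTm _ N2); [unfold N; lia|]. apply HT2; [lra|]. intros k.
  specialize (HDx (2 * k + 1)%nat). rewrite Nat.even_odd, Nat.add_1_r, Nat.div2_succ_double in HDx.
  exact HDx. }
specialize (G1 0%nat). specialize (G2 0%nat). rewrite Nat.add_0_r in G1, G2.
destruct (Hp N) as (_ & _ & H3). unfold c1, c2 in *. fold v in G2, H3.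
replace (fst (p N) + v + (x - v)) with (fst (p N) + x) in G2 by ring.
revert H3. apply Rle_not_lt. apply Rabs_le. lra.
Qed.

(** A shift of size between [k d] and [(k + 1) d] is a fixed shift, controlled by pointwise
    convergence, followed by one of size at most [d]. The bound does not deteriorate with [k]: the
    induction hypothesis serves only the shifts up to [k d]. *)
Lemma uniform_on_bounded (h : R -> R)
  (hloc : forall eps, 0 < eps -> exists d M, 0 < d /\
     forall u v, M <= u -> Rabs v <= d -> Rabs (h (u + v) - h u) <= eps)
  (hsv : forall v eps, 0 < eps -> exists M, forall u, M < u -> Rabs (h (u + v) - h u) < eps)
  (eps B : R) (heps : 0 < eps) :
  exists M, forall u v, M <= u -> Rabs v <= B -> Rabs (h (u + v) - h u) <= eps.
Proof.
destruct (hloc (eps / 2)) as (d & M0 & Hd & Hloc); [lra|].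
assert (Hk : forall k : nat, exists M, forall u v, M <= u -> Rabs v <= INR k * d ->
  Rabs (h (u + v) - h u) <= eps).
{ induction k as [|k (M1 & IH)].
  - exists M0. intros u v Hu Hv. simpl in Hv. rewrite Rmult_0_l in Hv.
    apply Rle_trans with (eps / 2); [apply Hloc; lra|lra].
  - destruct (hsv (INR k * d) (eps / 2)) as (M2 & H2); [lra|].
    destruct (hsv (- (INR k * d)) (eps / 2)) as (M3 & H3); [lra|].
    assert (0 <= INR k * d) by pos.
    exists (Rmax (Rmax M1 (M0 + INR k * d)) (Rmax (M2 + 1) (M3 + 1))).
    intros u v Hu Hv.
    assert (M1 <= u /\ M0 + INR k * d <= u /\ M2 + 1 <= u /\ M3 + 1 <= u) as (U1 & U2 & U3 & U4).
    { repeat split; refine (Rle_trans _ _ _ _ Hu).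
      - apply Rle_trans with (2 := Rmax_l _ _), Rmax_l.
      - apply Rle_trans with (2 := Rmax_l _ _), Rmax_r.
      - apply Rle_trans with (2 := Rmax_r _ _), Rmax_l.
      - apply Rle_trans with (2 := Rmax_r _ _), Rmax_r. }
    rewrite S_INR in Hv.
    destruct (Rle_dec (Rabs v) (INR k * d)) as [Hle|Hgt]; [apply IH; assumption|].
    assert (Hs : exists w, (w = INR k * d \/ w = - (INR k * d)) /\ Rabs (v - w) <= d).
    { unfold Rabs in Hv, Hgt. destruct (Rcase_abs v).
      - exists (- (INR k * d)). split; [auto|]. apply Rabs_le. lra.
      - exists (INR k * d). split; [auto|]. apply Rabs_le. lra. }
    destruct Hs as (w & Hw & Hvw).
    replace (h (u + v) - h u) with ((h (u + w + (v - w)) - h (u + w)) + (h (u + w) - h u))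
      by (replace (u + w + (v - w)) with (u + v) by ring; ring).
    apply Rle_trans with (1 := Rabs_triang _ _).
    assert (Rabs (h (u + w + (v - w)) - h (u + w)) <= eps / 2).
    { apply Hloc; [destruct Hw as [-> | ->]; lra|exact Hvw]. }
    assert (Rabs (h (u + w) - h u) < eps / 2).
    { destruct Hw as [-> | ->]; [apply H2|apply H3]; lra. }
    lra. }
destruct (INR_unbounded (B / d)) as (k & Hkb).
destruct (Hk k) as (M & HM). exists M. intros u v Hu Hv. apply HM; [exact Hu|].
apply Rle_trans with (1 := Hv). apply Rmult_le_reg_r with (/ d); [apply Rinv_0_lt_compat; lra|].
replace (INR k * d * / d) with (INR k) by (field; lra). unfold Rdiv in Hkb. lra.
Qed.

(** Unit steps cost at most [a] each, and at most [v + 1] of them are needed. *)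
Lemma linear_growth (h : R -> R) (M a : R) (ha : 0 < a)
  (hu : forall u v, M <= u -> Rabs v <= 1 -> Rabs (h (u + v) - h u) <= a) :
  forall u v, M <= u -> 0 <= v -> Rabs (h (u + v) - h u) <= a * (v + 1).
Proof.
assert (Hk : forall k : nat, forall u v, M <= u -> 0 <= v <= INR k ->
  Rabs (h (u + v) - h u) <= a * (v + 1)).
{ induction k as [|k IH]; intros u v Hu Hv.
  - simpl in Hv. replace v with 0 by lra. replace (u + 0) with u by ring.
    rewrite Rminus_diag, Rabs_R0. lra.
  - destruct (Rle_dec v 1) as [H1|H1].
    + apply Rle_trans with a; [apply hu; [lra|rewrite Rabs_pos_eq; lra]|nra].
    + rewrite S_INR in Hv.
      replace (h (u + v) - h u) with ((h (u + 1 + (v - 1)) - h (u + 1)) + (h (u + 1) - h u))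
        by (replace (u + 1 + (v - 1)) with (u + v) by ring; ring).
      apply Rle_trans with (1 := Rabs_triang _ _).
      assert (Rabs (h (u + 1 + (v - 1)) - h (u + 1)) <= a * (v - 1 + 1)) by (apply IH; lra).
      assert (Rabs (h (u + 1) - h u) <= a) by (apply hu; [lra|rewrite Rabs_R1; lra]).
      nra. }
intros u v Hu Hv. destruct (INR_unbounded v) as (k & Hkv). apply (Hk k); lra.
Qed.

(** * Uniform convergence theorem and Potter bounds in multiplicative form *)

Definition locally_uniform_sv (L : R -> R) : Prop :=
  forall eps B, 0 < eps -> 1 <= B -> exists M, 0 < M /\
    forall x lam, M <= x -> / B <= lam <= B -> Rabs (L (lam * x) / L x - 1) < eps.

Definition potter_bounds (L : R -> R) : Prop :=
  forall a, 0 < a -> exists M C, 0 < M /\ 1 <= C /\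
    forall x y, M <= x -> x <= y ->
      L y <= C * Rpower (y / x) a * L x /\ L x <= C * Rpower (y / x) a * L y.

Lemma exp_le_mono x y : x <= y -> exp x <= exp y.
Proof. intros [H|H]; [left; apply exp_increasing, H|rewrite H; apply Rle_refl]. Qed.

Section SlowlyVarying.

Variable L : R -> R.
Hypothesis hLm : measurable_pos L.
Hypothesis hL : slowly_varying L.

(** Logarithmic coordinates turn dilations into translations: slow variation says that
    [h (u + v) - h u] tends to 0 for each [v]. *)
Let h u := ln (L (exp u)).

Lemma ln_sv_measurable c a : baire_property (fun u => h (c + u) < a).
Proof.
destruct (borel_comp_exp_baire _ c (hLm (exp a))) as (U & D & HU & HD & H).
exists U, D. split; [exact HU|split; [exact HD|]]. intros x Hx. rewrite <- (H x Hx).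
assert (He := exp_pos (c + x)). assert (HLx := proj1 hL _ He). unfold h. split.
- intros Hlt. split; [exact He|]. rewrite <- (exp_ln (L _) HLx). apply exp_increasing, Hlt.
- intros [_ Hlt]. apply exp_lt_inv. rewrite (exp_ln _ HLx). exact Hlt.
Qed.

Lemma ln_sv_translate v eps : 0 < eps ->
  exists M, forall u, M < u -> Rabs (h (u + v) - h u) < eps.
Proof.
intros Heps.
assert (Hc : continuity_pt ln 1).
{ apply derivable_continuous_pt. exists (/ 1). apply derivable_pt_lim_ln. lra. }
destruct (Hc eps Heps) as (d & Hd & H).
destruct (proj2 hL (exp v) (exp_pos v) d Hd) as (M & HM).
exists (ln (Rmax M 1)). intros u Hu.
assert (Hm1 := Rmax_l M 1). assert (Hm2 := Rmax_r M 1).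
assert (Heu : Rmax M 1 < exp u).
{ rewrite <- (exp_ln (Rmax M 1)); [apply exp_increasing, Hu|lra]. }
unfold h. rewrite <- ln_div; [|apply (proj1 hL), exp_pos|apply (proj1 hL), exp_pos].
rewrite exp_plus, (Rmult_comm (exp u)).
specialize (HM (exp u)). set (q := L (exp v * exp u) / L (exp u)) in *.
destruct (Req_dec q 1) as [->|Hne]; [rewrite ln_1, Rabs_R0; exact Heps|].
specialize (H q). simpl in H. unfold R_dist in H. rewrite ln_1, Rminus_0_r in H.
apply H. split; [split; [exact I|auto]|apply HM; lra].
Qed.

Lemma ln_sv_bounded eps B : 0 < eps ->
  exists M, forall u v, M <= u -> Rabs v <= B -> Rabs (h (u + v) - h u) <= eps.
Proof.
intros Heps. apply uniform_on_bounded; [|apply ln_sv_translate|exact Heps].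
intros e He. apply uniform_near_zero; [apply ln_sv_measurable|apply ln_sv_translate|exact He].
Qed.

Lemma slowly_varying_uniform : locally_uniform_sv L.
Proof.
intros eps B Heps HB.
assert (Hc : continuity_pt exp 0) by (apply continuity_pt_filterlim, continuous_exp).
destruct (Hc eps Heps) as (d & Hd & H).
destruct (ln_sv_bounded (d / 2) (ln B)) as (M & HM); [lra|].
exists (exp M). split; [apply exp_pos|]. intros x lam Hx Hlam.
assert (0 < / B) by pos.
assert (0 < x) by (generalize (exp_pos M); lra).
assert (Hq : Rabs (ln (L (lam * x) / L x)) <= d / 2).
{ rewrite ln_div; [|apply (proj1 hL); nra|apply (proj1 hL); lra].
  replace (L (lam * x)) with (L (exp (ln x + ln lam)))
    by (rewrite exp_plus, !exp_ln by lra; f_equal; ring).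
  replace (L x) with (L (exp (ln x))) by (rewrite exp_ln by lra; reflexivity).
  apply HM.
  - rewrite <- (ln_exp M). apply ln_le; [apply exp_pos|exact Hx].
  - apply Rabs_le. rewrite <- ln_Rinv by lra. split; apply ln_le; lra. }
assert (Hpos : 0 < L (lam * x) / L x) by (apply Rdiv_lt_0_compat; apply (proj1 hL); nra).
set (q := ln (L (lam * x) / L x)) in *.
replace (L (lam * x) / L x) with (exp q) by (apply exp_ln, Hpos).
destruct (Req_dec q 0) as [->|Hne]; [rewrite exp_0, Rminus_diag, Rabs_R0; exact Heps|].
specialize (H q). simpl in H. unfold R_dist in H. rewrite exp_0, Rminus_0_r in H.
apply H. split; [split; [exact I|auto]|lra].
Qed.

(** The exponential of [linear_growth] with slope [a]; the additive 1 there becomes the factor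
    [C = exp a]. *)
Lemma slowly_varying_potter : potter_bounds L.
Proof.
intros a Ha. destruct (ln_sv_bounded a 1 Ha) as (M & HM).
assert (Hg := linear_growth h M a Ha HM).
exists (exp M), (exp a). split; [apply exp_pos|split].
{ generalize (exp_ineq1_le a). lra. }
intros x y Hx Hxy. assert (0 < x) by (generalize (exp_pos M); lra).
assert (HMx : M <= ln x) by (rewrite <- (ln_exp M); apply ln_le; [apply exp_pos|exact Hx]).
assert (Hxy' : 0 <= ln y - ln x) by (generalize (ln_le x y); lra).
specialize (Hg (ln x) (ln y - ln x) HMx Hxy').
replace (ln x + (ln y - ln x)) with (ln y) in Hg by ring.
unfold h in Hg. rewrite !exp_ln in Hg by lra.
assert (Lx := proj1 hL x ltac:(lra)). assert (Ly := proj1 hL y ltac:(lra)).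
unfold Rpower. rewrite ln_div by lra. rewrite <- exp_plus.
replace (a + a * (ln y - ln x)) with (a * (ln y - ln x + 1)) by ring.
apply Rabs_le_between in Hg. split.
- rewrite <- (exp_ln (L y)), <- (exp_ln (L x)) at 1 by assumption. rewrite <- exp_plus.
  apply exp_le_mono. lra.
- rewrite <- (exp_ln (L x)), <- (exp_ln (L y)) at 1 by assumption. rewrite <- exp_plus.
  apply exp_le_mono. lra.
Qed.

End SlowlyVarying.

(** * Riemann-Stieltjes sums *)

Fixpoint sm (f : nat -> R) (n : nat) : R :=
  match n with O => 0 | S m => sm f m + f m end.

Lemma sm_S f n : sm f (S n) = sm f n + f n.
Proof. reflexivity. Qed.

Lemma sm_ext f g n : (forall i, (i < n)%nat -> f i = g i) -> sm f n = sm g n.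
Proof.
induction n as [|n IH]; intros H; simpl; [reflexivity|].
rewrite IH, H by (intros; try apply H; lia). reflexivity.
Qed.

Lemma sm_lin a b f g n : sm (fun i => a * f i + b * g i) n = a * sm f n + b * sm g n.
Proof. induction n as [|n IH]; simpl; [|rewrite IH]; ring. Qed.

Lemma sm_scal a f n : sm (fun i => a * f i) n = a * sm f n.
Proof. induction n as [|n IH]; simpl; [|rewrite IH]; ring. Qed.

Lemma sm_minus f g n : sm (fun i => f i - g i) n = sm f n - sm g n.
Proof. induction n as [|n IH]; simpl; [|rewrite IH]; ring. Qed.

Lemma sm_le f g n : (forall i, (i < n)%nat -> f i <= g i) -> sm f n <= sm g n.
Proof.
induction n as [|n IH]; intros H; simpl; [lra|].
assert (f n <= g n) by (apply H; lia). assert (sm f n <= sm g n) by (apply IH; intros; apply H; lia).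
lra.
Qed.

Lemma sm_ge0 f n : (forall i, (i < n)%nat -> 0 <= f i) -> 0 <= sm f n.
Proof.
intros H. apply Rle_trans with (sm (fun _ => 0 * 0) n); [rewrite sm_scal; lra|].
apply sm_le. intros i Hi. specialize (H i Hi). lra.
Qed.

Lemma sm_abs f n : Rabs (sm f n) <= sm (fun i => Rabs (f i)) n.
Proof.
induction n as [|n IH]; simpl; [rewrite Rabs_R0; lra|].
apply Rle_trans with (1 := Rabs_triang _ _). lra.
Qed.

Lemma sm_telescope f n : sm (fun i => f (S i) - f i) n = f n - f 0%nat.
Proof. induction n as [|n IH]; simpl; [|rewrite IH]; ring. Qed.

Lemma sm_const c n : sm (fun _ => c) n = INR n * c.
Proof. induction n as [|n IH]; [simpl|rewrite S_INR; simpl; rewrite IH]; ring. Qed.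

Lemma sm_split f n m : sm f (n + m) = sm f n + sm (fun i => f (n + i)%nat) m.
Proof.
induction m as [|m IH]; [rewrite Nat.add_0_r; simpl; ring|].
rewrite Nat.add_succ_r. simpl. rewrite IH. ring.
Qed.

Lemma sum_f_R0_sm f n : sum_f_R0 f n = sm f (S n).
Proof. induction n as [|n IH]; simpl; [ring|]. rewrite IH. reflexivity. Qed.

Definition grid (N j : nat) : R := INR j * PI / INR (S N).

(** [rs H N f] approximates the integral of [f] against the measure with distribution function
    [H], an atom [H 0] at the origin included. *)
Definition rs (H : R -> R) (N : nat) (f : R -> R) : R :=
  f 0 * H 0 + sm (fun j => f (grid N (S j)) * (H (grid N (S j)) - H (grid N j))) (S N).

Lemma grid_0 N : grid N 0 = 0.
Proof. unfold grid. simpl INR at 1. unfold Rdiv. ring. Qed.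

Lemma grid_end N : grid N (S N) = PI.
Proof. unfold grid. field. apply not_0_INR. lia. Qed.

Lemma grid_S N j : grid N (S j) = grid N j + PI / INR (S N).
Proof. unfold grid. rewrite (S_INR j). field. apply not_0_INR. lia. Qed.

Lemma mesh_pos N : 0 < PI / INR (S N).
Proof. apply Rdiv_lt_0_compat; [apply PI_RGT_0|apply lt_0_INR; lia]. Qed.

Lemma grid_le N i j : (i <= j)%nat -> grid N i <= grid N j.
Proof.
intros Hij. induction Hij as [|j Hij IH]; [lra|].
rewrite grid_S. generalize (mesh_pos N). lra.
Qed.

Lemma grid_range N j : (j <= S N)%nat -> 0 <= grid N j <= PI.
Proof.
intros Hj. assert (H1 := grid_le N 0 j ltac:(lia)). assert (H2 := grid_le N j (S N) Hj).
rewrite grid_0 in H1. rewrite grid_end in H2. lra.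
Qed.

Lemma rs_ext H N f g : (forall x, 0 <= x <= PI -> f x = g x) -> rs H N f = rs H N g.
Proof.
intros Hfg. unfold rs. rewrite (Hfg 0) by (generalize PI_RGT_0; lra). f_equal.
apply sm_ext. intros j Hj. rewrite Hfg; [reflexivity|apply grid_range; lia].
Qed.

Lemma rs_lin H N a b f g :
  rs H N (fun x => a * f x + b * g x) = a * rs H N f + b * rs H N g.
Proof.
unfold rs. rewrite (sm_ext _ (fun j =>
  a * (f (grid N (S j)) * (H (grid N (S j)) - H (grid N j))) +
  b * (g (grid N (S j)) * (H (grid N (S j)) - H (grid N j))))) by (intros; ring).
rewrite sm_lin. ring.
Qed.

Lemma rs_scal H N a f : rs H N (fun x => a * f x) = a * rs H N f.
Proof.
replace (a * rs H N f) with (a * rs H N f + 0 * rs H N f) by ring. rewrite <- rs_lin.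
apply rs_ext. intros. ring.
Qed.

Lemma rs_plus H N f g : rs H N (fun x => f x + g x) = rs H N f + rs H N g.
Proof.
replace (rs H N f + rs H N g) with (1 * rs H N f + 1 * rs H N g) by ring. rewrite <- rs_lin.
apply rs_ext. intros. ring.
Qed.

Lemma rs_minus H N f g : rs H N (fun x => f x - g x) = rs H N f - rs H N g.
Proof.
replace (rs H N f - rs H N g) with (1 * rs H N f + (-1) * rs H N g) by ring.
rewrite <- rs_lin. apply rs_ext. intros. ring.
Qed.

Lemma rs_sm H N (f : nat -> R -> R) n :
  rs H N (fun x => sm (fun k => f k x) n) = sm (fun k => rs H N (f k)) n.
Proof.
induction n as [|n IH]; simpl.
- rewrite (rs_ext H N _ (fun x => 0 * 0)) by (intros; ring). rewrite rs_scal. ring.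
- rewrite rs_plus, IH. reflexivity.
Qed.

Lemma rs_measure H1 H2 a b N f :
  rs (fun x => a * H1 x + b * H2 x) N f = a * rs H1 N f + b * rs H2 N f.
Proof.
unfold rs. rewrite (sm_ext _ (fun j =>
  a * (f (grid N (S j)) * (H1 (grid N (S j)) - H1 (grid N j))) +
  b * (f (grid N (S j)) * (H2 (grid N (S j)) - H2 (grid N j))))) by (intros; ring).
rewrite sm_lin. ring.
Qed.

Definition nondecreasing_pos (H : R -> R) : Prop :=
  0 <= H 0 /\ forall x y, 0 <= x -> x <= y -> y <= PI -> H x <= H y.

Lemma nondecreasing_pos_ge0 H x : nondecreasing_pos H -> 0 <= x <= PI -> 0 <= H x.
Proof. intros [H0 Hm] Hx. apply Rle_trans with (1 := H0). apply Hm; lra. Qed.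

Lemma grid_incr H N j : nondecreasing_pos H -> (j < S N)%nat -> 0 <= H (grid N (S j)) - H (grid N j).
Proof.
intros [_ Hm] Hj. assert (H (grid N j) <= H (grid N (S j))); [|lra].
apply Hm; [apply grid_range; lia|apply grid_le; lia|apply grid_range; lia].
Qed.

Lemma rs_le H N f g : nondecreasing_pos H ->
  (forall x, 0 <= x <= PI -> f x <= g x) -> rs H N f <= rs H N g.
Proof.
intros HH Hfg. unfold rs. apply Rplus_le_compat.
- apply Rmult_le_compat_r; [apply HH|apply Hfg; generalize PI_RGT_0; lra].
- apply sm_le. intros j Hj. apply Rmult_le_compat_r; [apply grid_incr; assumption|].
  apply Hfg, grid_range; lia.
Qed.

Lemma rs_const H N c : rs H N (fun _ => c) = c * H PI.
Proof.
unfold rs. rewrite sm_scal.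
rewrite (sm_telescope (fun j => H (grid N j))), grid_0, grid_end. ring.
Qed.

Lemma rs_abs H N f g : nondecreasing_pos H ->
  (forall x, 0 <= x <= PI -> Rabs (f x) <= g x) -> Rabs (rs H N f) <= rs H N g.
Proof.
intros HH Hfg. apply Rabs_le. split.
- replace (- rs H N g) with ((-1) * rs H N g) by ring. rewrite <- rs_scal.
  apply rs_le; [exact HH|]. intros x Hx. specialize (Hfg x Hx). apply Rabs_le_between in Hfg. lra.
- apply rs_le; [exact HH|]. intros x Hx. specialize (Hfg x Hx). apply Rabs_le_between in Hfg. lra.
Qed.

Definition cutoff (b : R) (f : R -> R) (x : R) : R := if Rle_dec x b then f x else 0.

(* Summation by parts: the jumps of [H] never appear, only its supremum. *)
Lemma rs_cutoff_bound H N f b K M : 0 <= b -> 0 <= K -> 0 <= M ->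
  (forall x, 0 <= x <= PI -> x <= b -> Rabs (H x) <= M) ->
  (forall x, 0 <= x <= PI -> Rabs (f x) <= 1) ->
  (forall x y, 0 <= x <= PI -> 0 <= y <= PI -> Rabs (f x - f y) <= K * Rabs (x - y)) ->
  Rabs (rs H N (cutoff b f)) <= M * (1 + K * b).
Proof.
intros Hb HK HM HH Hf Hlip.
set (S_ := fun m => cutoff b f 0 * H 0 +
  sm (fun j => cutoff b f (grid N (S j)) * (H (grid N (S j)) - H (grid N j))) m).
assert (Hcut : forall x, x <= b -> cutoff b f x = f x).
{ intros x Hx. unfold cutoff. destruct (Rle_dec x b); [reflexivity|contradiction]. }
(* The invariant of Abel summation: up to the boundary term at the current grid point, the partial
   sum grows by at most [M * K] times the mesh per cell. Past [b] the cutoff freezes it. *)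
assert (Hmain : forall m, (m <= S N)%nat ->
  (grid N m <= b -> Rabs (S_ m - f (grid N m) * H (grid N m)) <= M * K * grid N m) /\
  Rabs (S_ m) <= M * (1 + K * b)).
{ assert (Hsnd : forall m, (m <= S N)%nat -> grid N m <= b ->
    Rabs (S_ m - f (grid N m) * H (grid N m)) <= M * K * grid N m ->
    Rabs (S_ m) <= M * (1 + K * b)).
  { intros m Hm Hmb H1. assert (Hr := grid_range N m Hm).
    replace (S_ m) with ((S_ m - f (grid N m) * H (grid N m)) + f (grid N m) * H (grid N m)) by ring.
    apply Rle_trans with (1 := Rabs_triang _ _). rewrite Rabs_mult.
    assert (Rabs (f (grid N m)) * Rabs (H (grid N m)) <= 1 * M).
    { apply Rmult_le_compat; try apply Rabs_pos; auto. }
    assert (M * K * grid N m <= M * K * b) by (apply Rmult_le_compat_l; [nra|lra]). nra. }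
  induction m as [|m IH]; intros Hm.
  - assert (H0 : Rabs (S_ 0%nat - f (grid N 0) * H (grid N 0)) <= M * K * grid N 0).
    { unfold S_. simpl sm. rewrite grid_0, Hcut by lra.
      replace (f 0 * H 0 + 0 - f 0 * H 0) with 0 by ring. rewrite Rabs_R0. lra. }
    split; [intros _; exact H0|]. apply (Hsnd 0%nat); [lia|rewrite grid_0; lra|exact H0].
  - destruct IH as [IH1 IH2]; [lia|].
    assert (Hle := grid_le N m (S m) ltac:(lia)).
    assert (HSr := grid_range N (S m) Hm). assert (Hr := grid_range N m ltac:(lia)).
    destruct (Rle_dec (grid N (S m)) b) as [Hin|Hout].
    + assert (H1 : Rabs (S_ (S m) - f (grid N (S m)) * H (grid N (S m))) <= M * K * grid N (S m)).
      { replace (S_ (S m)) with (S_ m + f (grid N (S m)) * (H (grid N (S m)) - H (grid N m))).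
        2: { unfold S_. simpl sm. rewrite (Hcut (grid N (S m))) by exact Hin. ring. }
        replace (_ - f (grid N (S m)) * H (grid N (S m))) with
          ((S_ m - f (grid N m) * H (grid N m)) - (f (grid N (S m)) - f (grid N m)) * H (grid N m))
          by ring.
        apply Rle_trans with (1 := Rabs_triang _ _). rewrite Rabs_Ropp, Rabs_mult.
        specialize (IH1 ltac:(lra)). specialize (Hlip _ _ HSr Hr).
        rewrite (Rabs_pos_eq (grid N (S m) - grid N m)) in Hlip by lra.
        assert (Rabs (f (grid N (S m)) - f (grid N m)) * Rabs (H (grid N m)) <=
          K * (grid N (S m) - grid N m) * M).
        { apply Rmult_le_compat; try apply Rabs_pos; [exact Hlip|apply HH; lra]. }
        nra. }
      split; [intros _; exact H1|]. apply (Hsnd (S m)); assumption.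
    + split; [intros; contradiction|].
      replace (S_ (S m)) with (S_ m); [exact IH2|].
      assert (Hz : cutoff b f (grid N (S m)) = 0).
      { unfold cutoff. destruct (Rle_dec (grid N (S m)) b); [contradiction|reflexivity]. }
      unfold S_. simpl sm. rewrite Hz. ring. }
apply (Hmain (S N)). lia.
Qed.

Lemma bernoulli_Rpower x p : 0 < x -> 0 < p <= 1 -> Rpower x p <= 1 + p * (x - 1).
Proof.
intros Hx Hp. destruct (Req_dec p 1) as [->|Hp1]; [rewrite Rpower_1 by exact Hx; lra|].
(* tangent line of [exp] at the weighted mean of [0] and [ln x] *)
unfold Rpower.
assert (Ht : forall y z, exp z * (1 + (y - z)) <= exp y).
{ intros y z. replace (exp y) with (exp z * exp (y - z)) by (rewrite <- exp_plus; f_equal; ring).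
  apply Rmult_le_compat_l; [left; apply exp_pos|]. apply exp_ineq1_le. }
assert (H1 := Ht (ln x) (p * ln x)). assert (H2 := Ht 0 (p * ln x)).
rewrite exp_ln in H1 by exact Hx. rewrite exp_0 in H2.
set (E := exp (p * ln x)) in *. set (l := ln x) in *. nra.
Qed.

(** Discrete form of y^th d(-y^(-2)) = 2 / (2 - th) d(-y^(th - 2)). Bernoulli's inequality for the
    square of [y / z] with exponent [(2 - th) / 2] turns the identity of differentials into an
    inequality of increments. *)
Lemma Rpower_decr_diff y z th : 0 < y <= z -> 0 < th < 2 ->
  Rpower y th * (/ (y * y) - / (z * z)) <=
  2 / (2 - th) * (Rpower y (th - 2) - Rpower z (th - 2)).
Proof.
intros Hyz Hth.
assert (Hsq : forall u, 0 < u -> / (u * u) = Rpower u (-2)).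
{ intros u Hu. replace (-2) with (- (2)) by ring. rewrite Rpower_Ropp. f_equal.
  replace 2 with (1 + 1) by ring. rewrite Rpower_plus, Rpower_1 by exact Hu. reflexivity. }
rewrite !Hsq by lra.
assert (B := bernoulli_Rpower (Rpower (y / z) 2) ((2 - th) / 2) (Rpower_pos _ _) ltac:(lra)).
rewrite Rpower_mult in B. replace (2 * ((2 - th) / 2)) with (2 - th) in B by field.
assert (E1 : Rpower y th * Rpower y (-2) = Rpower y (th - 2)).
{ rewrite <- Rpower_plus. f_equal. }
assert (E2 : Rpower y (th - 2) * Rpower (y / z) 2 = Rpower y th * Rpower z (-2)).
{ unfold Rpower. rewrite ln_div by lra. rewrite <- !exp_plus. f_equal. ring. }
assert (E3 : Rpower y (th - 2) * Rpower (y / z) (2 - th) = Rpower z (th - 2)).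
{ unfold Rpower. rewrite ln_div by lra. rewrite <- !exp_plus. f_equal. ring. }
assert (P := Rpower_pos y (th - 2)).
apply Rmult_le_reg_l with ((2 - th) / 2); [lra|].
replace ((2 - th) / 2 * (2 / (2 - th) * (Rpower y (th - 2) - Rpower z (th - 2))))
  with (Rpower y (th - 2) - Rpower z (th - 2)) by (field; lra).
rewrite Rmult_minus_distr_l, E1, <- E2, <- E3.
apply Rmult_le_compat_l with (r := Rpower y (th - 2)) in B; [|lra]. nra.
Qed.

(** Summation by parts moves the increments to y^(-2), and for [th] below 2 they telescope by
    [Rpower_decr_diff]. Truncating the argument at [B] makes the weight constant on the initial
    stretch, so one formula serves the whole grid. *)
Lemma rs_tail_bound H N B n th M : nondecreasing_pos H -> 0 < B -> 0 <= n -> 0 < th < 2 -> 0 <= M ->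
  (forall x, 0 <= x <= PI -> H x <= M * Rpower (Rmax B (n * x)) th) ->
  rs H N (fun x => / (Rmax B (n * x) * Rmax B (n * x))) <= 2 / (2 - th) * M * Rpower B (th - 2).
Proof.
intros HH HB Hn Hth HM Hbd.
set (y := fun j => Rmax B (n * grid N j)).
assert (Hy : forall j, 0 < y j) by (intros j; apply Rlt_le_trans with (1 := HB), Rmax_l).
assert (Hy0 : y 0%nat = B) by (unfold y; rewrite grid_0, Rmult_0_r, Rmax_left; lra).
set (C := 2 / (2 - th)).
assert (HC : 1 <= C).
{ unfold C. apply Rmult_le_reg_r with (2 - th); [lra|]. field_simplify; lra. }
set (S_ := fun m => / (Rmax B (n * 0) * Rmax B (n * 0)) * H 0 +
  sm (fun j => / (y (S j) * y (S j)) * (H (grid N (S j)) - H (grid N j))) m).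
assert (Hmain : forall m, (m <= S N)%nat ->
  S_ m <= / (y m * y m) * H (grid N m) + C * M * (Rpower B (th - 2) - Rpower (y m) (th - 2))).
{ induction m as [|m IH]; intros Hm.
  - unfold S_. simpl sm. rewrite Hy0, grid_0, Rmult_0_r, (Rmax_left B 0) by lra. lra.
  - replace (S_ (S m)) with (S_ m + / (y (S m) * y (S m)) * (H (grid N (S m)) - H (grid N m)))
      by (unfold S_; simpl sm; ring).
    specialize (IH ltac:(lia)).
    assert (Hyy : y m <= y (S m)).
    { apply Rle_max_compat_l, Rmult_le_compat_l; [exact Hn|apply grid_le; lia]. }
    assert (D := Rpower_decr_diff (y m) (y (S m)) th (conj (Hy m) Hyy) Hth). fold C in D.
    assert (Hg := Hbd (grid N m) (grid_range N m ltac:(lia))).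
    fold (y m) in Hg.
    assert (Hinv : / (y (S m) * y (S m)) <= / (y m * y m)).
    { apply Rinv_le_contravar; [apply Rmult_lt_0_compat; apply Hy|].
      apply Rmult_le_compat; try (left; apply Hy); assumption. }
    apply Rmult_le_compat_l with (r := M) in D; [|exact HM]. nra. }
specialize (Hmain (S N) ltac:(lia)).
change (rs H N (fun x => / (Rmax B (n * x) * Rmax B (n * x)))) with (S_ (S N)).
apply Rle_trans with (1 := Hmain).
assert (Hg := Hbd (grid N (S N)) (grid_range N (S N) ltac:(lia))). fold (y (S N)) in Hg.
(* The boundary term left at pi is [M] times y^(th - 2); the negative term of the invariant absorbs
   it because [C] is at least 1. *)
assert (E : / (y (S N) * y (S N)) * (M * Rpower (y (S N)) th) = M * Rpower (y (S N)) (th - 2)).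
{ replace (th - 2) with (th + - (2)) by ring. rewrite Rpower_plus, Rpower_Ropp.
  replace (Rpower (y (S N)) 2) with (y (S N) * y (S N)).
  - field. apply Rgt_not_eq, Hy.
  - replace 2 with (1 + 1) by ring. rewrite Rpower_plus, Rpower_1 by apply Hy. reflexivity. }
assert (0 <= / (y (S N) * y (S N))) by (left; apply Rinv_0_lt_compat, Rmult_lt_0_compat; apply Hy).
apply Rmult_le_compat_l with (1 := H0) in Hg. rewrite E in Hg.
assert (P := Rpower_pos (y (S N)) (th - 2)).
assert (0 <= (C - 1) * (M * Rpower (y (S N)) (th - 2))) by pos.
nra.
Qed.

(** * The Fejer kernel *)

Lemma le_of_derive_le (f g f' g' : R -> R) (x : R) : 0 <= x ->
  (forall t, 0 <= t <= x -> is_derive f t (f' t)) ->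
  (forall t, 0 <= t <= x -> is_derive g t (g' t)) ->
  (forall t, 0 <= t <= x -> f' t <= g' t) -> f 0 <= g 0 -> f x <= g x.
Proof.
intros Hx Hf Hg Hle H0.
destruct (MVT_gen (fun t => g t - f t) 0 x (fun t => g' t - f' t)) as (c & Hc & E).
- intros t Ht. rewrite Rmin_left, Rmax_right in Ht by exact Hx.
  apply (is_derive_minus g f); [apply Hg|apply Hf]; lra.
- intros t Ht. rewrite Rmin_left, Rmax_right in Ht by exact Hx.
  apply continuity_pt_filterlim, (ex_derive_continuous (fun t => g t - f t)).
  exists (g' t - f' t). apply (is_derive_minus g f); [apply Hg|apply Hf]; lra.
- rewrite Rmin_left, Rmax_right in Hc by exact Hx. specialize (Hle c Hc).
  assert (0 <= (g' c - f' c) * (x - 0)) by pos. lra.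
Qed.

(** From here to [cos_le_quartic] the bounds are alternating Taylor polynomials; each follows from
    the preceding one by comparing derivatives. *)
Lemma sin_le_id x : 0 <= x -> sin x <= x.
Proof.
intros Hx. apply (le_of_derive_le sin (fun t => t) cos (fun _ => 1)); try exact Hx.
- intros t _. auto_derive; [exact I|ring].
- intros t _. auto_derive; [exact I|ring].
- intros t _. apply COS_bound.
- rewrite sin_0. lra.
Qed.

Lemma cos_ge_quadratic x : 0 <= x -> 1 - x ^ 2 / 2 <= cos x.
Proof.
intros Hx. apply (le_of_derive_le (fun t => 1 - t ^ 2 / 2) cos (fun t => - t) (fun t => - sin t));
  try exact Hx.
- intros t _. auto_derive; [exact I|field].
- intros t _. auto_derive; [exact I|ring].
- intros t Ht. generalize (sin_le_id t). lra.
- rewrite cos_0. lra.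
Qed.

Lemma sin_ge_cubic x : 0 <= x -> x - x ^ 3 / 6 <= sin x.
Proof.
intros Hx. apply (le_of_derive_le (fun t => t - t ^ 3 / 6) sin (fun t => 1 - t ^ 2 / 2) cos);
  try exact Hx.
- intros t _. auto_derive; [exact I|field].
- intros t _. auto_derive; [exact I|ring].
- intros t Ht. apply cos_ge_quadratic. lra.
- rewrite sin_0. lra.
Qed.

Lemma cos_le_quartic x : 0 <= x -> cos x <= 1 - x ^ 2 / 2 + x ^ 4 / 24.
Proof.
intros Hx. apply (le_of_derive_le cos (fun t => 1 - t ^ 2 / 2 + t ^ 4 / 24)
  (fun t => - sin t) (fun t => - t + t ^ 3 / 6)); try exact Hx.
- intros t _. auto_derive; [exact I|ring].
- intros t _. auto_derive; [exact I|field].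
- intros t Ht. generalize (sin_ge_cubic t). lra.
- rewrite cos_0. lra.
Qed.

(** The quartic bound makes [cos (8 / 5)] negative, so half of pi is below 8/5. *)
Lemma PI_lt_16_5 : PI < 16 / 5.
Proof.
apply Rnot_le_lt. intros H.
assert (H1 : 0 <= cos (8 / 5)) by (apply cos_ge_0; lra).
assert (H2 := cos_le_quartic (8 / 5)). lra.
Qed.

Lemma cos_lipschitz a b : Rabs (cos a - cos b) <= Rabs (a - b).
Proof.
destruct (MVT_gen cos b a (fun t => - sin t)) as (c & _ & E).
- intros t _. auto_derive; [exact I|ring].
- intros t _. apply continuity_pt_filterlim, continuous_cos.
- rewrite E, Rabs_mult, Rabs_Ropp. rewrite <- (Rmult_1_l (Rabs (a - b))) at 2.
  apply Rmult_le_compat_r; [apply Rabs_pos|]. apply Rabs_le, SIN_bound.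
Qed.

(** The squared chord |1 - exp(i x)|^2 = 4 sin^2(x / 2). *)
Definition chord2 (x : R) : R := 2 - 2 * cos x.

Lemma chord2_le x : 0 <= x -> chord2 x <= x ^ 2.
Proof. intros Hx. unfold chord2. generalize (cos_ge_quadratic x Hx). lra. Qed.

Lemma chord2_ge x : 0 <= x -> x ^ 2 * (1 - x ^ 2 / 12) <= chord2 x.
Proof. intros Hx. unfold chord2. generalize (cos_le_quartic x Hx). nra. Qed.

Lemma chord2_ge_eighth x : 0 <= x <= PI -> x ^ 2 / 8 <= chord2 x.
Proof.
intros Hx. assert (H := chord2_ge x (proj1 Hx)). assert (P := PI_lt_16_5).
(* At 10.5 the factor [1 - x ^ 2 / 12] equals 1/8, and the square of 16/5 is 10.24. *)
assert (x ^ 2 <= 10.5) by nra. nra.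
Qed.

Lemma chord2_pos x : 0 < x <= PI -> 0 < chord2 x.
Proof. intros Hx. generalize (chord2_ge_eighth x). nra. Qed.

Lemma chord2_ge0 x : 0 <= chord2 x.
Proof. unfold chord2. generalize (COS_bound x). lra. Qed.

(** Enlarging the covariance matrix adds one diagonal entry and twice a border row. With truncated
    subtraction [(j - l) + (l - j)] is |j - l|, and a partial border row, read backwards, is a
    difference of two prefix sums. *)
Lemma var_S_succ a n : var_S a (S n) = var_S a n + a 0%nat + 2 * sm (fun k => a (S k)) n.
Proof.
assert (E : forall m, var_S a m =
  sm (fun j => sm (fun l => a ((j - l) + (l - j))%nat) m) m).
{ intros [|m]; [reflexivity|]. unfold var_S. rewrite sum_f_R0_sm. apply sm_ext.
  intros j _. apply sum_f_R0_sm. }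
rewrite !E. simpl sm at 1.
assert (E1 : forall m, (m <= n)%nat -> sm (fun l => a ((n - l) + (l - n))%nat) m =
  sm (fun k => a (S k)) n - sm (fun k => a (S k)) (n - m)).
{ induction m as [|m IH]; intros Hm; simpl sm.
  - rewrite Nat.sub_0_r. ring.
  - rewrite IH by lia. assert (E0 : (n - m = S (n - S m))%nat) by lia.
    replace (n - m + (m - n))%nat with (S (n - S m)) by lia.
    rewrite E0. generalize (n - S m)%nat. intros p. simpl sm. ring. }
assert (E2 : sm (fun j => sm (fun l => a ((j - l) + (l - j))%nat) n + a ((j - n) + (n - j))%nat) n =
  sm (fun j => sm (fun l => a ((j - l) + (l - j))%nat) n) n +
  sm (fun l => a ((n - l) + (l - n))%nat) n).
{ rewrite (sm_ext _ (fun j => 1 * sm (fun l => a ((j - l) + (l - j))%nat) n +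
    1 * a ((n - j) + (j - n))%nat)).
  - rewrite sm_lin. ring.
  - intros i _. rewrite (Nat.add_comm (i - n)). ring. }
rewrite E2, (E1 n) by lia. rewrite Nat.sub_diag.
simpl (0 + 0)%nat. simpl sm. ring.
Qed.

Lemma var_S_rs H N (f : nat -> R -> R) n :
  var_S (fun k => rs H N (f k)) n = rs H N (fun x => var_S (fun k => f k x) n).
Proof.
induction n as [|n IH].
- simpl. rewrite (rs_ext H N _ (fun x => 0 * 0)) by (intros; ring). rewrite rs_scal. ring.
- rewrite var_S_succ, IH.
  rewrite (rs_ext H N (fun x => var_S _ (S n)) (fun x =>
    (var_S (fun k => f k x) n + f 0%nat x) + 2 * sm (fun k => f (S k) x) n))
    by (intros; apply var_S_succ).
  rewrite rs_plus, rs_plus, rs_scal, (rs_sm H N (fun k => f (S k))). reflexivity.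
Qed.

Lemma is_lim_seq_sm (u : nat -> nat -> R) (l : nat -> R) n :
  (forall k, (k < n)%nat -> is_lim_seq (fun N => u N k) (l k)) ->
  is_lim_seq (fun N => sm (u N) n) (sm l n).
Proof.
induction n as [|n IH]; intros H; simpl; [apply is_lim_seq_const|].
apply is_lim_seq_plus'; [apply IH; intros; apply H; lia|apply H; lia].
Qed.

Lemma is_lim_seq_var_S (u : nat -> nat -> R) (l : nat -> R) n :
  (forall k, is_lim_seq (fun N => u N k) (l k)) ->
  is_lim_seq (fun N => var_S (u N) n) (var_S l n).
Proof.
intros H. induction n as [|n IH]; [apply is_lim_seq_const|].
apply (is_lim_seq_ext (fun N => var_S (u N) n + u N 0%nat + 2 * sm (fun k => u N (S k)) n)).
- intros N. symmetry. apply var_S_succ.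
- rewrite var_S_succ. apply is_lim_seq_plus'; [apply is_lim_seq_plus'; [exact IH|apply H]|].
  apply is_lim_seq_mult'; [apply is_lim_seq_const|].
  apply (is_lim_seq_sm (fun N k => u N (S k)) (fun k => l (S k))). intros k _. apply H.
Qed.

(** The double sum of cos((j - l) x) is the squared modulus of the sum of exp(i j x). Written
    through [var_S] the kernel involves no division at the origin, and linearity alone exchanges it
    with [rs]. *)
Definition fejer (n : nat) (x : R) : R := var_S (fun k => cos (INR k * x)) n.

Lemma rs_fejer_lim G r n : is_spectral_cov G r ->
  is_lim_seq (fun N => rs G N (fejer n)) (var_S r n).
Proof.
intros Hr.
apply (is_lim_seq_ext (fun N => var_S (fun k => rs G N (fun x => cos (INR k * x))) n)).
{ intros N. apply var_S_rs. }
apply is_lim_seq_var_S. intros k.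
replace (r k) with (G 0 + (r k - G 0)) by ring.
apply (is_lim_seq_ext (fun N => G 0 + RS_cos_sum G k N)).
- intros N. unfold rs, RS_cos_sum. rewrite sum_f_R0_sm, Rmult_0_r, cos_0, Rmult_1_l. reflexivity.
- apply is_lim_seq_plus'; [apply is_lim_seq_const|]. apply is_lim_seq_Reals, Hr.
Qed.

Lemma fejer_0 x : fejer 0 x = 0.
Proof. reflexivity. Qed.

Lemma fejer_1 x : fejer 1 x = 1.
Proof. unfold fejer. simpl. rewrite Rmult_0_l. apply cos_0. Qed.

Lemma fejer_second_diff n x :
  fejer (S (S n)) x - 2 * fejer (S n) x + fejer n x = 2 * cos (INR (S n) * x).
Proof.
assert (H : forall a, var_S a (S (S n)) - 2 * var_S a (S n) + var_S a n = 2 * a (S n)).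
{ intros a. rewrite !(var_S_succ a (S n)), !(var_S_succ a n). simpl sm. ring. }
apply (H (fun k => cos (INR k * x))).
Qed.

(** Multiply |1 + ... + exp(i (n - 1) x)|^2 by |1 - exp(i x)|^2. The recurrence behind it has order
    two, hence the induction on two consecutive indices. *)
Lemma chord2_fejer n x : chord2 x * fejer n x = 2 - 2 * cos (INR n * x).
Proof.
assert (H : chord2 x * fejer n x = 2 - 2 * cos (INR n * x) /\
  chord2 x * fejer (S n) x = 2 - 2 * cos (INR (S n) * x)); [|apply H].
induction n as [|n [IH1 IH2]].
- rewrite fejer_0, fejer_1. unfold chord2. simpl. rewrite Rmult_0_l, cos_0, Rmult_1_l. lra.
- split; [exact IH2|].
  replace (fejer (S (S n)) x) with (2 * cos (INR (S n) * x) + 2 * fejer (S n) x - fejer n x)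
    by (rewrite <- fejer_second_diff; ring).
  assert (E : cos (INR (S (S n)) * x) = 2 * cos x * cos (INR (S n) * x) - cos (INR n * x)).
  { replace (INR (S (S n)) * x) with (INR (S n) * x + x) by (rewrite (S_INR (S n)); ring).
    replace (INR n * x) with (INR (S n) * x - x) by (rewrite S_INR; ring).
    rewrite cos_plus, cos_minus. ring. }
  rewrite E. unfold chord2 in *. nra.
Qed.

Lemma fejer_rec n x : fejer (S (S n)) x = 2 * cos x * fejer (S n) x - fejer n x + 2.
Proof.
assert (H1 := fejer_second_diff n x). assert (H2 := chord2_fejer (S n) x).
unfold chord2 in H2. lra.
Qed.

Lemma fejer_at_0 n : fejer n 0 = INR n ^ 2.
Proof.
assert (H : fejer n 0 = INR n ^ 2 /\ fejer (S n) 0 = INR (S n) ^ 2); [|apply H].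
induction n as [|n [IH1 IH2]].
- rewrite fejer_0, fejer_1. simpl. lra.
- split; [exact IH2|]. rewrite fejer_rec, IH1, IH2, cos_0, !S_INR. ring.
Qed.

Lemma fejer_ge0 n x : 0 <= x <= PI -> 0 <= fejer n x.
Proof.
intros Hx. destruct (Req_dec x 0) as [->|Hne].
- rewrite fejer_at_0. apply pow2_ge_0.
- assert (H := chord2_fejer n x). assert (P := chord2_pos x ltac:(lra)).
  assert (B := COS_bound (INR n * x)). nra.
Qed.

Lemma sm_INR n : 2 * sm (fun k => INR (S k)) n = INR n * (INR n + 1).
Proof.
induction n as [|n IH]; [simpl; ring|].
change (sm (fun k => INR (S k)) (S n)) with (sm (fun k => INR (S k)) n + INR (S n)).
rewrite Rmult_plus_distr_l, IH, S_INR. ring.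
Qed.

Lemma fejer_abs_le n x : Rabs (fejer n x) <= INR n ^ 2.
Proof.
induction n as [|n IH].
- rewrite fejer_0, Rabs_R0. simpl. lra.
- unfold fejer. rewrite var_S_succ. fold (fejer n x).
  assert (A : Rabs (sm (fun k => cos (INR (S k) * x)) n) <= INR n).
  { apply Rle_trans with (1 := sm_abs _ _). rewrite <- (Rmult_1_r (INR n)), <- sm_const.
    apply sm_le. intros i _. apply Rabs_le, COS_bound. }
  simpl (INR 0). rewrite Rmult_0_l, cos_0.
  apply Rabs_le_between in A. apply Rabs_le_between in IH. rewrite S_INR. apply Rabs_le. nra.
Qed.

Lemma fejer_lipschitz n x y : Rabs (fejer n x - fejer n y) <= INR n ^ 3 * Rabs (x - y).
Proof.
assert (Hd := Rabs_pos (x - y)).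
(* (n^3 - n) / 3 solves the recursion exactly: its increments are n (n + 1), twice the sum of the
   frequencies. *)
assert (H : Rabs (fejer n x - fejer n y) <= (INR n ^ 3 - INR n) / 3 * Rabs (x - y)).
{ induction n as [|n IH].
  - rewrite !fejer_0, Rminus_diag, Rabs_R0. simpl. lra.
  - unfold fejer. rewrite !var_S_succ. fold (fejer n x) (fejer n y).
    simpl (INR 0). rewrite !Rmult_0_l.
    assert (A : Rabs (sm (fun k => cos (INR (S k) * x)) n - sm (fun k => cos (INR (S k) * y)) n)
      <= Rabs (x - y) * sm (fun k => INR (S k)) n).
    { rewrite <- sm_minus. apply Rle_trans with (1 := sm_abs _ _). rewrite <- sm_scal.
      apply sm_le. intros i _. apply Rle_trans with (1 := cos_lipschitz _ _).
      rewrite <- Rmult_minus_distr_l, Rabs_mult, (Rabs_pos_eq (INR (S i))) by apply pos_INR. lra. }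
    assert (E := sm_INR n). apply Rabs_le_between in A. apply Rabs_le_between in IH.
    rewrite S_INR. apply Rabs_le. nra. }
apply Rle_trans with (1 := H). apply Rmult_le_compat_r; [exact Hd|].
assert (0 <= INR n) by pos. assert (0 <= INR n ^ 3) by pos. lra.
Qed.

Lemma fejer_decay n x : 0 < x <= PI -> fejer n x <= 32 / x ^ 2.
Proof.
intros Hx. assert (H := chord2_fejer n x). assert (Q := chord2_ge_eighth x ltac:(lra)).
assert (F := fejer_ge0 n x ltac:(lra)). assert (B := COS_bound (INR n * x)).
apply Rmult_le_reg_r with (x ^ 2 / 8); [nra|].
replace (32 / x ^ 2 * (x ^ 2 / 8)) with 4 by (field; lra). nra.
Qed.

(** * The Abelian comparison *)

Definition near0 (P : R -> Prop) : Prop := exists d, 0 < d /\ forall s, 0 < s < d -> P s.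

Lemma near0_and P Q : near0 P -> near0 Q -> near0 (fun s => P s /\ Q s).
Proof.
intros (d & Hd & HP) (e & He & HQ). exists (Rmin d e). split; [apply Rmin_glb_lt; assumption|].
intros s Hs. assert (H1 := Rmin_l d e). assert (H2 := Rmin_r d e).
split; [apply HP|apply HQ]; lra.
Qed.

Lemma near0_imp (P Q : R -> Prop) : (forall s, 0 < s -> P s -> Q s) -> near0 P -> near0 Q.
Proof. intros H (d & Hd & HP). exists d. split; [exact Hd|]. intros s Hs. apply H; [|apply HP]; lra. Qed.

Lemma near0_lt d : 0 < d -> near0 (fun s => s < d).
Proof. intros Hd. exists d. split; [exact Hd|]. intros s Hs. lra. Qed.

Lemma near0_scale c P : 0 < c -> near0 P -> near0 (fun s => P (c * s)).
Proof.
intros Hc (d & Hd & H). exists (d / c). split; [apply Rdiv_lt_0_compat; lra|].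
intros s Hs. apply H. split; [nra|]. replace d with (c * (d / c)) by (field; lra).
apply Rmult_lt_compat_l; lra.
Qed.

Lemma near0_seq P : near0 P -> exists n0, forall n, (n0 <= n)%nat -> (0 < n)%nat /\ P (/ INR n).
Proof.
intros (d & Hd & H). destruct (INR_unbounded (/ d)) as (k & Hk).
exists (S k). intros n Hn. split; [lia|]. apply H.
assert (0 < / d) by pos.
assert (INR k <= INR n) by (apply le_INR; lia).
split; [apply Rinv_0_lt_compat; lra|].
rewrite <- (Rinv_inv d). apply Rinv_lt_contravar; [apply Rmult_lt_0_compat|]; lra.
Qed.

Lemma Rpower_le_mono a b c : 0 < a <= b -> 0 <= c -> Rpower a c <= Rpower b c.
Proof. intros H Hc. apply Rle_Rpower_l; assumption. Qed.

Lemma Rpower_ge_1 a c : 1 <= a -> 0 <= c -> 1 <= Rpower a c.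
Proof.
intros Ha Hc. rewrite <- (rpower_base1 c) at 1 || replace 1 with (Rpower 1 c).
apply Rpower_le_mono; lra.
unfold Rpower. rewrite ln_1, Rmult_0_r. apply exp_0.
Qed.

Lemma Rpower_mul_base a b c : 0 < a -> 0 < b -> Rpower (a * b) c = Rpower a c * Rpower b c.
Proof. intros Ha Hb. symmetry. apply Rpower_mult_distr; assumption. Qed.

Lemma Rpower_small a eps : 0 < a -> 0 < eps -> near0 (fun s => Rpower s a < eps).
Proof.
intros Ha He. exists (Rpower eps (/ a)). split; [apply Rpower_pos|]. intros s Hs.
replace eps with (Rpower (Rpower eps (/ a)) a).
- apply Rlt_Rpower_l; lra.
- rewrite Rpower_mult. replace (/ a * a) with 1 by (field; lra). apply Rpower_1, He.
Qed.

(* [Rpower 0 b = 1], hence the case distinction. *)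
Definition pw (b x : R) : R := if Rle_dec x 0 then 0 else Rpower x b.

Lemma pw_pos b x : 0 < x -> pw b x = Rpower x b.
Proof. intros Hx. unfold pw. destruct (Rle_dec x 0); [lra|reflexivity]. Qed.

Lemma pw_0 b x : x <= 0 -> pw b x = 0.
Proof. intros Hx. unfold pw. destruct (Rle_dec x 0); [reflexivity|contradiction]. Qed.

Lemma pw_ge0 b x : 0 <= pw b x.
Proof. unfold pw. destruct (Rle_dec x 0); [lra|left; apply Rpower_pos]. Qed.

Lemma pw_le b x y : 0 <= b -> x <= y -> pw b x <= pw b y.
Proof.
intros Hb Hxy. destruct (Rle_dec x 0) as [Hx|Hx].
- rewrite pw_0 by exact Hx. apply pw_ge0.
- rewrite !pw_pos by lra. apply Rpower_le_mono; lra.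
Qed.

Lemma pw_scale b s x : 0 < s -> pw b (s * x) = Rpower s b * pw b x.
Proof.
intros Hs. destruct (Rle_dec x 0) as [Hx|Hx].
- rewrite !pw_0; nra.
- rewrite !pw_pos by nra. apply Rpower_mul_base; lra.
Qed.

Lemma pw_nondecreasing b : 0 <= b -> nondecreasing_pos (pw b).
Proof. intros Hb. split; [apply pw_ge0|]. intros. apply pw_le; assumption. Qed.

Section Comparison.

Variables (L : R -> R) (beta : R).
Hypothesis hbeta : 0 < beta < 2.
Hypothesis Lpos : forall x, 0 < x -> 0 < L x.
Hypothesis Lunif : locally_uniform_sv L.
Hypothesis Lpot : potter_bounds L.

Let U s := L (/ s) * Rpower s beta.

Lemma reg_var_pos s : 0 < s -> 0 < U s.
Proof.
intros Hs. apply Rmult_lt_0_compat; [apply Lpos, Rinv_0_lt_compat, Hs|apply Rpower_pos].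
Qed.

Lemma sv_scale_near0 eps B : 0 < eps -> 1 <= B ->
  near0 (fun s => forall x, s / B <= x <= B * s -> Rabs (L (/ x) - L (/ s)) <= eps * L (/ s)).
Proof.
intros He HB. destruct (Lunif eps B He HB) as (M & HM & H).
exists (/ M). split; [apply Rinv_0_lt_compat, HM|]. intros s Hs x Hx.
assert (0 < / s) by pos.
assert (0 < / B) by pos.
assert (0 < s / B) by pos.
assert (Ls := Lpos (/ s) ltac:(lra)).
specialize (H (/ s) (s / x)).
replace (s / x * / s) with (/ x) in H by (field; lra).
assert (Hlt : Rabs (L (/ x) / L (/ s) - 1) < eps).
{ apply H.
  - rewrite <- (Rinv_inv M). apply Rinv_le_contravar; lra.
  - split.
    + apply Rmult_le_reg_r with x; [lra|]. replace (s / x * x) with s by (field; lra).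
      apply Rmult_le_reg_l with B; [lra|]. replace (B * (/ B * x)) with x by (field; lra). lra.
    + apply Rmult_le_reg_r with x; [lra|]. replace (s / x * x) with s by (field; lra).
      apply Rmult_le_reg_l with (/ B); [lra|]. replace (/ B * (B * x)) with x by (field; lra).
      unfold Rdiv in Hx. lra. }
replace (L (/ x) - L (/ s)) with ((L (/ x) / L (/ s) - 1) * L (/ s)) by (field; lra).
rewrite Rabs_mult, (Rabs_pos_eq (L (/ s))) by lra. apply Rmult_le_compat_r; lra.
Qed.

Variables (G : R -> R) (kappa : R).
Hypothesis hG : nondecreasing_pos G.
Hypothesis hkappa : 0 < kappa.
Hypothesis hasym : forall eps, 0 < eps ->
  near0 (fun x => Rabs (G x - kappa * U x) <= eps * U x).

(** On [[d * s, B * s]] the ratio [x / s] stays in a compact set, so [L] may be frozen at [/ s].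
    Below [d * s] monotonicity suffices: [G x] and the model are at most what they are at [d * s],
    and [d] makes that negligible against [U s]. *)
Lemma head_estimate eps B : 0 < eps -> 1 <= B ->
  near0 (fun s => forall x, 0 <= x <= PI -> x <= B * s ->
    Rabs (G x - kappa * L (/ s) * pw beta x) <= eps * U s).
Proof.
intros He HB.
assert (Hdl : near0 (fun d => Rpower d beta < eps / (4 * (kappa + 1)))).
{ apply Rpower_small; [lra|]. apply Rdiv_lt_0_compat; lra. }
destruct (near0_and _ _ Hdl (near0_lt 1 Rlt_0_1)) as (d0 & Hd0 & Hd).
set (d := d0 / 2). destruct (Hd d) as [Hde Hd1]; [unfold d; lra|].
assert (Hdpos : 0 < d) by pos.
assert (BB := Rpower_ge_1 B beta HB ltac:(lra)).
(* The asymptotics of [G] cost [2 * e1], as [L (/ x)] is at most [2 * L (/ s)], and freezing [L]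
   costs [kappa * e1]; this is the factor [2 + kappa]. *)
set (e1 := Rmin 1 (eps / ((2 + kappa) * Rpower B beta))).
assert (He1 : 0 < e1) by pos.
assert (He1' : e1 <= 1) by apply Rmin_l.
assert (He1'' : e1 * ((2 + kappa) * Rpower B beta) <= eps).
{ assert (e1 <= eps / ((2 + kappa) * Rpower B beta)) by apply Rmin_r.
  apply Rmult_le_compat_r with (r := (2 + kappa) * Rpower B beta) in H; [|nra].
  replace (eps / ((2 + kappa) * Rpower B beta) * ((2 + kappa) * Rpower B beta)) with eps in H
    by (field; split; nra). exact H. }
set (B' := Rmax B (/ d)).
assert (HB' : 1 <= B') by (apply Rle_trans with (1 := HB), Rmax_l).
assert (Hmid : near0 (fun s => forall x, d * s <= x <= B * s ->
  Rabs (G x - kappa * L (/ s) * Rpower x beta) <= e1 * (2 + kappa) * (L (/ s) * Rpower x beta))).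
{ generalize (near0_and _ _ (near0_scale B _ ltac:(lra) (hasym e1 He1)) (sv_scale_near0 e1 B' He1 HB')).
  intros (d2 & Hd2 & H2). exists d2. split; [exact Hd2|]. intros s Hs x Hx.
  assert (Hdx : 0 < x) by nra.
  destruct (H2 (x / B)) as [Ha _].
  { split; [apply Rdiv_lt_0_compat; lra|]. apply Rle_lt_trans with s; [|lra].
    apply Rmult_le_reg_l with B; [lra|]. replace (B * (x / B)) with x by (field; lra). lra. }
  replace (B * (x / B)) with x in Ha by (field; lra).
  destruct (H2 s Hs) as [_ Hb]. specialize (Hb x).
  assert (Hb' : Rabs (L (/ x) - L (/ s)) <= e1 * L (/ s)).
  { apply Hb. split.
    - apply Rle_trans with (d * s); [|lra]. apply Rmult_le_reg_r with B'; [lra|].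
      replace (s / B' * B') with s by (field; lra).
      assert (/ d <= B') by apply Rmax_r.
      assert (d * / d <= d * B') by nra.
      rewrite Rinv_r in H0 by lra. nra.
    - apply Rle_trans with (B * s); [lra|]. apply Rmult_le_compat_r; [lra|apply Rmax_l]. }
  assert (P := Rpower_pos x beta). unfold U in Ha.
  assert (Ls := Lpos (/ s) ltac:(apply Rinv_0_lt_compat; lra)).
  set (l := L (/ x)) in *. set (ls := L (/ s)) in *. set (p := Rpower x beta) in *.
  apply Rabs_le_between in Hb'.
  replace (G x - kappa * ls * p) with ((G x - kappa * (l * p)) + kappa * p * (l - ls)) by ring.
  apply Rle_trans with (1 := Rabs_triang _ _). rewrite Rabs_mult, (Rabs_pos_eq (kappa * p)) by nra.
  assert (Rabs (l - ls) <= e1 * ls) by (apply Rabs_le; lra).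
  assert (kappa * p * Rabs (l - ls) <= kappa * p * (e1 * ls)) by (apply Rmult_le_compat_l; nra).
  assert (e1 * (l * p) <= e1 * (2 * ls * p)).
  { apply Rmult_le_compat_l; [lra|]. apply Rmult_le_compat_r; nra. }
  nra. }
destruct Hmid as (d3 & Hd3 & Hmid). exists (Rmin d3 (PI / d)).
split; [apply Rmin_glb_lt; [exact Hd3|apply Rdiv_lt_0_compat; [apply PI_RGT_0|lra]]|].
intros s Hs x Hx HxB.
assert (Hs3 : s < d3) by (apply Rlt_le_trans with (1 := proj2 Hs), Rmin_l).
assert (HsP : d * s <= PI).
{ apply Rlt_le. replace PI with (d * (PI / d)) by (field; lra). apply Rmult_lt_compat_l; [lra|].
  apply Rlt_le_trans with (1 := proj2 Hs), Rmin_r. }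
specialize (Hmid s ltac:(lra)).
assert (Ls := Lpos (/ s) ltac:(apply Rinv_0_lt_compat; lra)).
assert (Ps := Rpower_pos s beta). unfold U. set (ls := L (/ s)) in *.
assert (LP : 0 < ls * Rpower s beta) by pos.
destruct (Rle_dec (d * s) x) as [Hdx|Hdx].
- assert (0 < x) by nra. rewrite pw_pos by lra.
  apply Rle_trans with (1 := Hmid x (conj Hdx HxB)).
  assert (Hp : Rpower x beta <= Rpower B beta * Rpower s beta).
  { rewrite <- Rpower_mul_base by lra. apply Rpower_le_mono; lra. }
  apply Rle_trans with (e1 * (2 + kappa) * (ls * (Rpower B beta * Rpower s beta))).
  + apply Rmult_le_compat_l; [nra|]. apply Rmult_le_compat_l; lra.
  + replace (e1 * (2 + kappa) * (ls * (Rpower B beta * Rpower s beta))) with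
      (e1 * ((2 + kappa) * Rpower B beta) * (ls * Rpower s beta)) by ring.
    apply Rmult_le_compat_r; lra.
- assert (Hm := Hmid (d * s) ltac:(nra)).
  assert (HGx : 0 <= G x) by (apply nondecreasing_pos_ge0; assumption).
  assert (HGd : G x <= G (d * s)) by (apply hG; nra).
  assert (Hpx := pw_ge0 beta x).
  assert (Hpd : pw beta x <= Rpower (d * s) beta).
  { rewrite <- (pw_pos beta (d * s)) by nra. apply pw_le; lra. }
  assert (Q : Rpower (d * s) beta <= eps / (4 * (kappa + 1)) * Rpower s beta).
  { rewrite Rpower_mul_base by lra. apply Rmult_le_compat_r; lra. }
  set (pd := Rpower (d * s) beta) in *.
  assert (Hpdpos : 0 < pd) by pos.
  apply Rabs_le_between in Hm.
  assert (E : 0 <= kappa * ls * pw beta x <= kappa * ls * pd).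
  { split; [apply Rmult_le_pos; nra|]. apply Rmult_le_compat_l; nra. }
  assert (F : G x <= (kappa + (2 + kappa)) * (ls * pd)).
  { nra. }
  assert (Z : (2 + 2 * kappa) * (ls * pd) <= eps * (ls * Rpower s beta)).
  { assert (ls * pd <= ls * (eps / (4 * (kappa + 1)) * Rpower s beta))
      by (apply Rmult_le_compat_l; lra).
    apply Rle_trans with ((2 + 2 * kappa) * (ls * (eps / (4 * (kappa + 1)) * Rpower s beta))).
    - apply Rmult_le_compat_l; lra.
    - replace ((2 + 2 * kappa) * (ls * (eps / (4 * (kappa + 1)) * Rpower s beta))) with
        (eps / 2 * (ls * Rpower s beta)) by (field; lra).
      apply Rmult_le_compat_r; lra. }
  apply Rabs_le. nra.
Qed.

(** The majorant for the tails. Below [s] it holds by monotonicity; up to a fixed [x1] by Potter's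
    inequality, at the price of the extra exponent [a]; beyond [x1] the number [G PI] is compared
    with the bound at [x1]. The two summands of [M] serve the last two ranges. *)
Lemma global_estimate a : 0 < a -> exists M, 0 < M /\
  near0 (fun s => forall x, 0 <= x <= PI ->
    G x <= M * U s * Rpower (Rmax 1 (/ s * x)) (beta + a)).
Proof.
intros Ha. destruct (Lpot a Ha) as (MP & C & HMP & HC & Hpot).
destruct (hasym 1 Rlt_0_1) as (d0 & Hd0 & Has).
assert (PP := PI_RGT_0).
set (x1 := Rmin (d0 / 2) (Rmin (/ MP) PI)).
assert (Hx1 : 0 < x1) by pos.
assert (Hx1d : x1 <= d0 / 2) by apply Rmin_l.
assert (Hx1' : x1 <= Rmin (/ MP) PI) by apply Rmin_r.
assert (Hx1M : x1 <= / MP) by (apply Rle_trans with (1 := Hx1'), Rmin_l).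
assert (Hx1P : x1 <= PI) by (apply Rle_trans with (1 := Hx1'), Rmin_r).
assert (U1 := reg_var_pos x1 Hx1).
assert (HGP : 0 <= G PI) by (apply nondecreasing_pos_ge0; [exact hG|lra]).
set (M := C * (kappa + 1) + C * G PI / U x1).
assert (HM1 : 0 <= C * G PI / U x1) by pos.
assert (HMpos : 0 < M) by (unfold M; nra).
exists M. split; [exact HMpos|]. exists x1. split; [exact Hx1|]. intros s Hs.
assert (Hpt : forall x, s <= x <= x1 -> L (/ x) * Rpower x beta <=
   C * (U s * Rpower (/ s * x) (beta + a)) /\
   U s * Rpower (/ s * x) (beta + a) >= / C * (L (/ x) * Rpower x beta)).
{ intros x Hx.
  assert (/ x1 <= / x) by (apply Rinv_le_contravar; lra).
  assert (/ x <= / s) by (apply Rinv_le_contravar; lra).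
  assert (MP <= / x1) by (rewrite <- (Rinv_inv MP); apply Rinv_le_contravar; lra).
  destruct (Hpot (/ x) (/ s) ltac:(lra) ltac:(lra)) as [_ H2].
  replace (/ s / / x) with (/ s * x) in H2 by (field; lra).
  assert (0 < / s) by lra.
  assert (E : U s * Rpower (/ s * x) (beta + a) =
    Rpower (/ s * x) a * L (/ s) * Rpower x beta).
  { unfold U. rewrite Rpower_plus. replace (Rpower x beta) with
      (Rpower s beta * Rpower (/ s * x) beta); [ring|].
    rewrite <- Rpower_mul_base by nra. f_equal. field. lra. }
  rewrite E.
  assert (L (/ x) * Rpower x beta <= C * Rpower (/ s * x) a * L (/ s) * Rpower x beta).
  { apply Rmult_le_compat_r; [left; apply Rpower_pos|exact H2]. }
  split; [lra|]. apply Rle_ge, Rmult_le_reg_l with C; [lra|].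
  rewrite <- Rmult_assoc, Rinv_r by lra. lra. }
assert (Hmid : forall x, s <= x <= x1 -> G x <= M * U s * Rpower (/ s * x) (beta + a)).
{ intros x Hx. destruct (Hpt x Hx) as [H1 _].
  assert (A := Has x ltac:(lra)). apply Rabs_le_between in A. unfold U in A.
  assert (0 <= U s * Rpower (/ s * x) (beta + a)).
  { apply Rmult_le_pos; [left; apply reg_var_pos; lra|left; apply Rpower_pos]. }
  apply Rle_trans with ((kappa + 1) * (L (/ x) * Rpower x beta)); [lra|].
  apply Rle_trans with ((kappa + 1) * (C * (U s * Rpower (/ s * x) (beta + a)))).
  - apply Rmult_le_compat_l; lra.
  - unfold M. nra. }
intros x Hx. destruct (Rle_dec x s) as [Hxs|Hxs].
- apply Rle_trans with (G s); [apply hG; lra|].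
  apply Rle_trans with (1 := Hmid s ltac:(lra)). apply Rmult_le_compat_l.
  + apply Rmult_le_pos; [lra|left; apply reg_var_pos; lra].
  + apply Rpower_le_mono; [|lra]. rewrite Rinv_l by lra. split; [lra|apply Rmax_l].
- assert (Hsx : 0 < / s * x) by pos.
  apply Rle_trans with (M * U s * Rpower (/ s * x) (beta + a)).
  2: { apply Rmult_le_compat_l; [apply Rmult_le_pos; [lra|left; apply reg_var_pos; lra]|].
       apply Rpower_le_mono; [|lra]. split; [exact Hsx|apply Rmax_r]. }
  destruct (Rle_dec x x1) as [Hxx1|Hxx1]; [apply Hmid; lra|].
  destruct (Hpt x1 ltac:(lra)) as [_ H2].
  apply Rle_trans with (G PI); [apply hG; lra|].
  assert (Hm : Rpower (/ s * x1) (beta + a) <= Rpower (/ s * x) (beta + a)).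
  { assert (0 < / s) by (apply Rinv_0_lt_compat; lra).
    apply Rpower_le_mono; [|lra]. split; [nra|apply Rmult_le_compat_l; lra]. }
  fold (U x1) in H2.
  assert (Us := reg_var_pos s ltac:(lra)).
  apply Rle_trans with (M * (U s * Rpower (/ s * x1) (beta + a))).
  2: { rewrite Rmult_assoc. apply Rmult_le_compat_l; [lra|]. apply Rmult_le_compat_l; lra. }
  apply Rle_trans with (M * (/ C * U x1)).
  2: { apply Rmult_le_compat_l; lra. }
  unfold M. rewrite Rmult_plus_distr_r.
  replace (C * G PI / U x1 * (/ C * U x1)) with (G PI) by (field; lra).
  assert (0 <= C * (kappa + 1) * (/ C * U x1)); [|lra].
  apply Rmult_le_pos; [nra|]. apply Rmult_le_pos; [left; apply Rinv_0_lt_compat|]; lra.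
Qed.

(** The conditions describe a kernel of scale [s]: height 1, slope [K / s], decay (s / x)^2.
    Uniformity in [N] and in the kernel allows the use at [s = 1 / n] with the Fejer kernel divided
    by n^2. *)
Lemma kernel_comparison K eps : 1 <= K -> 0 < eps ->
  near0 (fun s => forall N f,
    (forall x, 0 <= x <= PI -> Rabs (f x) <= 1) ->
    (forall x y, 0 <= x <= PI -> 0 <= y <= PI -> Rabs (f x - f y) <= K / s * Rabs (x - y)) ->
    (forall x, 0 < x <= PI -> Rabs (f x) <= K * (s / x) ^ 2) ->
    Rabs (rs G N f - kappa * L (/ s) * rs (pw beta) N f) <= eps * U s).
Proof.
intros HK He.
(* [th] is the midpoint of [beta] and 2: above [beta] to make room for Potter's inequality, below 2
   to make [Rpower B (th - 2)] small. *)
set (a := (2 - beta) / 2). assert (Ha : 0 < a) by pos.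
set (th := beta + a). assert (Hth : 0 < th < 2) by (unfold th, a; lra).
destruct (global_estimate a Ha) as (M & HM & Hglob). fold th in Hglob.
set (C := 2 / (2 - th)). assert (HC : 0 < C) by pos.
set (Q := K * C * (M + kappa)).
assert (HQ : 0 < Q) by pos.
destruct (near0_and _ _ (Rpower_small (2 - th) (eps / (2 * Q)) ltac:(lra)
  ltac:(apply Rdiv_lt_0_compat; lra)) (near0_lt 1 Rlt_0_1)) as (b0 & Hb0 & Hb).
set (B := / (b0 / 2)). destruct (Hb (b0 / 2) ltac:(lra)) as [HBp HB1].
assert (HB : 1 <= B).
{ unfold B. rewrite <- Rinv_1. apply Rinv_le_contravar; lra. }
assert (HBp' : Rpower B (th - 2) <= eps / (2 * Q)).
{ left. replace (Rpower B (th - 2)) with (Rpower (b0 / 2) (2 - th)); [exact HBp|].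
  unfold B, Rpower. rewrite ln_Rinv by lra. f_equal. ring. }
set (e1 := eps / (2 * (1 + K * B))).
assert (HKB : 0 < 1 + K * B) by nra.
assert (He1 : 0 < e1) by pos.
refine (near0_imp _ _ _ (near0_and _ _ Hglob (head_estimate e1 B He1 HB))).
intros s Hs [Hgl Hhead] N f Hf1 Hlip Hdec.
assert (Us := reg_var_pos s Hs).
assert (Ls := Lpos (/ s) ltac:(apply Rinv_0_lt_compat; lra)).
assert (His : 0 < / s) by pos.
(* The kernel is cut at [b]: its head is integrated against the difference of the two distribution
   functions, its tail against each one separately. *)
set (ls := L (/ s)) in *. set (b := B * s).
set (t := fun x => f x - cutoff b f x).
set (w := fun x => / (Rmax B (/ s * x) * Rmax B (/ s * x))).
assert (Hsplit : forall H, rs H N f = rs H N (cutoff b f) + rs H N t).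
{ intros H. rewrite <- rs_plus. apply rs_ext. intros; unfold t; ring. }
assert (Hcut : Rabs (rs G N (cutoff b f) - kappa * ls * rs (pw beta) N (cutoff b f)) <=
  eps / 2 * U s).
{ replace (rs G N (cutoff b f) - kappa * ls * rs (pw beta) N (cutoff b f)) with
    (1 * rs G N (cutoff b f) + (- (kappa * ls)) * rs (pw beta) N (cutoff b f)) by ring.
  rewrite <- rs_measure.
  replace (eps / 2 * U s) with (e1 * U s * (1 + K / s * b)).
  2: { unfold e1, b. field. split; lra. }
  apply rs_cutoff_bound; try assumption.
  - unfold b; nra.
  - apply Rdiv_le_0_compat; lra.
  - nra.
  - intros x Hx Hxb. replace (1 * G x + - (kappa * ls) * pw beta x) with
      (G x - kappa * ls * pw beta x) by ring. apply Hhead; assumption. }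
assert (Ht : forall x, 0 <= x <= PI -> Rabs (t x) <= K * w x).
{ intros x Hx. assert (Hw : 0 < w x).
  { apply Rinv_0_lt_compat, Rmult_lt_0_compat; apply Rlt_le_trans with B; try lra; apply Rmax_l. }
  unfold t, cutoff. destruct (Rle_dec x b) as [Hxb|Hxb].
  - rewrite Rminus_diag, Rabs_R0. nra.
  - rewrite Rminus_0_r. assert (Hxpos : 0 < x) by (unfold b in Hxb; nra).
    apply Rle_trans with (1 := Hdec x ltac:(lra)). right. f_equal. unfold w.
    rewrite Rmax_right; [field; lra|]. apply Rmult_le_reg_l with s; [lra|].
    replace (s * (/ s * x)) with x by (field; lra). unfold b in Hxb. lra. }
assert (Htail : forall H M', nondecreasing_pos H -> 0 <= M' ->
  (forall x, 0 <= x <= PI -> H x <= M' * Rpower (Rmax 1 (/ s * x)) th) ->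
  Rabs (rs H N t) <= K * (C * M' * Rpower B (th - 2))).
{ intros H M' HH HM' Hbd. apply Rle_trans with (1 := rs_abs H N t _ HH Ht). rewrite rs_scal.
  apply Rmult_le_compat_l; [lra|]. apply rs_tail_bound; try assumption; try lra.
  intros x Hx. apply Rle_trans with (1 := Hbd x Hx). apply Rmult_le_compat_l; [exact HM'|].
  apply Rpower_le_mono; [|lra]. split; [apply Rlt_le_trans with 1; [lra|apply Rmax_l]|].
  apply Rle_max_compat_r, HB. }
assert (T1 := Htail G (M * U s) hG ltac:(nra) Hgl).
assert (T2 : Rabs (rs (pw beta) N t) <= K * (C * Rpower s beta * Rpower B (th - 2))).
{ apply Htail; [apply pw_nondecreasing; lra|left; apply Rpower_pos|].
  intros x Hx. replace x with (s * (/ s * x)) at 1 by (field; lra). rewrite pw_scale by exact Hs.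
  apply Rmult_le_compat_l; [left; apply Rpower_pos|].
  apply Rle_trans with (pw beta (Rmax 1 (/ s * x))); [apply pw_le; [lra|apply Rmax_r]|].
  assert (1 <= Rmax 1 (/ s * x)) by apply Rmax_l. rewrite pw_pos by lra.
  apply Rle_Rpower; unfold th; lra. }
rewrite !Hsplit.
replace (_ - kappa * ls * _) with
  ((rs G N (cutoff b f) - kappa * ls * rs (pw beta) N (cutoff b f)) +
   (rs G N t + - (kappa * ls * rs (pw beta) N t))) by ring.
apply Rle_trans with (1 := Rabs_triang _ _).
assert (T3 : Rabs (rs G N t + - (kappa * ls * rs (pw beta) N t)) <= eps / 2 * U s); [|lra].
apply Rle_trans with (1 := Rabs_triang _ _). rewrite Rabs_Ropp, Rabs_mult.
rewrite (Rabs_pos_eq (kappa * ls)) by nra.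
apply Rmult_le_compat_l with (r := kappa * ls) in T2; [|nra].
apply Rle_trans with (Q * U s * Rpower B (th - 2)).
- unfold Q. apply Rle_trans with (1 := Rplus_le_compat _ _ _ _ T1 T2). right. unfold U. fold ls. ring.
- replace (eps / 2 * U s) with (Q * U s * (eps / (2 * Q))) by (field; lra).
  apply Rmult_le_compat_l; [nra|exact HBp'].
Qed.

End Comparison.

(** * Abel means and the resolvent kernel *)

(* The factor of [rho ^ M] is found by solving for the remainder of the generating function with
   the recurrence [fejer_rec]. *)
Lemma fejer_partial_sums rho x M : rho <> 1 ->
  ((1 - rho) ^ 2 + rho * chord2 x) * sm (fun n => rho ^ n * fejer n x) M +
  rho ^ M * ((1 - 2 * cos x * rho) * fejer M x + rho * fejer (S M) x + 2 * rho ^ 2 / (1 - rho)) =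
  rho * (1 + rho) / (1 - rho).
Proof.
intros Hrho. induction M as [|M IH].
- simpl sm. rewrite fejer_0, fejer_1. simpl. field. lra.
- rewrite <- IH. simpl sm. rewrite fejer_rec. unfold chord2. simpl. field. lra.
Qed.

Lemma pow_exp_mult t n : exp (- t) ^ n = exp (- (t * INR n)).
Proof.
induction n as [|n IH]; [simpl; rewrite Rmult_0_r, Ropp_0, exp_0; reflexivity|].
rewrite S_INR. simpl. rewrite IH, <- exp_plus. f_equal. ring.
Qed.

(** The remainder in [fejer_partial_sums] vanishes by this, Fejer kernels being at most quadratic in
    the index. *)
Lemma poly_geometric_lim rho : 0 < rho < 1 ->
  is_lim_seq (fun M => rho ^ M * (INR M + 2) ^ 2) 0.
Proof.
intros Hr. set (t := - ln rho).
assert (Ht : 0 < t) by (unfold t; generalize (ln_increasing rho 1); rewrite ln_1; lra).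
assert (E : rho = exp (- t)) by (unfold t; rewrite Ropp_involutive, exp_ln; lra).
(* exp (t m) >= (t m)^3 / 27 *)
assert (Hb : forall M, 0 <= rho ^ M * (INR M + 2) ^ 2 <= (exp (2 * t) * 27 / t ^ 3) * / (INR M + 2)).
{ intros M. assert (P := pos_INR M). rewrite E, pow_exp_mult. set (m := INR M + 2).
  replace (t * INR M) with (t * m - 2 * t) by (unfold m; ring).
  replace (- (t * m - 2 * t)) with (2 * t + - (t * m)) by ring. rewrite exp_plus, exp_Ropp.
  assert (Hm : 2 <= m) by (unfold m; lra).
  assert (H3 : (t * m) ^ 3 / 27 <= exp (t * m)).
  { assert (H1 : 0 <= t * m / 3 <= exp (t * m / 3)).
    { split; [nra|]. generalize (exp_ineq1_le (t * m / 3)). nra. }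
    replace (exp (t * m)) with (exp (t * m / 3) ^ 3).
    - replace ((t * m) ^ 3 / 27) with ((t * m / 3) ^ 3) by field. apply pow_incr, H1.
    - simpl. rewrite Rmult_1_r, <- !exp_plus. f_equal. field. }
  assert (H4 : 0 < (t * m) ^ 3 / 27) by pos.
  assert (He := exp_pos (2 * t)). split.
  - apply Rmult_le_pos; [|nra]. apply Rmult_le_pos; [lra|]. left. apply Rinv_0_lt_compat. lra.
  - apply Rle_trans with (exp (2 * t) * / ((t * m) ^ 3 / 27) * m ^ 2).
    + apply Rmult_le_compat_r; [nra|]. apply Rmult_le_compat_l; [lra|].
      apply Rinv_le_contravar; lra.
    + right. field. lra. }
apply (is_lim_seq_le_le (fun _ => 0) _ (fun M => (exp (2 * t) * 27 / t ^ 3) * / (INR M + 2)));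
  [exact Hb|apply is_lim_seq_const|].
replace (Finite 0) with (Rbar_mult (exp (2 * t) * 27 / t ^ 3) 0) by (simpl; f_equal; ring).
apply is_lim_seq_scal_l. replace (Finite 0) with (Rbar_inv p_infty) by reflexivity.
apply is_lim_seq_inv; [|discriminate].
apply is_lim_seq_plus with p_infty 2; [apply is_lim_seq_INR|apply is_lim_seq_const|reflexivity].
Qed.

Definition eventually_nat (P : nat -> Prop) : Prop := exists N0, forall N, (N0 <= N)%nat -> P N.

Lemma ev_and P Q : eventually_nat P -> eventually_nat Q -> eventually_nat (fun n => P n /\ Q n).
Proof.
intros (a & Ha) (b & Hb). exists (a + b)%nat. intros N HN. split; [apply Ha|apply Hb]; lia.
Qed.

Lemma ev_imp (P Q : nat -> Prop) : (forall n, P n -> Q n) -> eventually_nat P -> eventually_nat Q.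
Proof. intros H (a & Ha). exists a. intros N HN. apply H, Ha, HN. Qed.

Lemma is_lim_seq_ev u (l : R) : is_lim_seq u l <->
  forall eps, 0 < eps -> eventually_nat (fun n => Rabs (u n - l) <= eps).
Proof.
split.
- intros H eps He. apply is_lim_seq_Reals in H. destruct (H eps He) as (N0 & HN).
  exists N0. intros n Hn. specialize (HN n Hn). unfold R_dist in HN. lra.
- intros H. apply is_lim_seq_Reals. intros eps He. destruct (H (eps / 2)) as (N0 & HN); [lra|].
  exists N0. intros n Hn. specialize (HN n Hn). unfold R_dist. lra.
Qed.

(** The generating function of the Fejer kernels is a multiple of the resolvent kernel. The
    truncation error is bounded on all of [[0, PI]], hence in the sum by that bound times [G PI] for
    every [N]; so [M] is fixed first and [N] goes to infinity afterwards. *)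
Lemma resolvent_abel_sum G (v : nat -> R) rho eta :
  nondecreasing_pos G -> (forall n, is_lim_seq (fun N => rs G N (fejer n)) (v n)) ->
  0 < rho < 1 -> 0 < eta ->
  eventually_nat (fun M => eventually_nat (fun N =>
    Rabs (rs G N (fun x => / ((1 - rho) ^ 2 / rho + chord2 x)) -
      (1 - rho) / (1 + rho) * sm (fun n => rho ^ n * v n) M) <= eta)).
Proof.
intros HG Hv Hr Heta. assert (PP := PI_RGT_0).
assert (HGP : 0 <= G PI) by (apply nondecreasing_pos_ge0; [exact HG|lra]).
set (c := (1 - rho) / (1 + rho)).
assert (Hc : 0 < c < 1).
{ unfold c. split; [apply Rdiv_lt_0_compat; lra|]. apply Rmult_lt_reg_r with (1 + rho); [lra|].
  unfold Rdiv. rewrite Rmult_assoc, Rinv_l; lra. }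
set (K := (4 + 2 / (1 - rho)) / (1 - rho) ^ 2).
assert (H1r : 0 < 2 / (1 - rho)) by pos.
assert (HK : 0 < K) by pos.
assert (Hlim := proj1 (is_lim_seq_ev _ _) (poly_geometric_lim rho Hr)).
specialize (Hlim (eta / (2 * K * (G PI + 1)))).
assert (Hden : 0 < 2 * K * (G PI + 1)) by pos.
refine (ev_imp _ _ _ (Hlim (Rdiv_lt_0_compat _ _ Heta Hden))). clear Hlim. intros M HM.
rewrite Rminus_0_r in HM.
assert (HMpos : 0 <= rho ^ M * (INR M + 2) ^ 2).
{ apply Rmult_le_pos; [apply pow_le; lra|apply pow2_ge_0]. }
rewrite Rabs_pos_eq in HM by exact HMpos.
assert (Hfin : is_lim_seq (fun N => c * sm (fun n => rho ^ n * rs G N (fejer n)) M)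
  (c * sm (fun n => rho ^ n * v n) M)).
{ apply is_lim_seq_mult'; [apply is_lim_seq_const|].
  apply (is_lim_seq_sm (fun N n => rho ^ n * rs G N (fejer n)) (fun n => rho ^ n * v n)).
  intros k _. apply is_lim_seq_mult'; [apply is_lim_seq_const|apply Hv]. }
destruct (proj1 (is_lim_seq_ev _ _) Hfin (eta / 2) ltac:(lra)) as (N0 & HN0).
exists N0. intros N HN. specialize (HN0 N HN).
assert (Hrs : c * sm (fun n => rho ^ n * rs G N (fejer n)) M =
  rs G N (fun x => c * sm (fun n => rho ^ n * fejer n x) M)).
{ rewrite rs_scal. f_equal. rewrite (rs_sm G N (fun n x => rho ^ n * fejer n x)).
  apply sm_ext. intros i _. rewrite rs_scal. reflexivity. }
assert (Hrem : Rabs (rs G N (fun x => / ((1 - rho) ^ 2 / rho + chord2 x) -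
    c * sm (fun n => rho ^ n * fejer n x) M)) <= eta / 2).
{ apply Rle_trans with (rs G N (fun _ => K * (rho ^ M * (INR M + 2) ^ 2))).
  2: { rewrite rs_const.
       apply Rle_trans with (K * (eta / (2 * K * (G PI + 1))) * (G PI + 1)).
       - apply Rmult_le_compat; try lra; [apply Rmult_le_pos; lra|apply Rmult_le_compat_l; lra].
       - right. field. lra. }
  apply rs_abs; [exact HG|]. intros x Hx.
  assert (Hid := fejer_partial_sums rho x M ltac:(lra)).
  assert (Hch := chord2_ge0 x).
  set (Q := (1 - rho) ^ 2 + rho * chord2 x) in *.
  assert (HQ : (1 - rho) ^ 2 <= Q) by (unfold Q; nra).
  assert (HQ0 : 0 < (1 - rho) ^ 2) by pos.
  set (S_ := sm (fun n => rho ^ n * fejer n x) M) in *.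
  set (T := (1 - 2 * cos x * rho) * fejer M x + rho * fejer (S M) x + 2 * rho ^ 2 / (1 - rho)) in *.
  replace (/ ((1 - rho) ^ 2 / rho + chord2 x)) with (rho / Q).
  2: { unfold Q. field. unfold Q in HQ. split; lra. }
  replace (rho / Q - c * S_) with (c * (rho ^ M * T / Q)).
  2: { apply Rmult_eq_reg_r with Q; [|lra].
       replace (c * (rho ^ M * T / Q) * Q) with (c * (rho ^ M * T)) by (field; lra).
       replace (rho ^ M * T) with (rho * (1 + rho) / (1 - rho) - Q * S_) by lra.
       unfold c. field. repeat split; lra. }
  assert (HT : Rabs T <= (4 + 2 / (1 - rho)) * (INR M + 2) ^ 2).
  { assert (F1 := fejer_abs_le M x). assert (F2 := fejer_abs_le (S M) x).
    rewrite S_INR in F2. assert (P := pos_INR M). assert (B := COS_bound x).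
    assert (B1 : Rabs (1 - 2 * cos x * rho) <= 3) by (apply Rabs_le; nra).
    unfold T. apply Rle_trans with (1 := Rabs_triang _ _).
    assert (A1 : Rabs ((1 - 2 * cos x * rho) * fejer M x) <= 3 * INR M ^ 2).
    { rewrite Rabs_mult. apply Rmult_le_compat; try apply Rabs_pos; assumption. }
    assert (A2 : Rabs (rho * fejer (S M) x) <= 1 * (INR M + 1) ^ 2).
    { rewrite Rabs_mult. apply Rmult_le_compat; try apply Rabs_pos; [|assumption].
      rewrite Rabs_pos_eq; lra. }
    assert (A3 : Rabs (2 * rho ^ 2 / (1 - rho)) <= 2 / (1 - rho)).
    { rewrite Rabs_pos_eq.
      - apply Rmult_le_compat_r; [left; apply Rinv_0_lt_compat; lra|nra].
      - apply Rdiv_le_0_compat; [nra|lra]. }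
    assert (A4 := Rabs_triang ((1 - 2 * cos x * rho) * fejer M x) (rho * fejer (S M) x)).
    assert (1 <= (INR M + 2) ^ 2) by nra. nra. }
  assert (Hpow : 0 <= rho ^ M) by pos.
  rewrite Rabs_mult, (Rabs_pos_eq c) by lra. unfold Rdiv at 1.
  rewrite !Rabs_mult, (Rabs_pos_eq (rho ^ M)), (Rabs_pos_eq (/ Q))
    by (try exact Hpow; left; apply Rinv_0_lt_compat; lra).
  assert (0 < / Q) by pos.
  assert (/ Q <= / (1 - rho) ^ 2) by (apply Rinv_le_contravar; lra).
  apply Rle_trans with (1 * (rho ^ M * ((4 + 2 / (1 - rho)) * (INR M + 2) ^ 2) * / (1 - rho) ^ 2)).
  - apply Rmult_le_compat; try lra.
    + apply Rmult_le_pos; [apply Rmult_le_pos; [exact Hpow|apply Rabs_pos]|lra].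
    + apply Rmult_le_compat; try lra; [apply Rmult_le_pos; [exact Hpow|apply Rabs_pos]|].
      apply Rmult_le_compat_l; assumption.
  - right. unfold K. field. lra. }
rewrite rs_minus, <- Hrs in Hrem.
replace (rs G N _ - c * sm (fun n => rho ^ n * v n) M) with
  ((rs G N (fun x => / ((1 - rho) ^ 2 / rho + chord2 x)) -
     c * sm (fun n => rho ^ n * rs G N (fejer n)) M) +
   (c * sm (fun n => rho ^ n * rs G N (fejer n)) M - c * sm (fun n => rho ^ n * v n) M)) by ring.
apply Rle_trans with (1 := Rabs_triang _ _). lra.
Qed.

(* u^3 <= 48 exp(u/2) turns the tail into a geometric sum. *)
Lemma tail_sum t (a : nat -> R) K M : 0 < t <= 1 ->
  (forall n, (K <= n)%nat -> 0 <= a n <= exp (- (t * INR n)) * (t * INR n) ^ 3) ->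
  t * sm (fun i => a (K + i)%nat) M <= 192 * exp (- (t * INR K / 2)).
Proof.
intros Ht Ha.
set (g := fun i => exp (- (t * INR (K + i) / 2))).
assert (Hexp3 : forall x, 0 <= x -> x ^ 3 <= 48 * exp (x / 2)).
{ intros x Hx. assert (H1 : 0 <= x / 6 <= exp (x / 6)).
  { split; [lra|]. generalize (exp_ineq1_le (x / 6)). lra. }
  apply pow_incr with (n := 3%nat) in H1.
  replace (exp (x / 6) ^ 3) with (exp (x / 2)) in H1.
  - assert (H2 : 0 <= (x / 2) ^ 3 / 6 <= exp (x / 2)).
    { split; [assert (0 <= (x / 2) ^ 3) by (apply pow_le; lra); lra|].
      apply (le_of_derive_le (fun u => u ^ 3 / 6) exp (fun u => u ^ 2 / 2) exp (x / 2)); try lra.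
      - intros u _. auto_derive; [exact I|field].
      - intros u _. apply is_derive_exp.
      - intros u Hu. apply (le_of_derive_le (fun u => u ^ 2 / 2) exp (fun u => u) exp u); try lra.
        + intros w _. auto_derive; [exact I|field].
        + intros w _. apply is_derive_exp.
        + intros w Hw. generalize (exp_ineq1_le w). lra.
        + rewrite exp_0. lra.
      - rewrite exp_0. lra. }
    replace ((x / 2) ^ 3 / 6) with (x ^ 3 / 48) in H2 by field. lra.
  - simpl. rewrite Rmult_1_r, <- !exp_plus. f_equal. field. }
(* 192 is 4 times 48: for [t <= 1] each step of the geometric sequence [g] loses at least the
   fraction [t / 4]. *)
assert (Hstep : forall i, t * a (K + i)%nat <= 192 * (g i - g (S i))).
{ intros i. destruct (Ha (K + i)%nat ltac:(lia)) as [_ H].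
  set (x := t * INR (K + i)) in *.
  assert (Hx : 0 <= x) by pos.
  assert (E1 : g i = exp (- (x / 2))) by (unfold g, x; f_equal; field).
  assert (E2 : g (S i) = exp (- (x / 2)) * exp (- (t / 2))).
  { unfold g, x. rewrite Nat.add_succ_r, S_INR, <- exp_plus. f_equal. field. }
  assert (Hd : exp (- (t / 2)) <= 1 - t / 4).
  { rewrite exp_Ropp. apply Rmult_le_reg_r with (exp (t / 2)); [apply exp_pos|].
    rewrite Rinv_l by apply Rgt_not_eq, exp_pos. generalize (exp_ineq1_le (t / 2)). nra. }
  assert (Hp := exp_pos (- (x / 2))).
  assert (H3 : exp (- x) * x ^ 3 <= 48 * exp (- (x / 2))).
  { replace (48 * exp (- (x / 2))) with (exp (- x) * (48 * exp (x / 2))).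
    - apply Rmult_le_compat_l; [left; apply exp_pos|apply Hexp3, Hx].
    - replace (- (x / 2)) with (- x + x / 2) by field. rewrite exp_plus. ring. }
  rewrite E1, E2. nra. }
apply Rle_trans with (192 * (g 0%nat - g M)).
- rewrite <- sm_scal.
  apply Rle_trans with (sm (fun i => 192 * (g i - g (S i))) M); [apply sm_le; auto|].
  rewrite sm_scal. right. f_equal.
  rewrite (sm_ext _ (fun i => (-1) * (g (S i) - g i))) by (intros; ring).
  rewrite sm_scal, (sm_telescope g). ring.
- unfold g at 1. rewrite Nat.add_0_r. assert (0 < g M) by pos. lra.
Qed.

(** The integrand of Gamma(1 + gamma). With [pw] in place of [Rpower] it is continuous on the whole
    line, so integrals from 0 are proper. *)
Definition gamma_density (gamma u : R) : R := pw gamma u * exp (- u).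

Lemma pw_continuous b x : 0 < b -> continuous (pw b) x.
Proof.
intros Hb. apply continuity_pt_filterlim. destruct (Rlt_dec 0 x) as [Hx|Hx].
- apply continuity_pt_ext_loc with (fun y => Rpower y b).
  + exists (mkposreal x Hx). intros y Hy. rewrite pw_pos; [reflexivity|].
    apply Rabs_def2 in Hy. simpl in Hy. unfold minus, plus, opp in Hy. simpl in Hy. lra.
  + apply continuity_pt_filterlim. apply (ex_derive_continuous (fun y => Rpower y b)).
    unfold Rpower. auto_derive. exact Hx.
- intros eps He. destruct (Rpower_small b eps Hb He) as (d & Hd & H).
  exists d. split; [exact Hd|]. intros y [_ Hy]. simpl in *. unfold R_dist in *.
  rewrite (pw_0 b x) by lra. rewrite Rminus_0_r.
  destruct (Rle_dec y 0) as [Hy0|Hy0]; [rewrite pw_0, Rabs_R0; lra|].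
  rewrite pw_pos, Rabs_pos_eq by (try (left; apply Rpower_pos); lra).
  apply H. apply Rabs_def2 in Hy. lra.
Qed.

Lemma gamma_density_continuous gamma x : 0 < gamma < 2 -> continuous (gamma_density gamma) x.
Proof.
intros Hg. apply (continuous_mult (pw gamma) (fun u => exp (- u))).
- apply pw_continuous. lra.
- apply (ex_derive_continuous (fun u => exp (- u))). auto_derive. exact I.
Qed.

Section AbelMeans.

Variables (L : R -> R) (gamma W : R) (v : nat -> R).
Hypothesis hgamma : 0 < gamma < 2.
Hypothesis Lpos : forall x, 0 < x -> 0 < L x.
Hypothesis Lunif : locally_uniform_sv L.
Hypothesis Lpot : potter_bounds L.
Hypothesis hW : 0 < W.
Hypothesis v0 : v 0%nat = 0.
Hypothesis vpos : forall n, 0 <= v n.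
Hypothesis hv : forall eps, 0 < eps -> eventually_nat (fun n =>
  Rabs (v n - W * (L (INR n) * Rpower (INR n) gamma)) <= eps * (L (INR n) * Rpower (INR n) gamma)).

(** The order of [v n] at n = 1 / t, where the Abel mean with ratio [exp (- t)] has its mass. *)
Let T t := Rpower t (- gamma) * L (/ t).

Lemma scale_pos t : 0 < t -> 0 < T t.
Proof.
intros Ht. apply Rmult_lt_0_compat; [apply Rpower_pos|apply Lpos, Rinv_0_lt_compat, Ht].
Qed.

Lemma scale_shift t x : 0 < t -> 0 < x -> L (/ t) * Rpower x gamma = T t * Rpower (t * x) gamma.
Proof.
intros Ht Hx. unfold T. rewrite Rpower_mul_base, Rpower_Ropp by assumption.
field. apply Rgt_not_eq, Rpower_pos.
Qed.

(** Potter's inequality with exponent [gamma / 2] leaves the power [gamma / 2] of [t * n]. The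
    finitely many indices before the asymptotics sets in are bounded by a constant [Z]; the same
    inequality at the fixed index [k] shows that [Z] is at most a multiple of
    [T t * Rpower t (gamma / 2)]. *)
Lemma profile_low_bound : exists C, 0 < C /\ near0 (fun t => forall n, (0 < n)%nat -> t * INR n <= 1 ->
  v n <= C * T t * Rpower (t * INR n) (gamma / 2)).
Proof.
destruct (hv 1 Rlt_0_1) as (n0 & Hn0).
destruct (Lpot (gamma / 2) ltac:(lra)) as (MP & C & HMP & HC & Hpot).
destruct (INR_unbounded MP) as (n1 & Hn1).
set (k := (n0 + n1)%nat).
assert (Hk1 : INR n1 <= INR k) by (apply le_INR; unfold k; lia).
set (Z := sm v k + 1).
assert (HZ : 1 <= Z) by (unfold Z; generalize (sm_ge0 v k (fun i _ => vpos i)); lra).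
assert (HvZ : forall n, (n < k)%nat -> v n <= Z).
{ intros n Hn. unfold Z. replace k with (S n + (k - S n))%nat by lia. rewrite sm_split.
  assert (H1 := sm_ge0 (fun i => v (S n + i)%nat) (k - S n) (fun i _ => vpos _)).
  simpl sm at 1. assert (H2 := sm_ge0 v n (fun i _ => vpos i)). lra. }
set (c0 := L (INR k) * Rpower (INR k) (gamma / 2)).
assert (Hc0 : 0 < c0) by (apply Rmult_lt_0_compat; [apply Lpos; lra|apply Rpower_pos]).
set (C1 := (W + 1) * C + C * Z / c0).
assert (HCZ : 0 < C * Z / c0) by pos.
exists C1. split; [unfold C1; nra|].
exists (/ INR k). split; [apply Rinv_0_lt_compat; lra|]. intros t Ht n Hn Htn.
assert (Hit : INR k < / t).
{ rewrite <- (Rinv_inv (INR k)). apply Rinv_lt_contravar; [|lra].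
  apply Rmult_lt_0_compat; [lra|apply Rinv_0_lt_compat; lra]. }
assert (Hnt : INR n <= / t).
{ apply Rmult_le_reg_l with t; [lra|]. rewrite Rinv_r by lra. exact Htn. }
assert (Tp := scale_pos t ltac:(lra)).
assert (Hpt : forall x, MP <= x -> x <= / t ->
  L x * Rpower x gamma <= C * T t * Rpower (t * x) (gamma / 2) /\
  L x * Rpower x (gamma / 2) <= C * T t * Rpower t (gamma / 2)).
{ intros x Hx Hxt.
  destruct (Hpot x (/ t) Hx Hxt) as [_ H].
  assert (Hr : Rpower (/ t / x) (gamma / 2) * Rpower x (gamma / 2) = Rpower t (- (gamma / 2))).
  { rewrite <- Rpower_mul_base by (try apply Rdiv_lt_0_compat; try apply Rinv_0_lt_compat; lra).
    replace (/ t / x * x) with (/ t) by (field; lra). unfold Rpower.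
    rewrite ln_Rinv by lra. f_equal. ring. }
  assert (Hg : forall y, Rpower y gamma = Rpower y (gamma / 2) * Rpower y (gamma / 2)).
  { intros y. rewrite <- Rpower_plus. f_equal. field. }
  assert (H2 : L x * Rpower x (gamma / 2) <= C * T t * Rpower t (gamma / 2)).
  { apply Rle_trans with (C * Rpower (/ t / x) (gamma / 2) * L (/ t) * Rpower x (gamma / 2)).
    - apply Rmult_le_compat_r; [left; apply Rpower_pos|exact H].
    - right. replace (C * Rpower (/ t / x) (gamma / 2) * L (/ t) * Rpower x (gamma / 2)) with
        (C * L (/ t) * (Rpower (/ t / x) (gamma / 2) * Rpower x (gamma / 2))) by ring.
      rewrite Hr. unfold T. rewrite !Rpower_Ropp, Hg. field. apply Rgt_not_eq, Rpower_pos. }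
  split; [|exact H2].
  rewrite Hg, Rpower_mul_base by lra.
  apply Rmult_le_compat_r with (r := Rpower x (gamma / 2)) in H2; [lra|left; apply Rpower_pos]. }
assert (Hgoal : C * T t * Rpower (t * INR n) (gamma / 2) > 0) by pos.
set (p := Rpower (t * INR n) (gamma / 2)) in *.
assert (Hpp : 0 < p) by pos.
destruct (Nat.lt_ge_cases n k) as [Hnk|Hnk].
- assert (Hp1 : Rpower t (gamma / 2) <= p).
  { unfold p. apply Rpower_le_mono; [|lra]. split; [lra|].
    assert (1 <= INR n) by (apply (le_INR 1); lia). nra. }
  destruct (Hpt (INR k) ltac:(lra) ltac:(lra)) as [_ H]. fold c0 in H.
  apply Rle_trans with (1 := HvZ n Hnk).
  apply Rle_trans with (C * Z / c0 * T t * p).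
  + apply Rmult_le_reg_r with (c0 / Z); [apply Rdiv_lt_0_compat; lra|].
    replace (Z * (c0 / Z)) with c0 by (field; lra).
    replace (C * Z / c0 * T t * p * (c0 / Z)) with (C * T t * p) by (field; lra).
    apply Rle_trans with (1 := H). apply Rmult_le_compat_l; [nra|exact Hp1].
  + apply Rmult_le_compat_r; [lra|]. apply Rmult_le_compat_r; [lra|]. unfold C1. nra.
- assert (HnMP : MP <= INR n) by (apply Rle_trans with (INR k); [lra|apply le_INR; exact Hnk]).
  destruct (Hpt (INR n) HnMP Hnt) as [H _]. fold p in H.
  specialize (Hn0 n ltac:(unfold k in Hnk; lia)). apply Rabs_le_between in Hn0.
  apply Rle_trans with ((W + 1) * (L (INR n) * Rpower (INR n) gamma)); [lra|].
  apply Rle_trans with ((W + 1) * (C * T t * p)); [apply Rmult_le_compat_l; lra|].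
  unfold C1. nra.
Qed.

(** Potter's inequality yields the exponent 3 gamma / 2, rounded up to 3 as [tail_sum] expects. *)
Lemma profile_high_bound : exists C, 0 < C /\ near0 (fun t => forall n, 1 <= t * INR n ->
  v n <= C * T t * (t * INR n) ^ 3).
Proof.
destruct (hv 1 Rlt_0_1) as (n0 & Hn0).
destruct (Lpot (gamma / 2) ltac:(lra)) as (MP & C & HMP & HC & Hpot).
destruct (INR_unbounded MP) as (n1 & Hn1).
set (k := (n0 + n1)%nat).
assert (Hk1 : INR n1 <= INR k) by (apply le_INR; unfold k; lia).
exists ((W + 1) * C). split; [nra|].
exists (/ INR k). split; [apply Rinv_0_lt_compat; lra|]. intros t Ht n Htn.
assert (Hit : INR k < / t).
{ rewrite <- (Rinv_inv (INR k)). apply Rinv_lt_contravar; [|lra].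
  apply Rmult_lt_0_compat; [lra|apply Rinv_0_lt_compat; lra]. }
assert (Hnt : / t <= INR n).
{ apply Rmult_le_reg_l with t; [lra|]. rewrite Rinv_r by lra. exact Htn. }
assert (Hnk : (k <= n)%nat) by (apply INR_le; lra).
destruct (Hpot (/ t) (INR n) ltac:(lra) Hnt) as [H _].
replace (INR n / / t) with (t * INR n) in H by (field; lra).
assert (Tp := scale_pos t ltac:(lra)).
specialize (Hn0 n ltac:(unfold k in Hnk; lia)). apply Rabs_le_between in Hn0.
apply Rle_trans with ((W + 1) * (L (INR n) * Rpower (INR n) gamma)); [lra|].
replace ((W + 1) * C * T t * (t * INR n) ^ 3) with ((W + 1) * (C * T t * (t * INR n) ^ 3)) by ring.
apply Rmult_le_compat_l; [lra|].
apply Rle_trans with (C * Rpower (t * INR n) (gamma / 2) * L (/ t) * Rpower (INR n) gamma).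
{ apply Rmult_le_compat_r; [left; apply Rpower_pos|exact H]. }
rewrite Rmult_assoc, scale_shift by lra.
replace (C * Rpower (t * INR n) (gamma / 2) * (T t * Rpower (t * INR n) gamma)) with
  (C * T t * (Rpower (t * INR n) (gamma / 2) * Rpower (t * INR n) gamma)) by ring.
apply Rmult_le_compat_l; [nra|]. rewrite <- Rpower_plus, <- Rpower_pow by lra.
apply Rle_Rpower; [exact Htn|]. simpl. lra.
Qed.

(** The analogue of [head_estimate] for the sequence. Since [v] has no monotonicity to fall back on,
    the range of small [t * n] is handled by [profile_low_bound]. *)
Lemma profile_estimate eps B : 0 < eps -> 1 <= B ->
  near0 (fun t => forall n, t * INR n <= B ->
    Rabs (v n - W * T t * pw gamma (t * INR n)) <= eps * T t).
Proof.
intros He HB.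
destruct profile_low_bound as (C & HC & Hlow).
destruct (near0_and _ _ (Rpower_small (gamma / 2) (eps / (2 * (C + W))) ltac:(lra)
  ltac:(apply Rdiv_lt_0_compat; lra)) (near0_lt 1 Rlt_0_1)) as (d0 & Hd0 & Hd).
set (d := d0 / 2). destruct (Hd d) as [Hde Hd1]; [unfold d; lra|].
assert (Hdpos : 0 < d) by pos.
assert (BB := Rpower_ge_1 B gamma HB ltac:(lra)).
set (e1 := Rmin 1 (eps / ((2 + W) * Rpower B gamma))).
assert (He1 : 0 < e1) by pos.
assert (He1' : e1 <= 1) by apply Rmin_l.
assert (He1'' : e1 * ((2 + W) * Rpower B gamma) <= eps).
{ assert (e1 <= eps / ((2 + W) * Rpower B gamma)) by apply Rmin_r.
  apply Rmult_le_compat_r with (r := (2 + W) * Rpower B gamma) in H; [|nra].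
  replace (eps / ((2 + W) * Rpower B gamma) * ((2 + W) * Rpower B gamma)) with eps in H
    by (field; split; nra). exact H. }
set (B' := Rmax B (/ d)).
assert (HB' : 1 <= B') by (apply Rle_trans with (1 := HB), Rmax_l).
destruct (Lunif e1 B' He1 HB') as (M & HM & HU).
destruct (hv e1 He1) as (n0 & Hn0).
assert (Hlt1 : near0 (fun t => t < / M)) by (apply near0_lt, Rinv_0_lt_compat, HM).
assert (Hlt2 : near0 (fun t => t < d / (INR n0 + 1))).
{ apply near0_lt, Rdiv_lt_0_compat; [lra|generalize (pos_INR n0); lra]. }
refine (near0_imp _ _ _ (near0_and _ _ Hlow (near0_and _ _ Hlt1 Hlt2))).
intros t Ht (Hl & Ht1 & Ht2) n Htn.
assert (Tp := scale_pos t Ht).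
destruct (Nat.eq_dec n 0) as [->|Hn].
{ rewrite v0, (pw_0 gamma) by (simpl; lra).
  replace (0 - W * T t * 0) with 0 by ring. rewrite Rabs_R0. nra. }
assert (Hnp : 0 < INR n) by (apply lt_0_INR; lia).
assert (Htnp : 0 < t * INR n) by nra.
rewrite pw_pos by exact Htnp.
destruct (Rle_dec d (t * INR n)) as [Hdn|Hdn].
- assert (Hn0n : (n0 <= n)%nat).
  { apply INR_le. apply Rmult_le_reg_l with t; [lra|]. apply Rle_trans with (2 := Hdn).
    apply Rmult_lt_compat_r with (r := INR n0 + 1) in Ht2; [|generalize (pos_INR n0); lra].
    replace (d / (INR n0 + 1) * (INR n0 + 1)) with d in Ht2
      by (field; generalize (pos_INR n0); lra). nra. }
  specialize (Hn0 n Hn0n).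
  assert (HUn := HU (/ t) (t * INR n)).
  replace (t * INR n * / t) with (INR n) in HUn by (field; lra).
  assert (HLn : Rabs (L (INR n) / L (/ t) - 1) < e1).
  { apply HUn.
    - rewrite <- (Rinv_inv M). apply Rinv_le_contravar; lra.
    - split.
      + apply Rle_trans with (2 := Hdn). rewrite <- (Rinv_inv d).
        apply Rinv_le_contravar; [apply Rinv_0_lt_compat; lra|apply Rmax_r].
      + apply Rle_trans with (1 := Htn), Rmax_l. }
  assert (Ls := Lpos (/ t) ltac:(apply Rinv_0_lt_compat; lra)).
  assert (Ln := Lpos (INR n) Hnp).
  assert (E : L (INR n) * Rpower (INR n) gamma =
    (L (INR n) / L (/ t)) * (T t * Rpower (t * INR n) gamma)).
  { rewrite <- scale_shift by lra. field. lra. }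
  rewrite E in Hn0. set (l := L (INR n) / L (/ t)) in *.
  assert (Hp : Rpower (t * INR n) gamma <= Rpower B gamma) by (apply Rpower_le_mono; lra).
  assert (Pp := Rpower_pos (t * INR n) gamma).
  set (p := Rpower (t * INR n) gamma) in *.
  assert (Hl2 : l <= 2) by (apply Rabs_def2 in HLn; lra).
  replace (v n - W * T t * p) with ((v n - W * (l * (T t * p))) + W * (T t * p) * (l - 1)) by ring.
  apply Rle_trans with (1 := Rabs_triang _ _). rewrite Rabs_mult, (Rabs_pos_eq (W * (T t * p)));
    [|apply Rmult_le_pos; nra].
  assert (A1 : e1 * (l * (T t * p)) <= e1 * (2 * (T t * p))).
  { apply Rmult_le_compat_l; [lra|]. apply Rmult_le_compat_r; nra. }
  assert (A2 : W * (T t * p) * Rabs (l - 1) <= W * (T t * p) * e1).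
  { apply Rmult_le_compat_l; [apply Rmult_le_pos; nra|lra]. }
  apply Rle_trans with (e1 * (2 + W) * (T t * p)); [lra|].
  apply Rle_trans with (e1 * (2 + W) * (T t * Rpower B gamma)).
  + apply Rmult_le_compat_l; [nra|]. apply Rmult_le_compat_l; lra.
  + replace (e1 * (2 + W) * (T t * Rpower B gamma)) with (e1 * ((2 + W) * Rpower B gamma) * T t) by ring.
    apply Rmult_le_compat_r; lra.
- assert (H1 := Hl n ltac:(lia) ltac:(lra)).
  assert (Hp : Rpower (t * INR n) (gamma / 2) <= Rpower d (gamma / 2)) by (apply Rpower_le_mono; lra).
  assert (Pp := Rpower_pos (t * INR n) (gamma / 2)).
  assert (Pq := Rpower_pos (t * INR n) gamma).
  assert (Hq : Rpower (t * INR n) gamma <= Rpower (t * INR n) (gamma / 2)).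
  { replace gamma with (gamma / 2 + gamma / 2) at 1 by field. rewrite Rpower_plus.
    assert (Rpower (t * INR n) (gamma / 2) <= 1).
    { replace 1 with (Rpower 1 (gamma / 2)) by (unfold Rpower; rewrite ln_1, Rmult_0_r; apply exp_0).
      apply Rpower_le_mono; lra. }
    nra. }
  set (p := Rpower (t * INR n) (gamma / 2)) in *. set (q := Rpower (t * INR n) gamma) in *.
  assert (Hpe : (C + W) * p <= eps / 2).
  { apply Rle_trans with ((C + W) * (eps / (2 * (C + W)))); [apply Rmult_le_compat_l; lra|].
    right. field. lra. }
  specialize (vpos n).
  assert (HCp : C * p <= eps / 2) by nra. assert (HWp : W * p <= eps / 2) by nra.
  assert (C * T t * p <= T t * (eps / 2)) by nra.
  assert (0 <= W * T t * q <= T t * (eps / 2)).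
  { split; [apply Rmult_le_pos; nra|]. replace (W * T t * q) with (T t * (W * q)) by ring.
    apply Rmult_le_compat_l; [lra|]. nra. }
  apply Rabs_le. nra.
Qed.

End AbelMeans.

(** * The Gamma integral *)

(** The partition need not be uniform, as the substitution in [model_integral] requires, and the
    tags are only asked to be close to [h] on their cells. *)
Lemma riemann_sum_error (h : R -> R) (x c : nat -> R) (n : nat) (w : R) :
  (forall i, (i < n)%nat -> x i <= x (S i)) ->
  (forall y, x 0%nat <= y <= x n -> continuous h y) ->
  (forall i y, (i < n)%nat -> x i <= y <= x (S i) -> Rabs (h y - c i) <= w) ->
  Rabs (sm (fun i => c i * (x (S i) - x i)) n - RInt h (x 0%nat) (x n)) <= w * (x n - x 0%nat).
Proof.
intros Hmono Hc Hw.
assert (Hge : forall m, (m <= n)%nat -> x 0%nat <= x m /\ x m <= x n).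
{ intros m Hm. split.
  - clear Hw Hc. induction m as [|m IH]; [lra|].
    apply Rle_trans with (x m); [apply IH; lia|apply Hmono; lia].
  - clear Hw Hc. induction Hm as [|n Hm IH]; [lra|].
    apply Rle_trans with (x n); [apply IH; intros; apply Hmono; lia|apply Hmono; lia]. }
assert (H : forall m, (m <= n)%nat ->
  Rabs (sm (fun i => c i * (x (S i) - x i)) m - RInt h (x 0%nat) (x m)) <= w * (x m - x 0%nat)).
2: { apply H. lia. }
induction m as [|m IH]; intros Hm.
- simpl. rewrite RInt_point. change (@zero R_CompleteNormedModule) with 0.
  rewrite Rminus_0_r, Rabs_R0. lra.
- specialize (IH ltac:(lia)). assert (Hx := Hmono m ltac:(lia)).
  destruct (Hge m ltac:(lia)) as [Ha Hb]. destruct (Hge (S m) Hm) as [Ha' Hb'].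
  assert (E1 : ex_RInt h (x 0%nat) (x m)).
  { apply (ex_RInt_continuous (V := R_CompleteNormedModule)). rewrite Rmin_left, Rmax_right by lra.
    intros z Hz. apply Hc. lra. }
  assert (E2 : ex_RInt h (x m) (x (S m))).
  { apply (ex_RInt_continuous (V := R_CompleteNormedModule)). rewrite Rmin_left, Rmax_right by lra.
    intros z Hz. apply Hc. lra. }
  assert (Ech : RInt h (x 0%nat) (x (S m)) = RInt h (x 0%nat) (x m) + RInt h (x m) (x (S m))).
  { symmetry. apply (RInt_Chasles h); assumption. }
  rewrite Ech. simpl sm.
  assert (Hcell : Rabs (c m * (x (S m) - x m) - RInt h (x m) (x (S m))) <= w * (x (S m) - x m)).
  { replace (c m * (x (S m) - x m) - RInt h (x m) (x (S m))) with
      (- (RInt (fun y => minus (h y) (c m)) (x m) (x (S m)))).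
    - rewrite Rabs_Ropp, Rmult_comm. apply abs_RInt_le_const; [lra| |].
      + apply (ex_RInt_minus h (fun _ => c m)); [exact E2|apply ex_RInt_const].
      + intros y Hy. apply Hw; [lia|exact Hy].
    - rewrite (RInt_minus h (fun _ => c m)); [|exact E2|apply ex_RInt_const].
      rewrite RInt_const. unfold minus, plus, opp, scal. simpl. unfold mult. simpl. ring. }
  replace (sm (fun i => c i * (x (S i) - x i)) m + c m * (x (S m) - x m) -
    (RInt h (x 0%nat) (x m) + RInt h (x m) (x (S m)))) with
    ((sm (fun i => c i * (x (S i) - x i)) m - RInt h (x 0%nat) (x m)) +
     (c m * (x (S m) - x m) - RInt h (x m) (x (S m)))) by ring.
  apply Rle_trans with (1 := Rabs_triang _ _). lra.
Qed.

Section GammaIntegral.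

Variable gamma : R.
Hypothesis hgamma : 0 < gamma < 2.

Let psi := gamma_density gamma.

Lemma ex_RInt_gamma_density a b : ex_RInt psi a b.
Proof.
apply (ex_RInt_continuous (V := R_CompleteNormedModule)). intros z _.
apply gamma_density_continuous. exact hgamma.
Qed.

Lemma gamma_density_ge0 u : 0 <= psi u.
Proof. apply Rmult_le_pos; [apply pw_ge0|left; apply exp_pos]. Qed.

(** u^gamma is at most 1 + u^2, which half of the exponential absorbs; the bound has integral 16
    over the half-line. *)
Lemma gamma_density_le u : 0 <= u -> psi u <= 8 * exp (- (u / 2)).
Proof.
intros Hu.
assert (H1 : pw gamma u <= 1 + u ^ 2).
{ destruct (Rle_dec u 1) as [H|H].
  - apply Rle_trans with (pw gamma 1); [apply pw_le; lra|]. rewrite pw_pos by lra.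
    unfold Rpower. rewrite ln_1, Rmult_0_r, exp_0. nra.
  - rewrite pw_pos by lra. apply Rle_trans with (Rpower u 2); [apply Rle_Rpower; lra|].
    replace 2 with (1 + 1) by ring. rewrite Rpower_plus, Rpower_1 by lra. nra. }
assert (H2 : 1 + u ^ 2 <= 8 * exp (u / 2)).
{ assert (1 + u / 4 <= exp (u / 4)) by apply exp_ineq1_le.
  replace (u / 2) with (u / 4 + u / 4) by field. rewrite exp_plus.
  assert (H3 := le_of_derive_le (fun t => 1 + t + t ^ 2 / 2) exp (fun t => 1 + t) exp (u / 2)).
  assert (1 + u / 2 + (u / 2) ^ 2 / 2 <= exp (u / 2)).
  { apply H3; try lra.
    - intros t _. auto_derive; [exact I|field].
    - intros t _. apply is_derive_exp.
    - intros t _. apply exp_ineq1_le.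
    - rewrite exp_0. lra. }
  rewrite <- exp_plus. replace (u / 4 + u / 4) with (u / 2) by field. nra. }
unfold psi, gamma_density. replace (8 * exp (- (u / 2))) with (8 * exp (u / 2) * exp (- u)).
- apply Rmult_le_compat_r; [left; apply exp_pos|lra].
- rewrite Rmult_assoc, <- exp_plus. do 2 f_equal. field.
Qed.

Lemma gamma_integral_diff a b : RInt psi 0 b - RInt psi 0 a = RInt psi a b.
Proof.
assert (E : plus (RInt psi 0 a) (RInt psi a b) = RInt psi 0 b)
  by (apply (RInt_Chasles psi); apply ex_RInt_gamma_density).
unfold plus in E. simpl in E. lra.
Qed.

Lemma gamma_integral_le a b : 0 <= a <= b -> RInt psi 0 a <= RInt psi 0 b.
Proof.
intros Hab. assert (H := gamma_integral_diff a b).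
assert (0 <= RInt psi a b); [|lra].
apply RInt_ge_0; [lra|apply ex_RInt_gamma_density|intros; apply gamma_density_ge0].
Qed.

Lemma gamma_integral_bound b : 0 <= b -> RInt psi 0 b <= 16.
Proof.
intros Hb.
assert (H : is_RInt (fun u => 8 * exp (- (u / 2))) 0 b (minus (-16 * exp (- (b / 2))) (-16 * exp (- (0 / 2))))).
{ apply (is_RInt_derive (fun u => -16 * exp (- (u / 2)))).
  - intros x _. auto_derive; [exact I|unfold Rdiv; field].
  - intros x _. apply (ex_derive_continuous (fun u => 8 * exp (- (u / 2)))). auto_derive. exact I. }
apply Rle_trans with (RInt (fun u => 8 * exp (- (u / 2))) 0 b).
- apply RInt_le; [exact Hb|apply ex_RInt_gamma_density|eexists; exact H|]. intros x Hx. apply gamma_density_le. lra.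
- rewrite (is_RInt_unique _ _ _ _ H). unfold minus, plus, opp. simpl.
  replace (- (0 / 2)) with 0 by field. rewrite exp_0. generalize (exp_pos (- (b / 2))). lra.
Qed.

Definition gamma_limit (g : R) : Prop :=
  forall eps, 0 < eps -> exists B0, 1 <= B0 /\ forall b, B0 <= b -> Rabs (RInt psi 0 b - g) <= eps.

Lemma gamma_limit_exists : exists g, gamma_limit g.
Proof.
destruct (completeness (fun y => exists b, 0 <= b /\ y = RInt psi 0 b)) as (g & Hub & Hlub).
- exists 16. intros y (b & Hb & ->). apply gamma_integral_bound, Hb.
- exists (RInt psi 0 0), 0. split; [lra|reflexivity].
- exists g. intros eps He.
  assert (Hex : exists b, 0 <= b /\ g - eps < RInt psi 0 b).
  { apply Classical_Prop.NNPP. intros Hn. assert (g <= g - eps); [|lra].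
    apply Hlub. intros y (b & Hb & ->). apply Rnot_lt_le. intros Hlt. apply Hn. exists b. auto. }
  destruct Hex as (b0 & Hb0 & Hlt). exists (Rmax 1 b0). split; [apply Rmax_l|].
  intros b Hb. assert (H2 := Rmax_r 1 b0).
  assert (H3 := gamma_integral_le b0 b ltac:(lra)).
  assert (H4 : RInt psi 0 b <= g) by (apply Hub; exists b; split; [lra|reflexivity]).
  apply Rabs_le. lra.
Qed.

Lemma gamma_integral_small a : 0 <= a <= 1 -> 0 <= RInt psi 0 a <= 8 * a.
Proof.
intros Ha. split.
- apply RInt_ge_0; [lra|apply ex_RInt_gamma_density|intros; apply gamma_density_ge0].
- assert (H := abs_RInt_le_const psi 0 a 8 (proj1 Ha) (ex_RInt_gamma_density 0 a)).
  apply Rle_trans with (1 := Rle_abs _). rewrite Rminus_0_r in H. rewrite Rmult_comm. apply H.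
  intros t Ht. rewrite Rabs_pos_eq by apply gamma_density_ge0. apply Rle_trans with (1 := gamma_density_le t (proj1 Ht)).
  assert (exp (- (t / 2)) <= exp 0) by (apply exp_le_mono; lra). rewrite exp_0 in H0. lra.
Qed.

Lemma is_Gamma_of_limit g : gamma_limit g -> is_Gamma (1 + gamma) g.
Proof.
intros Hg eps He. destruct (Hg (eps / 4) ltac:(lra)) as (B0 & HB0 & HB).
(* [/ B0] keeps the upper limit beyond [B0]; [eps / 32] makes the missing piece below [a], at most
   [8 * a], smaller than [eps / 4]. *)
set (d := Rmin (/ B0) (Rmin (1 / 2) (eps / 32))).
assert (Hd : 0 < d) by pos.
assert (H1 : d <= / B0) by apply Rmin_l.
assert (H2 : d <= Rmin (1 / 2) (eps / 32)) by apply Rmin_r.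
assert (H3 := Rmin_l (1 / 2) (eps / 32)). assert (H4 := Rmin_r (1 / 2) (eps / 32)).
exists d. split; [exact Hd|]. intros a b Ha Hb.
assert (HBd : B0 <= / d).
{ rewrite <- (Rinv_inv B0). apply Rinv_le_contravar; lra. }
assert (Heq : forall t, Rmin a b < t < Rmax a b ->
  psi t = Rpower t (1 + gamma - 1) * exp (- t)).
{ intros t Ht. assert (0 < Rmin a b) by pos.
  unfold psi, gamma_density. rewrite pw_pos by lra. do 2 f_equal. ring. }
assert (Hex : ex_RInt (fun t => Rpower t (1 + gamma - 1) * exp (- t)) a b).
{ apply (ex_RInt_ext psi); [exact Heq|apply ex_RInt_gamma_density]. }
exists (ex_RInt_Reals_0 _ _ _ Hex). rewrite <- RInt_Reals.
rewrite <- (RInt_ext psi _ a b Heq), <- gamma_integral_diff.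
assert (S1 := gamma_integral_small a ltac:(lra)). assert (S2 := HB b ltac:(lra)).
apply Rabs_le_between in S2. apply Rabs_def1; lra.
Qed.

Lemma is_Gamma_unique s g1 g2 : is_Gamma s g1 -> is_Gamma s g2 -> g1 = g2.
Proof.
intros H1 H2. apply Rminus_diag_uniq, Rabs_eq_0.
apply Rle_antisym; [|apply Rabs_pos]. apply le_epsilon. intros eps He. rewrite Rplus_0_l.
destruct (H1 (eps / 2) ltac:(lra)) as (d1 & Hd1 & H1').
destruct (H2 (eps / 2) ltac:(lra)) as (d2 & Hd2 & H2').
set (d := Rmin d1 d2). assert (Hd : 0 < d) by pos.
assert (A1 : d <= d1) by apply Rmin_l. assert (A2 : d <= d2) by apply Rmin_r.
assert (/ d1 <= / d) by (apply Rinv_le_contravar; lra).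
assert (/ d2 <= / d) by (apply Rinv_le_contravar; lra).
destruct (H1' (d / 2) (/ d + 1) ltac:(lra) ltac:(lra)) as (p1 & Hp1).
destruct (H2' (d / 2) (/ d + 1) ltac:(lra) ltac:(lra)) as (p2 & Hp2).
rewrite (RiemannInt_P5 p2 p1) in Hp2.
apply Rabs_def2 in Hp1. apply Rabs_def2 in Hp2. apply Rabs_le. lra.
Qed.

(** [Gamma] is picked by [epsilon], so its value is reached by showing that the specification can be
    met and that it determines the number. *)
Lemma gamma_limit_Gamma : gamma_limit (Gamma (1 + gamma)).
Proof.
destruct gamma_limit_exists as (g & Hg).
assert (H := is_Gamma_of_limit g Hg).
assert (H' : is_Gamma (1 + gamma) (Gamma (1 + gamma))).
{ unfold Gamma. apply epsilon_spec. exists g. exact H. }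
rewrite (is_Gamma_unique _ _ _ H' H). exact Hg.
Qed.

Lemma Gamma_pos : 0 < Gamma (1 + gamma).
Proof.
assert (Hg := gamma_limit_Gamma).
assert (Hpos : 0 < RInt psi 0 1).
{ apply RInt_gt_0; [lra| |].
  - intros x Hx. apply Rmult_lt_0_compat; [rewrite pw_pos by lra; apply Rpower_pos|apply exp_pos].
  - intros x _. apply gamma_density_continuous. exact hgamma. }
destruct (Hg (RInt psi 0 1 / 2) ltac:(lra)) as (B0 & HB0 & H).
specialize (H B0 (Rle_refl _)). assert (H1 := gamma_integral_le 1 B0 ltac:(lra)).
apply Rabs_le_between in H. lra.
Qed.

End GammaIntegral.

(** Gives the constant [/ PI] of the linear case. *)
Lemma Gamma_2 : Gamma 2 = 1.
Proof.
assert (Hg := gamma_limit_Gamma 1 ltac:(lra)). replace (1 + 1) with 2 in Hg by ring.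
assert (E : forall b, 0 <= b -> RInt (gamma_density 1) 0 b = 1 - (b + 1) * exp (- b)).
{ intros b Hb. rewrite (RInt_ext _ (fun u => u * exp (- u))).
  - apply is_RInt_unique.
    replace (1 - (b + 1) * exp (- b)) with
      (minus ((fun u => - (u + 1) * exp (- u)) b) ((fun u => - (u + 1) * exp (- u)) 0)).
    + apply (is_RInt_derive (fun u => - (u + 1) * exp (- u))).
      * intros x _. auto_derive; [exact I|ring].
      * intros x _. apply (ex_derive_continuous (fun u => u * exp (- u))). auto_derive. exact I.
    + unfold minus, plus, opp. simpl. rewrite Ropp_0, exp_0. ring.
  - intros x. rewrite Rmin_left, Rmax_right by exact Hb. intros Hx. unfold gamma_density.
    rewrite pw_pos, Rpower_1 by lra. reflexivity. }
apply Rminus_diag_uniq, Rabs_eq_0. apply Rle_antisym; [|apply Rabs_pos].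
apply le_epsilon. intros eps He. rewrite Rplus_0_l.
destruct (Hg (eps / 2) ltac:(lra)) as (B0 & HB0 & H).
set (b := Rmax B0 (32 / eps)).
assert (Hb1 : B0 <= b) by apply Rmax_l. assert (Hb2 : 32 / eps <= b) by apply Rmax_r.
specialize (H b Hb1). rewrite E in H by lra.
(* (b+1) exp(-b) <= 8/b *)
assert (Hs : 0 <= (b + 1) * exp (- b) <= eps / 2).
{ assert (Hexp : 1 + b / 2 <= exp (b / 2)) by apply exp_ineq1_le.
  assert (Hexp2 : (b / 2) * (b / 2) <= exp b).
  { replace b with (b / 2 + b / 2) at 3 by field. rewrite exp_plus. apply Rmult_le_compat; lra. }
  rewrite exp_Ropp. assert (0 < exp b) by pos.
  assert (0 < / exp b) by pos.
  split; [nra|]. apply Rmult_le_reg_r with (exp b); [lra|].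
  rewrite Rmult_assoc, Rinv_l, Rmult_1_r by lra.
  apply Rle_trans with (eps / 2 * (b / 2 * (b / 2))); [|apply Rmult_le_compat_l; lra].
  assert (32 <= b * eps).
  { apply Rmult_le_compat_r with (r := eps) in Hb2; [|lra].
    replace (32 / eps * eps) with 32 in Hb2 by (field; lra). exact Hb2. }
  nra. }
apply Rabs_le_between in H. apply Rabs_le. lra.
Qed.

(** * Limits of the Abel means and of the resolvent integrals *)

Lemma nat_ceil x : 0 <= x -> exists n : nat, x <= INR n <= x + 1.
Proof.
intros Hx. destruct (nfloor_ex x Hx) as (n & Hn). exists (S n). rewrite S_INR. lra.
Qed.

Section AbelMeansLimit.

Variables (L : R -> R) (gamma W : R) (v : nat -> R).
Hypothesis hgamma : 0 < gamma < 2.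
Hypothesis Lpos : forall x, 0 < x -> 0 < L x.
Hypothesis Lunif : locally_uniform_sv L.
Hypothesis Lpot : potter_bounds L.
Hypothesis hW : 0 < W.
Hypothesis v0 : v 0%nat = 0.
Hypothesis vpos : forall n, 0 <= v n.
Hypothesis hv : forall eps, 0 < eps -> eventually_nat (fun n =>
  Rabs (v n - W * (L (INR n) * Rpower (INR n) gamma)) <= eps * (L (INR n) * Rpower (INR n) gamma)).

Let T t := Rpower t (- gamma) * L (/ t).
Let psi := gamma_density gamma.

(** The sum is cut at an index [K] near [B / t]. Below it [v n] is replaced by its profile, which
    leaves a Riemann sum of mesh [t] for the Gamma integral; above it [tail_sum] applies. Tail,
    profile, Riemann sum and truncation of the integral cost a quarter of [eps] each. *)
Lemma abel_means_limit eps : 0 < eps ->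
  near0 (fun t => eventually_nat (fun M =>
    Rabs (t * sm (fun n => exp (- t) ^ n * v n) M - W * Gamma (1 + gamma) * T t) <= eps * T t)).
Proof.
intros He.
destruct (profile_high_bound L gamma W v hgamma Lpos Lpot hW hv) as (C & HC & Hhigh).
destruct (gamma_limit_Gamma gamma hgamma (eps / (4 * W))) as (B0 & HB0 & HB).
{ apply Rdiv_lt_0_compat; lra. }
(* 192 C exp(-B/2) <= 384 C / B *)
set (B := Rmax B0 (384 * C * 4 / eps)).
assert (HB1 : B0 <= B) by apply Rmax_l.
assert (HB2 : 384 * C * 4 / eps <= B) by apply Rmax_r.
assert (HBtail : C * (192 * exp (- (B / 2))) <= eps / 4).
{ rewrite exp_Ropp. assert (1 + B / 2 <= exp (B / 2)) by apply exp_ineq1_le.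
  assert (/ exp (B / 2) <= / (B / 2)) by (apply Rinv_le_contravar; lra).
  apply Rle_trans with (C * (192 * / (B / 2))); [apply Rmult_le_compat_l; lra|].
  apply Rmult_le_reg_r with (B * 4 / eps); [apply Rdiv_lt_0_compat; lra|].
  replace (eps / 4 * (B * 4 / eps)) with B by (field; lra).
  replace (C * (192 * / (B / 2)) * (B * 4 / eps)) with (384 * C * 4 / eps) by (field; lra).
  exact HB2. }
set (e1 := eps / (4 * (B + 1))).
assert (He1 : 0 < e1) by pos.
assert (He2 : 0 < eps / (4 * W * (B + 1))) by pos.
assert (Hcont : forall x, 0 <= x <= B + 1 -> continuity_pt psi x).
{ intros x _. apply continuity_pt_filterlim, gamma_density_continuous, hgamma. }
destruct (Heine_cor2 Hcont (mkposreal _ He2)) as (dl & Hdl).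
simpl in Hdl.
refine (near0_imp _ _ _ (near0_and _ _ Hhigh (near0_and _ _
  (profile_estimate L gamma W v hgamma Lpos Lunif Lpot hW v0 vpos hv e1 (B + 1) He1 ltac:(lra))
  (near0_and _ _ (near0_lt 1 Rlt_0_1) (near0_lt dl (cond_pos dl)))))).
intros t Ht (Hhi & Hprof & Ht1 & Htd).
assert (Tp := scale_pos L gamma Lpos t Ht).
change (0 < T t) in Tp.
change (forall n, 1 <= t * INR n -> v n <= C * T t * (t * INR n) ^ 3) in Hhi.
change (forall n, t * INR n <= B + 1 ->
  Rabs (v n - W * T t * pw gamma (t * INR n)) <= e1 * T t) in Hprof.
set (tau := T t) in *. clearbody tau.
assert (HWT : 0 < W * tau) by pos.
destruct (nat_ceil (B / t)) as (K & HK); [apply Rdiv_le_0_compat; lra|].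
assert (HtK : B <= t * INR K <= B + 1).
{ assert (E : t * (B / t) = B) by (field; lra).
  destruct HK as [HKa HKb].
  apply Rmult_le_compat_l with (r := t) in HKa; [|lra].
  apply Rmult_le_compat_l with (r := t) in HKb; [|lra]. nra. }
assert (HnK : forall n, (n <= K)%nat -> 0 <= t * INR n <= B + 1).
{ intros n Hn. assert (INR n <= INR K) by (apply le_INR; exact Hn).
  assert (0 <= INR n) by pos. nra. }
exists K. intros M HM.
replace M with (K + (M - K))%nat by lia. rewrite sm_split, Rmult_plus_distr_l.
set (S1 := sm (fun n => exp (- t) ^ n * v n) K).
assert (Htail : 0 <= t * sm (fun i => exp (- t) ^ (K + i) * v (K + i)%nat) (M - K) <= eps / 4 * tau).
{ split.
  - apply Rmult_le_pos; [lra|]. apply sm_ge0. intros i _. apply Rmult_le_pos; [|apply vpos].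
    apply pow_le. left. apply exp_pos.
  - assert (Hts := tail_sum t (fun n => exp (- (t * INR n)) * (v n / (C * tau))) K (M - K) (conj Ht (Rlt_le _ _ Ht1))).
    assert (HCT : 0 < C * tau) by pos.
    replace (t * sm (fun i => exp (- t) ^ (K + i) * v (K + i)%nat) (M - K)) with
      (C * tau * (t * sm (fun i => exp (- (t * INR (K + i))) * (v (K + i)%nat / (C * tau))) (M - K))).
    + apply Rle_trans with (C * tau * (192 * exp (- (t * INR K / 2)))).
      * apply Rmult_le_compat_l; [lra|]. apply Hts. intros n Hn.
        assert (HtKn : 1 <= t * INR n).
        { apply Rle_trans with (t * INR K); [lra|].
          apply Rmult_le_compat_l; [lra|apply le_INR; exact Hn]. }
        assert (He' := exp_pos (- (t * INR n))). split.
        -- apply Rmult_le_pos; [lra|]. apply Rdiv_le_0_compat; [apply vpos|lra].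
        -- apply Rmult_le_compat_l; [lra|]. apply Rmult_le_reg_r with (C * tau); [lra|].
           unfold Rdiv. rewrite Rmult_assoc, Rinv_l, Rmult_1_r by lra.
           rewrite (Rmult_comm _ (C * tau)). apply Hhi, HtKn.
      * assert (exp (- (t * INR K / 2)) <= exp (- (B / 2))) by (apply exp_le_mono; lra).
        apply Rle_trans with (tau * (C * (192 * exp (- (B / 2))))).
        -- rewrite (Rmult_comm C (tau)), Rmult_assoc. apply Rmult_le_compat_l; [lra|].
           apply Rmult_le_compat_l; lra.
        -- rewrite (Rmult_comm (eps / 4)). apply Rmult_le_compat_l; lra.
    + rewrite <- !sm_scal. apply sm_ext. intros i _. rewrite pow_exp_mult. field.
      repeat split; lra. }
assert (H1 : Rabs (t * S1 - t * sm (fun n => W * tau * psi (t * INR n)) K) <= eps / 4 * tau).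
{ unfold S1. rewrite <- Rmult_minus_distr_l, <- sm_minus, Rabs_mult, (Rabs_pos_eq t) by lra.
  apply Rle_trans with (t * sm (fun _ => e1 * tau) K).
  - apply Rmult_le_compat_l; [lra|]. apply Rle_trans with (1 := sm_abs _ _). apply sm_le.
    intros n Hn. rewrite pow_exp_mult. unfold psi, gamma_density.
    replace (exp (- (t * INR n)) * v n - W * tau * (pw gamma (t * INR n) * exp (- (t * INR n)))) with
      (exp (- (t * INR n)) * (v n - W * tau * pw gamma (t * INR n))) by ring.
    rewrite Rabs_mult, (Rabs_pos_eq (exp _)) by (left; apply exp_pos).
    assert (Hr := HnK n ltac:(lia)).
    assert (exp (- (t * INR n)) <= exp 0) by (apply exp_le_mono; lra). rewrite exp_0 in H.
    assert (Hp := Hprof n ltac:(lra)). rewrite <- (Rmult_1_l (e1 * tau)).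
    apply Rmult_le_compat; [left; apply exp_pos|apply Rabs_pos|exact H|exact Hp].
  - rewrite sm_const. apply Rle_trans with ((B + 1) * (e1 * tau)).
    + rewrite <- Rmult_assoc. apply Rmult_le_compat_r; [|lra].
      left. apply Rmult_lt_0_compat; lra.
    + right. unfold e1. field. lra. }
assert (H2 : Rabs (t * sm (fun n => W * tau * psi (t * INR n)) K - W * tau * RInt psi 0 (t * INR K))
  <= eps / 4 * tau).
{ assert (Hrie := riemann_sum_error psi (fun i => t * INR i) (fun i => psi (t * INR i)) K
    (eps / (4 * W * (B + 1)))).
  assert (E : sm (fun i => psi (t * INR i) * (t * INR (S i) - t * INR i)) K =
    t * sm (fun n => psi (t * INR n)) K).
  { rewrite <- sm_scal. apply sm_ext. intros i _. rewrite S_INR. ring. }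
  cbv beta in Hrie. rewrite E in Hrie. simpl (INR 0) in Hrie. rewrite Rmult_0_r in Hrie.
  rewrite sm_scal.
  replace (t * (W * tau * sm (fun n => psi (t * INR n)) K) - W * tau * RInt psi 0 (t * INR K)) with
    (W * tau * (t * sm (fun n => psi (t * INR n)) K - RInt psi 0 (t * INR K))) by ring.
  rewrite Rabs_mult, (Rabs_pos_eq (W * tau)) by lra.
  apply Rle_trans with (W * tau * (eps / (4 * W * (B + 1)) * (t * INR K - 0))).
  - apply Rmult_le_compat_l; [lra|]. apply Hrie.
    + intros i _. apply Rmult_le_compat_l; [lra|apply le_INR; lia].
    + intros y _. apply gamma_density_continuous, hgamma.
    + intros i y Hi Hy. left. assert (R1 := HnK i ltac:(lia)). assert (R2 := HnK (S i) ltac:(lia)).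
      rewrite S_INR in Hy. rewrite S_INR in R2. apply Hdl; try lra.
      rewrite Rabs_pos_eq by lra. nra.
  - rewrite Rminus_0_r. apply Rle_trans with (W * tau * (eps / (4 * W * (B + 1)) * (B + 1))).
    + apply Rmult_le_compat_l; [lra|]. apply Rmult_le_compat_l; lra.
    + right. field. lra. }
assert (H3 : Rabs (W * tau * RInt psi 0 (t * INR K) - W * Gamma (1 + gamma) * tau) <= eps / 4 * tau).
{ replace (W * tau * RInt psi 0 (t * INR K) - W * Gamma (1 + gamma) * tau) with
    (W * tau * (RInt psi 0 (t * INR K) - Gamma (1 + gamma))) by ring.
  rewrite Rabs_mult, (Rabs_pos_eq (W * tau)) by lra.
  apply Rle_trans with (W * tau * (eps / (4 * W))).
  - apply Rmult_le_compat_l; [lra|]. apply HB. lra.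
  - right. field. lra. }
apply Rabs_le_between in H1. apply Rabs_le_between in H2. apply Rabs_le_between in H3.
apply Rabs_le. lra.
Qed.

End AbelMeansLimit.

(* t = 2 arsinh (s/2), so that rho = exp (-t) satisfies (1 - rho)^2 / rho = s^2 *)
Lemma resolvent_parameter s : 0 < s < 1 -> exists t q,
  0 < t /\ t <= s /\ s <= t * q /\ 1 < q /\ q <= 1 + s /\ 2 <= q + / q <= 2 + s /\
  (1 - exp (- t)) ^ 2 / exp (- t) = s ^ 2 /\
  (1 - exp (- t)) / (1 + exp (- t)) = s / (q + / q).
Proof.
intros Hs. set (r := sqrt (1 + s ^ 2 / 4)).
assert (Hr2 : r * r = 1 + s ^ 2 / 4) by (apply sqrt_sqrt; nra).
assert (Hr0 : 0 <= r) by apply sqrt_pos.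
assert (Hr1 : 1 <= r) by nra. assert (Hr3 : r <= 1 + s / 2) by nra.
(* [q] is exp(t / 2), so that s = q - 1 / q = 2 sinh(t / 2). *)
set (q := s / 2 + r).
assert (Hq : 1 < q) by (unfold q; lra).
assert (Hiq : / q = r - s / 2).
{ apply Rmult_eq_reg_l with q; [|lra]. rewrite Rinv_r by lra. unfold q. nra. }
exists (2 * ln q), q.
assert (Hln : 0 < ln q) by (rewrite <- ln_1; apply ln_increasing; lra).
assert (Hexp : exp (- (2 * ln q)) = / (q * q)).
{ rewrite exp_Ropp. f_equal. replace (2 * ln q) with (ln q + ln q) by ring.
  rewrite exp_plus, exp_ln by lra. reflexivity. }
split; [lra|]. split; [|split].
(* 2 u <= exp u - exp(-u) at u = ln q is [t <= s]; the next bullet uses exp(-t) >= 1 - t. *)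
- assert (H := le_of_derive_le (fun u => 2 * u) (fun u => exp u - exp (- u)) (fun _ => 2)
    (fun u => exp u + exp (- u)) (ln q) (Rlt_le _ _ Hln)).
  cbv beta in H. rewrite (exp_Ropp (ln q)), (exp_ln q), Hiq in H by lra.
  replace s with (q - (r - s / 2)) by (unfold q; lra). apply H.
  + intros t _. auto_derive; [exact I|ring].
  + intros t _. auto_derive; [exact I|ring].
  + intros t _. assert (Ht := exp_pos t). rewrite exp_Ropp.
    apply Rmult_le_reg_r with (exp t); [exact Ht|].
    rewrite Rmult_plus_distr_r, Rinv_l by lra. generalize (Rle_0_sqr (exp t - 1)). unfold Rsqr. lra.
  + rewrite Ropp_0. lra.
- assert (H := exp_ineq1_le (- (2 * ln q))). rewrite Hexp in H.
  assert (E : s = q * (1 - / (q * q))) by (rewrite Rinv_mult, Hiq; unfold q; nra).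
  nra.
- split; [exact Hq|]. split; [unfold q; lra|]. split; [rewrite Hiq; unfold q; lra|].
  assert (Es : s = q - / q) by (rewrite Hiq; unfold q; lra).
  rewrite Hexp. split.
  + rewrite Es. field. lra.
  + rewrite Es at 1. field. split; nra.
Qed.

Section Resolvent.

Variables (L : R -> R) (gamma W : R) (G : R -> R) (v : nat -> R).
Hypothesis hgamma : 0 < gamma < 2.
Hypothesis Lpos : forall x, 0 < x -> 0 < L x.
Hypothesis Lunif : locally_uniform_sv L.
Hypothesis Lpot : potter_bounds L.
Hypothesis hW : 0 < W.
Hypothesis hG : nondecreasing_pos G.
Hypothesis hlim : forall n, is_lim_seq (fun N => rs G N (fejer n)) (v n).
Hypothesis hv : forall eps, 0 < eps -> eventually_nat (fun n =>
  Rabs (v n - W * (L (INR n) * Rpower (INR n) gamma)) <= eps * (L (INR n) * Rpower (INR n) gamma)).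

(** The factor 1/2 is the limit of (1 - rho) / (t (1 + rho)), from the prefactor in
    [resolvent_abel_sum]; multiplication by [s ^ 2] turns the power -gamma into 2 - gamma. *)
Lemma resolvent_limit eps : 0 < eps ->
  near0 (fun s => eventually_nat (fun N =>
    Rabs (rs G N (fun x => s ^ 2 / (s ^ 2 + chord2 x)) -
      W * Gamma (1 + gamma) / 2 * (L (/ s) * Rpower s (2 - gamma))) <=
    eps * (L (/ s) * Rpower s (2 - gamma)))).
Proof.
intros He.
assert (v0 : v 0%nat = 0).
{ assert (H : is_lim_seq (fun N => rs G N (fejer 0)) 0).
  { apply (is_lim_seq_ext (fun _ => 0)); [|apply is_lim_seq_const].
    intros N. rewrite (rs_ext G N _ (fun x => 0 * 0)) by (intros; rewrite fejer_0; ring).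
    rewrite rs_scal. ring. }
  assert (E := is_lim_seq_unique _ _ H). rewrite (is_lim_seq_unique _ _ (hlim 0%nat)) in E.
  injection E. auto. }
assert (vpos : forall n, 0 <= v n).
{ intros n. assert (H := is_lim_seq_le (fun _ => 0) (fun N => rs G N (fejer n)) 0 (v n)). apply H.
  - intros N. replace 0 with (rs G N (fun _ => 0)) by (rewrite rs_const; ring).
    apply rs_le; [exact hG|]. intros x Hx. apply fejer_ge0, Hx.
  - apply is_lim_seq_const.
  - apply hlim. }
assert (HGa := Gamma_pos gamma hgamma). set (Ga := Gamma (1 + gamma)) in *.
set (e := Rmin (1 / 8) (eps / (32 * (W * Ga + 1)))).
assert (HWG : 0 < W * Ga) by pos.
assert (Hepos : 0 < e) by pos.
assert (He1 : e <= 1 / 8) by apply Rmin_l.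
assert (He2 : 8 * e * (W * Ga) <= eps / 4).
{ assert (e <= eps / (32 * (W * Ga + 1))) by apply Rmin_r.
  apply Rle_trans with (8 * (eps / (32 * (W * Ga + 1))) * (W * Ga + 1)).
  - apply Rmult_le_compat; lra.
  - right. field. lra. }
assert (Hab : near0 (fun t => eventually_nat (fun M =>
  Rabs (t * sm (fun n => exp (- t) ^ n * v n) M - W * Ga * (Rpower t (- gamma) * L (/ t))) <=
    eps / 4 * (Rpower t (- gamma) * L (/ t))))).
{ apply (abel_means_limit L gamma W v hgamma Lpos Lunif Lpot hW v0 vpos hv). lra. }
destruct Hab as (d & Hd & Hab).
refine (near0_imp _ _ _ (near0_and _ _ (near0_lt d Hd)
  (near0_and _ _ (near0_lt e Hepos) (sv_scale_near0 L Lpos Lunif e 2 Hepos ltac:(lra))))).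
intros s Hs (Hsd & Hse & Hsv).
destruct (resolvent_parameter s ltac:(lra)) as (t & q & Ht & Hts & Hstq & Hq1 & Hq2 & Hqq & Hsig & Hc).
assert (Hab' := Hab t ltac:(lra)). clear Hab.
assert (Hrho : 0 < exp (- t) < 1).
{ split; [apply exp_pos|]. rewrite <- exp_0. apply exp_increasing. lra. }
assert (HLts : Rabs (L (/ t) - L (/ s)) <= e * L (/ s)) by (apply Hsv; nra).
assert (Ls := Lpos (/ s) ltac:(apply Rinv_0_lt_compat; lra)).
assert (Ps := Rpower_pos s (2 - gamma)).
set (U := L (/ s) * Rpower s (2 - gamma)) in *.
assert (HU : 0 < U) by pos.
(* The tolerance carries a division by [s ^ 2] because the resolvent is multiplied by it below. One
   [M] is fixed here and [N] stays free. *)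
destruct (ev_and _ _ Hab' (resolvent_abel_sum G v (exp (- t)) (eps / 4 * U / s ^ 2) hG hlim Hrho
  ltac:(apply Rdiv_lt_0_compat; [apply Rmult_lt_0_compat; lra|nra]))) as (M & HM).
destruct (HM M (le_n M)) as [HM1 HM2]. clear HM Hab'.
refine (ev_imp _ _ _ HM2). clear HM2. intros N HN.
rewrite Hsig, Hc in HN. set (c := s / (q + / q)) in *.
set (S_ := sm (fun n => exp (- t) ^ n * v n) M) in *.
set (T := Rpower t (- gamma) * L (/ t)) in *.
replace (rs G N (fun x => s ^ 2 / (s ^ 2 + chord2 x))) with
  (s ^ 2 * rs G N (fun x => / (s ^ 2 + chord2 x))) by (rewrite <- rs_scal; reflexivity).
set (X := rs G N (fun x => / (s ^ 2 + chord2 x))) in *.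
(* [mu] gathers everything that separates the parameter [t] of the Abel mean from the scale [s]; it
   tends to 1/2. *)
set (mu := Rpower (s / t) (1 + gamma) / (q + / q) * (L (/ t) / L (/ s))).
assert (Hst : 1 <= s / t <= q).
{ split; apply Rmult_le_reg_r with t; try exact Ht; unfold Rdiv; rewrite Rmult_assoc, Rinv_l; lra. }
assert (Emu : s ^ 2 * c / t * T = mu * U).
{ unfold mu, U, T, c. replace (s / t) with (s * / t) by reflexivity.
  assert (Hit : 0 < / t) by pos.
  unfold Rminus. rewrite Rpower_mul_base, !Rpower_plus, !Rpower_1, (Rpower_Ropp t), (Rpower_Ropp s) by lra.
  replace (Rpower (/ t) gamma) with (/ Rpower t gamma)
    by (rewrite <- Rpower_Ropp; unfold Rpower; rewrite ln_Rinv by lra; f_equal; ring).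
  replace (Rpower s 2) with (s ^ 2) by (rewrite <- Rpower_pow by lra; reflexivity).
  field. repeat split; try lra; (nra || (apply Rgt_not_eq, Rpower_pos)). }
assert (Hmu : Rabs (mu - / 2) <= 8 * e).
{ set (l := L (/ t) / L (/ s)).
  assert (Hl : 1 - e <= l <= 1 + e).
  { apply Rabs_le_between in HLts. unfold l. split.
    - apply Rmult_le_reg_r with (L (/ s)); [exact Ls|]. unfold Rdiv.
      rewrite Rmult_assoc, Rinv_l; lra.
    - apply Rmult_le_reg_r with (L (/ s)); [exact Ls|]. unfold Rdiv.
      rewrite Rmult_assoc, Rinv_l; lra. }
  set (p := Rpower (s / t) (1 + gamma)).
  assert (Hp1 : 1 <= p) by (apply Rpower_ge_1; lra).
  assert (Hp2 : p <= (1 + e) ^ 3).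
  { apply Rle_trans with (Rpower (1 + e) (1 + gamma)).
    - apply Rpower_le_mono; lra.
    - rewrite <- Rpower_pow by lra. apply Rle_Rpower; simpl; lra. }
  assert (Hp3 : p <= 1 + 5 * e) by nra.
  assert (Hi1 : / (q + / q) <= / 2) by (apply Rinv_le_contravar; lra).
  assert (Hi2 : / (2 + e) <= / (q + / q)) by (apply Rinv_le_contravar; lra).
  assert (Hi3 : / 2 - e <= / (2 + e)).
  { apply Rmult_le_reg_r with (2 + e); [lra|]. rewrite Rinv_l; nra. }
  set (i := / (q + / q)) in *. change (Rabs (p * i * l - / 2) <= 8 * e).
  assert (Hi0 : 0 < i) by (apply Rinv_0_lt_compat; lra).
  assert (A1 : p * l <= (1 + 5 * e) * (1 + e)) by (apply Rmult_le_compat; lra).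
  assert (A2 : 1 * (1 - e) <= p * l) by (apply Rmult_le_compat; lra).
  assert (A3 : p * l * i <= (1 + 5 * e) * (1 + e) * / 2) by (apply Rmult_le_compat; lra).
  assert (A4 : 1 * (1 - e) * (/ 2 - e) <= p * l * i) by (apply Rmult_le_compat; lra).
  assert (He3 : 0 <= e * e <= e * (1 / 8)) by (split; [|apply Rmult_le_compat_l]; nra).
  replace (p * i * l) with (p * l * i) by ring. clearbody p l i.
  apply Rabs_le. lra. }
assert (Hc0 : 0 < c) by pos.
assert (B1 : Rabs (s ^ 2 * X - s ^ 2 * (c * S_)) <= eps / 4 * U).
{ rewrite <- Rmult_minus_distr_l, Rabs_mult, (Rabs_pos_eq (s ^ 2)) by nra.
  apply Rle_trans with (s ^ 2 * (eps / 4 * U / s ^ 2)).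
  - apply Rmult_le_compat_l; [nra|exact HN].
  - right. field. lra. }
assert (Hk : 0 < s ^ 2 * c / t) by pos.
assert (B2 : Rabs (s ^ 2 * (c * S_) - W * Ga * (mu * U)) <= eps / 4 * (mu * U)).
{ rewrite <- Emu. replace (s ^ 2 * (c * S_) - W * Ga * (s ^ 2 * c / t * T)) with
    (s ^ 2 * c / t * (t * S_ - W * Ga * T)) by (field; lra).
  rewrite Rabs_mult, (Rabs_pos_eq (s ^ 2 * c / t)) by lra.
  replace (eps / 4 * (s ^ 2 * c / t * T)) with (s ^ 2 * c / t * (eps / 4 * T)) by ring.
  apply Rmult_le_compat_l; [lra|exact HM1]. }
assert (B3 : Rabs (W * Ga * (mu * U) - W * Ga / 2 * U) <= eps / 4 * U).
{ replace (W * Ga * (mu * U) - W * Ga / 2 * U) with (W * Ga * U * (mu - / 2)) by field.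
  rewrite Rabs_mult, (Rabs_pos_eq (W * Ga * U)) by (apply Rmult_le_pos; lra).
  apply Rle_trans with (W * Ga * U * (8 * e)).
  - apply Rmult_le_compat_l; [apply Rmult_le_pos; lra|exact Hmu].
  - replace (W * Ga * U * (8 * e)) with (8 * e * (W * Ga) * U) by ring.
    apply Rmult_le_compat_r; lra. }
assert (Hmu2 : mu <= 2) by (apply Rabs_le_between in Hmu; lra).
assert (B4 : eps / 4 * (mu * U) <= eps / 4 * (2 * U)).
{ apply Rmult_le_compat_l; [lra|]. apply Rmult_le_compat_r; lra. }
apply Rabs_le_between in B1. apply Rabs_le_between in B2. apply Rabs_le_between in B3.
apply Rabs_le. lra.
Qed.

End Resolvent.

(** * The Tauberian theorem *)

(** The increments telescope up to the last grid point [g] not beyond [c]. *)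
Lemma rs_cutoff_one H N c : 0 <= c <= PI ->
  exists g, 0 <= g <= c /\ c - PI / INR (S N) <= g /\ rs H N (cutoff c (fun _ => 1)) = H g.
Proof.
intros Hc. assert (Hmesh := mesh_pos N).
set (S_ := fun m => cutoff c (fun _ => 1) 0 * H 0 +
  sm (fun j => cutoff c (fun _ => 1) (grid N (S j)) * (H (grid N (S j)) - H (grid N j))) m).
assert (Hm : forall m, (m <= S N)%nat -> exists g, 0 <= g <= c /\ S_ m = H g /\
  (g = grid N m \/ c - PI / INR (S N) <= g /\ c < grid N m)).
{ induction m as [|m IH]; intros Hm.
  - exists 0. split; [lra|]. split; [|left; symmetry; apply grid_0].
    unfold S_, cutoff. simpl sm. destruct (Rle_dec 0 c); [ring|lra].
  - destruct IH as (g & Hg & HS & Hcase); [lia|]. assert (Hgr := grid_S N m).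
    assert (ES : S_ (S m) = S_ m + cutoff c (fun _ => 1) (grid N (S m)) *
      (H (grid N (S m)) - H (grid N m))) by (unfold S_; simpl sm; ring).
    unfold cutoff in ES. destruct (Rle_dec (grid N (S m)) c) as [Hin|Hout].
    + destruct Hcase as [-> | Hcase]; [|lra]. exists (grid N (S m)).
      split; [split; [apply grid_range; lia|exact Hin]|]. split; [|left; reflexivity].
      rewrite ES, HS. ring.
    + exists g. split; [exact Hg|]. split; [rewrite ES, HS; ring|]. right.
      destruct Hcase as [-> | Hcase]; lra. }
destruct (Hm (S N) (le_n _)) as (g & Hg & HS & Hcase). exists g. split; [exact Hg|].
split; [|exact HS]. rewrite grid_end in Hcase. lra.
Qed.

Lemma bernoulli_lower w n : 0 <= w <= 1 -> 1 - INR n * w <= (1 - w) ^ n.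
Proof.
intros Hw. induction n as [|n IH]; [simpl; lra|]. rewrite S_INR. simpl.
assert (P := pos_INR n). nra.
Qed.

(* For [z] away from 1/2 this polynomial tends to the indicator function of [z > 1/2]. *)
Definition step_poly (n : nat) (z : R) : R := 1 - (1 - z ^ n) ^ (2 ^ n).

Lemma INR_pow2 n : INR (2 ^ n) = 2 ^ n.
Proof. rewrite pow_INR. reflexivity. Qed.

Lemma step_poly_bounds n z : 0 <= z <= 1 -> 0 <= step_poly n z <= 1.
Proof.
intros Hz. unfold step_poly.
assert (0 <= z ^ n <= 1 ^ n) by (split; [apply pow_le|apply pow_incr]; lra).
rewrite pow1 in H.
assert (0 <= (1 - z ^ n) ^ (2 ^ n) <= 1 ^ (2 ^ n)) by (split; [apply pow_le|apply pow_incr]; lra).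
rewrite pow1 in H0. lra.
Qed.

(** (1 - w)^m >= 1 - m w with w = z^n and m = 2^n. *)
Lemma step_poly_upper n z : 0 <= z <= 1 -> step_poly n z <= (2 * z) ^ n.
Proof.
intros Hz. unfold step_poly.
assert (0 <= z ^ n <= 1 ^ n) by (split; [apply pow_le|apply pow_incr]; lra).
rewrite pow1 in H.
assert (B := bernoulli_lower (z ^ n) (2 ^ n) H). rewrite INR_pow2 in B.
rewrite Rpow_mult_distr. lra.
Qed.

(** (1 - w)^m (1 + w)^m <= 1 and (1 + w)^m >= 1 + m w, with w = z^n and m = 2^n. *)
Lemma step_poly_lower n z : 0 < z <= 1 -> 1 - / (2 * z) ^ n <= step_poly n z.
Proof.
intros Hz. unfold step_poly.
assert (Hw : 0 < z ^ n <= 1 ^ n) by (split; [apply pow_lt|apply pow_incr]; lra).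
rewrite pow1 in Hw. set (w := z ^ n) in *.
assert (B := poly (2 ^ n) w (proj1 Hw)). rewrite INR_pow2 in B.
rewrite Rpow_mult_distr. fold w.
assert (P2 : 0 < 2 ^ n) by pos.
assert (Hpos : 0 < 2 ^ n * w) by pos.
assert (H1 : (1 - w) ^ (2 ^ n) * (1 + w) ^ (2 ^ n) <= 1).
{ rewrite <- Rpow_mult_distr. apply Rle_trans with (1 ^ (2 ^ n)); [|rewrite pow1; lra].
  apply pow_incr. clearbody w. split; nra. }
assert ((1 - w) ^ (2 ^ n) <= / (2 ^ n * w)); [|lra].
apply Rmult_le_reg_r with (2 ^ n * w); [exact Hpos|]. rewrite Rinv_l by lra. nra.
Qed.

Section Tauberian.

Variables (L : R -> R) (beta kappa : R) (G : R -> R).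
Hypothesis hbeta : 0 < beta < 2.
Hypothesis Lpos : forall x, 0 < x -> 0 < L x.
Hypothesis Lunif : locally_uniform_sv L.
Hypothesis hG : nondecreasing_pos G.
Hypothesis hkappa : 0 < kappa.

Let U s := L (/ s) * Rpower s beta.
Let Delta N s f := rs G N f - kappa * L (/ s) * rs (pw beta) N f.

Definition admissible (k : R -> R) : Prop := forall eps, 0 < eps ->
  near0 (fun s => eventually_nat (fun N =>
    Rabs (Delta N s (fun x => k (chord2 x / s ^ 2))) <= eps * U s)).

Hypothesis hstieltjes : admissible (fun d => / (1 + d)).
Variable C0 : R.
Hypothesis hC0 : 0 < C0.
Hypothesis hmodel : near0 (fun s => eventually_nat (fun N =>
  rs (pw beta) N (fun x => / (1 + chord2 x / s ^ 2)) <= C0 * Rpower s beta)).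

Lemma tauberian_scale_pos s : 0 < s -> 0 < U s.
Proof.
intros Hs. apply Rmult_lt_0_compat; [apply Lpos, Rinv_0_lt_compat, Hs|apply Rpower_pos].
Qed.

Lemma ratio_ge0 x s : 0 < s -> 0 <= chord2 x / s ^ 2.
Proof. intros Hs. apply Rdiv_le_0_compat; [apply chord2_ge0|apply pow_lt, Hs]. Qed.

Lemma admissible_ext k1 k2 : (forall d, 0 <= d -> k1 d = k2 d) -> admissible k1 -> admissible k2.
Proof.
intros H H1 eps He. refine (near0_imp _ _ _ (H1 eps He)). intros s Hs.
apply ev_imp. intros N. unfold Delta.
rewrite (rs_ext G N (fun x => k2 (chord2 x / s ^ 2)) (fun x => k1 (chord2 x / s ^ 2)))
  by (intros; symmetry; apply H, ratio_ge0, Hs).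
rewrite (rs_ext (pw beta) N (fun x => k2 (chord2 x / s ^ 2)) (fun x => k1 (chord2 x / s ^ 2)))
  by (intros; symmetry; apply H, ratio_ge0, Hs).
auto.
Qed.

Lemma admissible_lin a b k1 k2 : admissible k1 -> admissible k2 ->
  admissible (fun d => a * k1 d + b * k2 d).
Proof.
intros H1 H2 eps He.
set (m := Rabs a + Rabs b + 1).
assert (Ha := Rabs_pos a). assert (Hb := Rabs_pos b).
assert (Hm : 0 < m) by (unfold m; lra).
assert (Hem : 0 < eps / m) by pos.
refine (near0_imp _ _ _ (near0_and _ _ (H1 _ Hem) (H2 _ Hem))).
intros s Hs [A B]. refine (ev_imp _ _ _ (ev_and _ _ A B)). intros N [A1 B1].
assert (HU := tauberian_scale_pos s Hs).
replace (Delta N s (fun x => a * k1 (chord2 x / s ^ 2) + b * k2 (chord2 x / s ^ 2))) with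
  (a * Delta N s (fun x => k1 (chord2 x / s ^ 2)) + b * Delta N s (fun x => k2 (chord2 x / s ^ 2)))
  by (unfold Delta; rewrite !rs_lin; ring).
apply Rle_trans with (1 := Rabs_triang _ _). rewrite !Rabs_mult.
apply Rle_trans with (Rabs a * (eps / m * U s) + Rabs b * (eps / m * U s)).
- apply Rplus_le_compat; apply Rmult_le_compat_l; assumption.
- rewrite <- Rmult_plus_distr_r. apply Rle_trans with (m * (eps / m * U s)).
  + apply Rmult_le_compat_r; [|unfold m; lra].
    apply Rmult_le_pos; lra.
  + right. field. lra.
Qed.

(** Both measures give the Stieltjes kernel an integral of order [U s]; it becomes the weight for
    limits of kernels. *)
Lemma stieltjes_bounds : near0 (fun s => eventually_nat (fun N =>
  rs G N (fun x => / (1 + chord2 x / s ^ 2)) <= (kappa * C0 + 1) * U s /\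
  kappa * L (/ s) * rs (pw beta) N (fun x => / (1 + chord2 x / s ^ 2)) <= kappa * C0 * U s)).
Proof.
refine (near0_imp _ _ _ (near0_and _ _ (hstieltjes 1 Rlt_0_1) hmodel)).
intros s Hs [A B]. refine (ev_imp _ _ _ (ev_and _ _ A B)). intros N [A1 B1].
assert (Ls := Lpos (/ s) ltac:(apply Rinv_0_lt_compat; lra)).
assert (B2 : kappa * L (/ s) * rs (pw beta) N (fun x => / (1 + chord2 x / s ^ 2)) <=
  kappa * C0 * U s).
{ apply Rle_trans with (kappa * L (/ s) * (C0 * Rpower s beta)).
  - apply Rmult_le_compat_l; [left; apply Rmult_lt_0_compat; lra|exact B1].
  - right. unfold U. ring. }
split; [|exact B2]. unfold Delta in A1. apply Rabs_le_between in A1. lra.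
Qed.

(** The weight [/ (1 + d)] has integrals of order [U s]. A merely uniform approximation would cost
    [eta * G PI], which does not decrease with [s]. *)
Lemma admissible_closure k : (forall eta, 0 < eta -> exists k', admissible k' /\
    forall d, 0 <= d -> Rabs (k d - k' d) <= eta * / (1 + d)) -> admissible k.
Proof.
intros H eps He.
set (m := 2 * kappa * C0 + 1). assert (Hm : 0 < m) by pos.
destruct (H (eps / (2 * m)) ltac:(apply Rdiv_lt_0_compat; lra)) as (k' & Hk' & Hkk).
refine (near0_imp _ _ _ (near0_and _ _ (Hk' (eps / 2) ltac:(lra)) stieltjes_bounds)).
intros s Hs [A B]. refine (ev_imp _ _ _ (ev_and _ _ A B)). intros N (A1 & B1 & B2).
assert (Ls := Lpos (/ s) ltac:(apply Rinv_0_lt_compat; lra)).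
set (z := fun x => / (1 + chord2 x / s ^ 2)) in *.
set (g := fun x => k (chord2 x / s ^ 2)) in *. set (g' := fun x => k' (chord2 x / s ^ 2)) in *.
assert (Hz : forall H', nondecreasing_pos H' ->
  Rabs (rs H' N g - rs H' N g') <= eps / (2 * m) * rs H' N z).
{ intros H' HH. rewrite <- rs_minus, <- rs_scal. apply rs_abs; [exact HH|].
  intros x _. apply Hkk, ratio_ge0, Hs. }
assert (Z1 := Hz G hG). assert (Z2 := Hz (pw beta) (pw_nondecreasing beta ltac:(lra))).
assert (Hkl : 0 < kappa * L (/ s)) by pos.
apply Rmult_le_compat_l with (r := kappa * L (/ s)) in Z2; [|lra].
rewrite <- (Rabs_pos_eq (kappa * L (/ s))) in Z2 at 1 by lra. rewrite <- Rabs_mult in Z2.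
assert (Hem : 0 < eps / (2 * m)) by pos.
assert (Z3 : eps / (2 * m) * rs G N z + kappa * L (/ s) * (eps / (2 * m) * rs (pw beta) N z) <=
  eps / 2 * U s).
{ replace (kappa * L (/ s) * (eps / (2 * m) * rs (pw beta) N z)) with
    (eps / (2 * m) * (kappa * L (/ s) * rs (pw beta) N z)) by ring.
  rewrite <- Rmult_plus_distr_l.
  apply Rle_trans with (eps / (2 * m) * (m * U s)).
  - apply Rmult_le_compat_l; [lra|]. unfold m. lra.
  - right. field. lra. }
unfold Delta in *. apply Rabs_le_between in A1. apply Rabs_le_between in Z1.
apply Rabs_le_between in Z2. apply Rabs_le. lra.
Qed.

(** A change of scale: with c^2 = q, the kernel [/ (q + d)] at scale [s] is [/ q] times the
    Stieltjes kernel at scale [c * s]. Slow variation then replaces [L (/ (c * s))] by [L (/ s)]. *)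
Lemma admissible_shift q : 0 < q -> admissible (fun d => / (q + d)).
Proof.
intros Hq eps He. set (c := sqrt q).
assert (Hc : 0 < c) by (apply sqrt_lt_R0, Hq).
assert (Hc2 : c * c = q) by (apply sqrt_sqrt; lra).
assert (Pc := Rpower_pos c beta). set (cb := Rpower c beta) in *.
set (B := Rmax 1 (Rmax c (/ c))).
assert (HB : 1 <= B) by apply Rmax_l.
assert (HBc : c <= B) by (apply Rle_trans with (2 := Rmax_r _ _), Rmax_l).
assert (HBi : / c <= B) by (apply Rle_trans with (2 := Rmax_r _ _), Rmax_r).
set (e := Rmin 1 (eps * q / (2 * (cb * (kappa * C0 + 1))))).
assert (Hkc : 0 < kappa * C0) by pos.
assert (Hden : 0 < cb * (kappa * C0 + 1)) by pos.
assert (Hepos : 0 < e) by pos.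
assert (He1 : e <= 1) by apply Rmin_l.
assert (He2 : e * (cb * (kappa * C0 + 1)) <= eps * q / 2).
{ assert (e <= eps * q / (2 * (cb * (kappa * C0 + 1)))) by apply Rmin_r.
  apply Rle_trans with (eps * q / (2 * (cb * (kappa * C0 + 1))) * (cb * (kappa * C0 + 1))).
  - apply Rmult_le_compat_r; lra.
  - right. field. split; lra. }
refine (near0_imp _ _ _ (near0_and _ _ (sv_scale_near0 L Lpos Lunif e B Hepos HB)
  (near0_scale c _ Hc (near0_and _ _ (hstieltjes (e / 2) ltac:(lra)) hmodel)))).
intros s Hs (Hsv & A & B_). refine (ev_imp _ _ _ (ev_and _ _ A B_)). intros N [A1 B1].
assert (HL : Rabs (L (/ (c * s)) - L (/ s)) <= e * L (/ s)).
{ apply Hsv. split; [|apply Rmult_le_compat_r; lra].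
  apply Rmult_le_reg_r with B; [lra|]. unfold Rdiv. rewrite Rmult_assoc, Rinv_l, Rmult_1_r by lra.
  assert (1 <= c * B).
  { rewrite <- (Rinv_r c) by lra. apply Rmult_le_compat_l; lra. }
  nra. }
assert (Ls := Lpos (/ s) ltac:(apply Rinv_0_lt_compat; lra)).
assert (HU := tauberian_scale_pos s Hs).
set (z := fun x => / (1 + chord2 x / (c * s) ^ 2)) in *.
assert (Ez : forall H', rs H' N (fun x => / (q + chord2 x / s ^ 2)) = / q * rs H' N z).
{ intros H'. rewrite <- rs_scal. apply rs_ext. intros x _. unfold z.
  assert (0 <= chord2 x / s ^ 2) by (apply ratio_ge0, Hs).
  assert (0 <= chord2 x / (c * s) ^ 2) by (apply ratio_ge0; nra).
  replace (chord2 x / s ^ 2) with (q * (chord2 x / (c * s) ^ 2)).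
  - set (r := chord2 x / (c * s) ^ 2) in *. clearbody r. field. repeat split; nra.
  - rewrite <- Hc2. field. lra. }
unfold Delta in A1 |- *. rewrite !Ez.
assert (EU : U (c * s) = L (/ (c * s)) * (cb * Rpower s beta)).
{ unfold U. rewrite Rpower_mul_base by assumption. reflexivity. }
rewrite EU in A1. rewrite Rpower_mul_base in B1 by assumption. fold cb in B1.
set (l' := L (/ (c * s))) in *. unfold U in *. set (l := L (/ s)) in *.
assert (Ps := Rpower_pos s beta). set (p := Rpower s beta) in *.
assert (Hl' : l' <= 2 * l) by (apply Rabs_le_between in HL; nra).
assert (Hr0 : 0 <= rs (pw beta) N z).
{ replace 0 with (rs (pw beta) N (fun _ => 0)) by (rewrite rs_const; ring).
  apply rs_le; [apply pw_nondecreasing; lra|]. intros x _. left. apply Rinv_0_lt_compat.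
  assert (0 <= chord2 x / (c * s) ^ 2) by (apply ratio_ge0; nra). lra. }
set (rg := rs G N z) in *. set (rp := rs (pw beta) N z) in *.
replace (/ q * rg - kappa * l * (/ q * rp)) with
  (/ q * ((rg - kappa * l' * rp) + kappa * rp * (l' - l))) by ring.
rewrite Rabs_mult, (Rabs_pos_eq (/ q)) by (left; apply Rinv_0_lt_compat; lra).
apply Rmult_le_reg_l with q; [lra|]. rewrite <- Rmult_assoc, Rinv_r, Rmult_1_l by lra.
apply Rle_trans with (1 := Rabs_triang _ _).
rewrite Rabs_mult, (Rabs_pos_eq (kappa * rp)) by (apply Rmult_le_pos; lra).
assert (X1 : e / 2 * (l' * (cb * p)) <= e / 2 * (2 * l * (cb * p))).
{ apply Rmult_le_compat_l; [lra|]. apply Rmult_le_compat_r; [|lra].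
  apply Rmult_le_pos; lra. }
assert (X2 : kappa * rp * Rabs (l' - l) <= kappa * (C0 * (cb * p)) * (e * l)).
{ apply Rmult_le_compat; [apply Rmult_le_pos; lra|apply Rabs_pos| |exact HL].
  apply Rmult_le_compat_l; lra. }
apply Rle_trans with (e * (cb * (kappa * C0 + 1)) * (l * p)).
- lra.
- replace (q * (eps * (l * p))) with (eps * q * (l * p)) by ring.
  apply Rmult_le_compat_r; [apply Rmult_le_pos; lra|].
  assert (0 < eps * q) by pos. lra.
Qed.

(* Powers are limits of the products [/ ((q+d)^j (q+h+d))], which partial fractions
   reduce to the previous stage. *)
Lemma admissible_power j q : 0 < q -> admissible (fun d => / (q + d) ^ S j).
Proof.
assert (H : forall j, (forall q, 0 < q -> admissible (fun d => / (q + d) ^ S j)) /\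
  (forall q h, 0 < q -> 0 < h -> admissible (fun d => / ((q + d) ^ j * (q + h + d))))).
2: { apply H. }
clear j q. induction j as [|j [IH1 IH2]].
- split.
  + intros q Hq. apply (admissible_ext (fun d => / (q + d))); [|apply admissible_shift, Hq].
    intros d _. simpl. rewrite Rmult_1_r. reflexivity.
  + intros q h Hq Hh. apply (admissible_ext (fun d => / (q + h + d))).
    * intros d _. simpl. rewrite Rmult_1_l. reflexivity.
    * apply admissible_shift. lra.
- assert (H2 : forall q h, 0 < q -> 0 < h ->
    admissible (fun d => / ((q + d) ^ S j * (q + h + d)))).
  { intros q h Hq Hh.
    apply (admissible_ext (fun d => / h * / (q + d) ^ S j + (- / h) * / ((q + d) ^ j * (q + h + d)))).
    - intros d Hd. simpl. field. repeat split; try lra. apply pow_nonzero. lra.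
    - apply (admissible_lin (/ h) (- / h) (fun d => / (q + d) ^ S j)); auto. }
  split; [|exact H2].
  intros q Hq. apply admissible_closure. intros eta Heta.
  set (m := Rmax 1 (/ q)). assert (Hm1 : 1 <= m) by apply Rmax_l.
  assert (Hmq : / q <= m) by apply Rmax_r.
  (* [m] compares [/ (q + h + d)] with [/ (1 + d)]; with this [h] the bound h q^(-j-2) m / (1 + d)
     for the gap is exactly [eta / (1 + d)]. *)
  set (h := eta * q ^ S (S j) / m).
  assert (Hh : 0 < h) by pos.
  exists (fun d => / ((q + d) ^ S j * (q + h + d))). split; [apply H2; assumption|].
  intros d Hd.
  assert (Hp : 0 < (q + d) ^ S j) by pos.
  assert (Hpq : q ^ S (S j) <= (q + d) ^ S (S j)) by (apply pow_incr; lra).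
  assert (Hq2 : 0 < q ^ S (S j)) by pos.
  replace (/ (q + d) ^ S (S j) - / ((q + d) ^ S j * (q + h + d))) with
    (h * / ((q + d) ^ S (S j)) * / (q + h + d)).
  2: { change ((q + d) ^ S (S j)) with ((q + d) * (q + d) ^ S j). field. lra. }
  assert (Hi1 : / (q + d) ^ S (S j) <= / q ^ S (S j)) by (apply Rinv_le_contravar; lra).
  assert (Hi0 : 0 < / (q + d) ^ S (S j)) by pos.
  assert (Hi2 : 0 < / (q + h + d)) by pos.
  assert (Hi3 : / (q + h + d) <= m * / (1 + d)).
  { apply Rmult_le_reg_r with (q + h + d); [lra|]. rewrite Rinv_l by lra.
    apply Rmult_le_reg_r with (1 + d); [lra|].
    replace (m * / (1 + d) * (q + h + d) * (1 + d)) with (m * (q + h + d)) by (field; lra).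
    assert (1 <= m * q).
    { rewrite <- (Rinv_l q) by lra. apply Rmult_le_compat_r; lra. }
    nra. }
  rewrite Rabs_pos_eq by (apply Rmult_le_pos; [apply Rmult_le_pos|]; lra).
  apply Rle_trans with (h * / q ^ S (S j) * (m * / (1 + d))).
  + apply Rmult_le_compat; try lra; [apply Rmult_le_pos; lra|].
    apply Rmult_le_compat_l; lra.
  + right. unfold h. field. repeat split; lra.
Qed.

(** What is at hand are the positive powers of [/ (1 + d)], so the constant term is never isolated:
    products keep a power with [0 < i], and 1 - (1 - w)^(M + 1) arises from 1 - (1 - w)^M by adding
    w (1 - w)^M. *)
Lemma admissible_step n : (0 < n)%nat -> admissible (fun d => step_poly n (/ (1 + d))).
Proof.
intros Hn.
assert (Hpow : forall j, (0 < j)%nat -> admissible (fun d => (/ (1 + d)) ^ j)).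
{ intros [|j] Hj; [lia|]. apply (admissible_ext (fun d => / (1 + d) ^ S j)).
  - intros d Hd. rewrite pow_inv. reflexivity.
  - apply admissible_power. lra. }
assert (Hmix : forall l i, (0 < i)%nat ->
  admissible (fun d => (/ (1 + d)) ^ i * (1 - (/ (1 + d)) ^ n) ^ l)).
{ induction l as [|l IH]; intros i Hi.
  - apply (admissible_ext (fun d => (/ (1 + d)) ^ i)); [intros; simpl; ring|apply Hpow, Hi].
  - apply (admissible_ext (fun d => 1 * ((/ (1 + d)) ^ i * (1 - (/ (1 + d)) ^ n) ^ l) +
      (-1) * ((/ (1 + d)) ^ (i + n) * (1 - (/ (1 + d)) ^ n) ^ l))).
    + intros d _. rewrite pow_add. simpl. ring.
    + apply (admissible_lin 1 (-1) (fun d => (/ (1 + d)) ^ i * (1 - (/ (1 + d)) ^ n) ^ l)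
        (fun d => (/ (1 + d)) ^ (i + n) * (1 - (/ (1 + d)) ^ n) ^ l)); apply IH; lia. }
assert (Hsum : forall M, (0 < M)%nat -> admissible (fun d => 1 - (1 - (/ (1 + d)) ^ n) ^ M)).
{ intros [|M] HM; [lia|]. clear HM. induction M as [|M IH].
  - apply (admissible_ext (fun d => (/ (1 + d)) ^ n)); [intros; simpl; ring|apply Hpow, Hn].
  - apply (admissible_ext (fun d => 1 * (1 - (1 - (/ (1 + d)) ^ n) ^ S M) +
      1 * ((/ (1 + d)) ^ n * (1 - (/ (1 + d)) ^ n) ^ S M))).
    + intros d _. simpl. ring.
    + apply (admissible_lin 1 1 (fun d => 1 - (1 - (/ (1 + d)) ^ n) ^ S M)
        (fun d => (/ (1 + d)) ^ n * (1 - (/ (1 + d)) ^ n) ^ S M)); [exact IH|apply Hmix, Hn]. }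
apply Hsum. apply Nat.neq_0_lt_0, Nat.pow_nonzero. lia.
Qed.

(** With z = 1 / (1 + d), the number 2 z is at least [a] for x below (1 - eta) s and at most [b]
    beyond (1 + eta) s. A second [eta] is lost on the left, since the last grid point before (1 -
    eta) s may be one mesh away. *)
Lemma step_sandwich n s eta b a N H : 0 < s -> 0 < eta <= 1 / 8 -> s < 1 -> s ^ 2 <= eta / 8 ->
  nondecreasing_pos H -> (1 - eta) * s <= PI -> (1 + eta) * s <= PI ->
  2 / (2 + eta) <= b -> 0 < a <= 2 / (2 - eta) -> PI / INR (S N) <= eta * s ->
  (1 - / a ^ S n) * H ((1 - 2 * eta) * s) <=
    rs H N (fun x => step_poly (S n) (/ (1 + chord2 x / s ^ 2))) /\
  rs H N (fun x => step_poly (S n) (/ (1 + chord2 x / s ^ 2))) <=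
    H ((1 + eta) * s) + 2 * b ^ n * rs H N (fun x => / (1 + chord2 x / s ^ 2)).
Proof.
intros Hs Heta Hs1 Hs2 HH Hpi1 Hpi2 Hb Ha HN.
assert (Hz : forall x, 0 < / (1 + chord2 x / s ^ 2) <= 1).
{ intros x. assert (R0 := ratio_ge0 x s Hs). split; [apply Rinv_0_lt_compat; lra|].
  rewrite <- Rinv_1. apply Rinv_le_contravar; lra. }
assert (Hss : 0 < s ^ 2) by pos.
split.
- destruct (rs_cutoff_one H N ((1 - eta) * s)) as (g & Hg & Hg2 & E); [nra|].
  assert (Hgy : H ((1 - 2 * eta) * s) <= H g) by (apply HH; nra).
  assert (Hsp : forall x, 0 <= x <= PI ->
    (1 - / a ^ S n) * cutoff ((1 - eta) * s) (fun _ => 1) x <=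
      step_poly (S n) (/ (1 + chord2 x / s ^ 2))).
  { intros x Hx. unfold cutoff. destruct (Rle_dec x ((1 - eta) * s)) as [Hxe|Hxe].
    - rewrite Rmult_1_r. apply Rle_trans with (2 := step_poly_lower (S n) _ (Hz x)).
      assert (Hd : chord2 x / s ^ 2 <= 1 - eta).
      { apply Rmult_le_reg_r with (s ^ 2); [exact Hss|]. unfold Rdiv.
        rewrite Rmult_assoc, Rinv_l, Rmult_1_r by lra.
        apply Rle_trans with (1 := chord2_le x (proj1 Hx)).
        apply Rle_trans with (((1 - eta) * s) ^ 2); [apply pow_incr; lra|nra]. }
      assert (R0 := ratio_ge0 x s Hs).
      assert (H2 : a <= 2 * / (1 + chord2 x / s ^ 2)).
      { apply Rle_trans with (1 := proj2 Ha). unfold Rdiv at 1. apply Rmult_le_compat_l; [lra|].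
        apply Rinv_le_contravar; lra. }
      assert (Hap : 0 < a ^ S n) by pos.
      assert (/ (2 * / (1 + chord2 x / s ^ 2)) ^ S n <= / a ^ S n).
      { apply Rinv_le_contravar; [exact Hap|]. apply pow_incr. lra. }
      lra.
    - rewrite Rmult_0_r. apply step_poly_bounds. specialize (Hz x). lra. }
  destruct (Rle_dec 0 (1 - / a ^ S n)) as [Ha1|Ha1].
  + apply Rle_trans with ((1 - / a ^ S n) * H g); [apply Rmult_le_compat_l; assumption|].
    rewrite <- E, <- rs_scal. apply rs_le; assumption.
  + apply Rle_trans with 0.
    * assert (0 <= H ((1 - 2 * eta) * s)) by (apply nondecreasing_pos_ge0; [exact HH|nra]). nra.
    * replace 0 with (rs H N (fun _ => 0)) by (rewrite rs_const; ring). apply rs_le; [exact HH|].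
      intros x _. apply step_poly_bounds. specialize (Hz x). lra.
- destruct (rs_cutoff_one H N ((1 + eta) * s)) as (g & Hg & Hg2 & E); [nra|].
  assert (Hgy : H g <= H ((1 + eta) * s)) by (apply HH; nra).
  apply Rle_trans with (H g + 2 * b ^ n * rs H N (fun x => / (1 + chord2 x / s ^ 2))); [|lra].
  rewrite <- E, <- rs_scal, <- rs_plus. apply rs_le; [exact HH|]. intros x Hx.
  assert (Hb0 : 0 < b).
  { apply Rlt_le_trans with (2 := Hb). apply Rdiv_lt_0_compat; lra. }
  assert (Hbn : 0 <= b ^ n) by pos.
  specialize (Hz x). set (z := / (1 + chord2 x / s ^ 2)) in *.
  unfold cutoff. destruct (Rle_dec x ((1 + eta) * s)) as [Hxe|Hxe].
  + assert (B1 := step_poly_bounds (S n) z ltac:(lra)).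
    assert (0 <= 2 * b ^ n * z) by nra. lra.
  + apply Rle_trans with (1 := step_poly_upper (S n) z ltac:(lra)). rewrite Rplus_0_l.
    (* One of the [S n] factors [2 * z] is kept, so that the error is integrated against the
       Stieltjes kernel; the other [n] are at most [b]. *)
    simpl. replace (2 * b ^ n * z) with (2 * z * b ^ n) by ring.
    apply Rmult_le_compat_l; [lra|]. apply pow_incr. split; [lra|].
    apply Rle_trans with (2 := Hb). unfold z, Rdiv at 2. apply Rmult_le_compat_l; [lra|].
    apply Rinv_le_contravar; [lra|].
    assert (1 + eta <= chord2 x / s ^ 2); [|lra].
    apply Rmult_le_reg_r with (s ^ 2); [exact Hss|]. unfold Rdiv.
    rewrite Rmult_assoc, Rinv_l, Rmult_1_r by lra.
    apply Rle_trans with (chord2 ((1 + eta) * s)).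
    * apply Rle_trans with (2 := chord2_ge ((1 + eta) * s) ltac:(nra)).
      replace (((1 + eta) * s) ^ 2 * (1 - ((1 + eta) * s) ^ 2 / 12)) with
        ((1 + eta) * s ^ 2 * ((1 + eta) * (1 - (1 + eta) ^ 2 * s ^ 2 / 12))) by field.
      (* The spare factor [1 + eta] absorbs the quartic error of [chord2], thanks to
         [s ^ 2 <= eta / 8]. *)
      assert (HA : 1 <= (1 + eta) * (1 - (1 + eta) ^ 2 * s ^ 2 / 12)).
      { nra. }
      assert (0 <= (1 + eta) * s ^ 2) by nra. nra.
    * unfold chord2. assert (cos x <= cos ((1 + eta) * s)); [|lra].
      apply cos_decr_1; nra.
Qed.

Lemma tauberian eps : 0 < eps -> near0 (fun x => Rabs (G x - kappa * U x) <= eps * U x).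
Proof.
intros He.
(* [up] and [lo] bracket the ratio of [G x] to [U x] at error level [e]: numerators come from the
   sandwich, denominators from passing from the scale [s] back to [x]. Both are continuous with
   value [kappa] at 0, so a small level [eta] is enough. *)
set (up := fun e => (kappa * (1 + e) ^ 2 + 2 * e) / ((1 - e) ^ 2 * (1 - 2 * e) ^ 2)).
set (lo := fun e => (kappa * (1 - e) * (1 - 2 * e) ^ 2 - 2 * e) / ((1 + e) * (1 + e) ^ 2)).
assert (Hnear : forall f : R -> R, continuous f 0 -> f 0 = kappa ->
  near0 (fun e => Rabs (f e - kappa) < eps)).
{ intros f Hf H0. apply continuity_pt_filterlim in Hf. destruct (Hf eps He) as (d & Hd & H).
  exists d. split; [exact Hd|]. intros e Hed. rewrite <- H0. apply (H e).
  split; [split; [exact I|lra]|]. simpl. unfold R_dist. rewrite Rminus_0_r, Rabs_pos_eq; lra. }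
assert (Hup : near0 (fun e => Rabs (up e - kappa) < eps)).
{ apply Hnear; unfold up; [|field].
  apply (ex_derive_continuous up). unfold up. auto_derive. lra. }
assert (Hlo : near0 (fun e => Rabs (lo e - kappa) < eps)).
{ apply Hnear; unfold lo; [|field].
  apply (ex_derive_continuous lo). unfold lo. auto_derive. lra. }
destruct (near0_and _ _ (near0_and _ _ Hup Hlo) (near0_lt (1 / 8) ltac:(lra))) as (d0 & Hd0 & Hd).
destruct (Hd (d0 / 2) ltac:(lra)) as [[Hu Hl] He8]. set (eta := d0 / 2) in *.
assert (Heta : 0 < eta) by pos. clear Hd Hnear.
set (b := 2 / (2 + eta)). set (a := 2 / (2 - eta)).
assert (Hb : 0 < b < 1).
{ unfold b. split; [apply Rdiv_lt_0_compat; lra|]. apply Rmult_lt_reg_r with (2 + eta); [lra|].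
  unfold Rdiv. rewrite Rmult_assoc, Rinv_l; lra. }
assert (Ha : 1 < a).
{ unfold a. apply Rmult_lt_reg_r with (2 - eta); [lra|].
  unfold Rdiv. rewrite Rmult_assoc, Rinv_l; lra. }
assert (Hia : 0 < / a < 1).
{ split; [apply Rinv_0_lt_compat; lra|]. rewrite <- Rinv_1. apply Rinv_lt_contravar; lra. }
assert (HK : 0 < kappa * C0) by pos.
destruct (pow_lt_1_zero b ltac:(rewrite Rabs_pos_eq; lra) (eta / (2 * (kappa * C0 + 1)))
  ltac:(apply Rdiv_lt_0_compat; lra)) as (n1 & Hn1).
destruct (pow_lt_1_zero (/ a) ltac:(rewrite Rabs_pos_eq; lra) eta Heta) as (n2 & Hn2).
set (n := (n1 + n2)%nat).
assert (Hbn : 2 * b ^ n * (kappa * C0 + 1) <= eta).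
{ assert (H := Hn1 n ltac:(unfold n; lia)). rewrite Rabs_pos_eq in H by (apply pow_le; lra).
  apply Rle_trans with (2 * (eta / (2 * (kappa * C0 + 1))) * (kappa * C0 + 1)).
  - apply Rmult_le_compat_r; lra.
  - right. field. lra. }
assert (Han : / a ^ S n <= eta).
{ assert (H := Hn2 (S n) ltac:(unfold n; lia)). rewrite Rabs_pos_eq in H by (apply pow_le; lra).
  rewrite pow_inv in H. lra. }
assert (Hbn0 : 0 <= b ^ n) by pos.
clear Hn1 Hn2.
assert (HP := PI2_3_2).
assert (Hmain : near0 (fun s =>
  (1 - eta) * G ((1 - 2 * eta) * s) <= (kappa * (1 + eta) ^ 2 + 2 * eta) * U s /\
  (kappa * (1 - eta) * (1 - 2 * eta) ^ 2 - 2 * eta) * U s <= G ((1 + eta) * s) /\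
  forall x, s / 2 <= x <= 2 * s -> Rabs (L (/ x) - L (/ s)) <= eta * L (/ s))).
{ refine (near0_imp _ _ _ (near0_and _ _ (near0_and _ _
    (admissible_step (S n) ltac:(lia) eta Heta) stieltjes_bounds)
    (near0_and _ _ (sv_scale_near0 L Lpos Lunif eta 2 Heta ltac:(lra)) (near0_lt (eta / 8) ltac:(lra))))).
  intros s Hs ((A & B) & Hsv & Hs8).
  assert (Hmesh : eventually_nat (fun N => PI / INR (S N) <= eta * s)).
  { destruct (INR_unbounded (PI / (eta * s))) as (N0 & HN0). exists N0. intros N HN.
    assert (Hes : 0 < eta * s) by nra.
    assert (INR N0 <= INR (S N)) by (apply le_INR; lia).
    assert (HpN : 0 < INR (S N)) by (apply lt_0_INR; lia).
    apply Rmult_le_reg_r with (INR (S N)); [exact HpN|].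
    unfold Rdiv. rewrite Rmult_assoc, Rinv_l, Rmult_1_r by lra.
    replace PI with (PI / (eta * s) * (eta * s)) at 1 by (field; lra).
    rewrite (Rmult_comm (eta * s)). apply Rmult_le_compat_r; lra. }
  (* One sufficiently fine grid is enough, since the conclusion does not mention [N]. *)
  destruct (ev_and _ _ (ev_and _ _ A B) Hmesh) as (N & HN).
  destruct (HN N (le_n N)) as ((A1 & B1 & B2) & HN1). clear HN A B Hmesh.
  assert (HU := tauberian_scale_pos s Hs).
  assert (Ls := Lpos (/ s) ltac:(apply Rinv_0_lt_compat; lra)).
  assert (Hs2 : s ^ 2 <= eta / 8) by nra.
  destruct (step_sandwich n s eta b a N G Hs ltac:(lra) ltac:(lra) Hs2 hG ltac:(nra) ltac:(nra)
    (Rle_refl _) ltac:(fold a; lra) HN1) as [G1 G2].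
  destruct (step_sandwich n s eta b a N (pw beta) Hs ltac:(lra) ltac:(lra) Hs2
    (pw_nondecreasing beta ltac:(lra)) ltac:(nra) ltac:(nra)
    (Rle_refl _) ltac:(fold a; lra) HN1) as [P1 P2].
  set (z := fun x => / (1 + chord2 x / s ^ 2)) in *.
  set (p := fun x => step_poly (S n) (/ (1 + chord2 x / s ^ 2))) in *.
  unfold Delta in A1. fold p in A1. apply Rabs_le_between in A1.
  set (kl := kappa * L (/ s)) in *.
  assert (Hkl : 0 < kl) by pos.
  assert (HG0 : 0 <= G ((1 - 2 * eta) * s)) by (apply nondecreasing_pos_ge0; [exact hG|nra]).
  assert (EU : forall c, 0 < c -> kl * pw beta (c * s) = kappa * Rpower c beta * U s).
  { intros c Hc. rewrite pw_pos, Rpower_mul_base by nra. unfold kl, U. ring. }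
  assert (Hpw1 : Rpower (1 + eta) beta <= (1 + eta) ^ 2).
  { rewrite <- Rpower_pow by lra. apply Rle_Rpower; simpl; lra. }
  assert (Hpw2 : (1 - 2 * eta) ^ 2 <= Rpower (1 - 2 * eta) beta).
  { rewrite <- Rpower_pow by lra. unfold Rpower. apply exp_le_mono. simpl INR.
    assert (ln (1 - 2 * eta) <= 0).
    { rewrite <- ln_1. apply ln_le; lra. }
    nra. }
  assert (Y1 : 2 * b ^ n * rs G N z <= eta * U s).
  { apply Rle_trans with (2 * b ^ n * ((kappa * C0 + 1) * U s)); [apply Rmult_le_compat_l; lra|].
    rewrite <- Rmult_assoc. apply Rmult_le_compat_r; lra. }
  assert (Y2 : kl * (2 * b ^ n * rs (pw beta) N z) <= eta * U s).
  { replace (kl * (2 * b ^ n * rs (pw beta) N z)) with (2 * b ^ n * (kl * rs (pw beta) N z)) by ring.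
    apply Rle_trans with (2 * b ^ n * ((kappa * C0 + 1) * U s)).
    - apply Rmult_le_compat_l; lra.
    - rewrite <- Rmult_assoc. apply Rmult_le_compat_r; lra. }
  apply Rmult_le_compat_l with (r := kl) in P1; [|lra].
  apply Rmult_le_compat_l with (r := kl) in P2; [|lra].
  assert (E1 := EU (1 + eta) ltac:(lra)). assert (E2 := EU (1 - 2 * eta) ltac:(lra)).
  assert (F1 : kappa * Rpower (1 + eta) beta * U s <= kappa * (1 + eta) ^ 2 * U s).
  { apply Rmult_le_compat_r; [lra|]. apply Rmult_le_compat_l; lra. }
  assert (F2 : kappa * (1 - 2 * eta) ^ 2 * U s <= kappa * Rpower (1 - 2 * eta) beta * U s).
  { apply Rmult_le_compat_r; [lra|]. apply Rmult_le_compat_l; lra. }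
  split; [|split; [|exact Hsv]].
  - apply Rle_trans with (rs G N p).
    + apply Rle_trans with (2 := G1). apply Rmult_le_compat_r; lra.
    + lra.
  - assert (F3 : (1 - eta) * (kl * pw beta ((1 - 2 * eta) * s)) <= kl * rs (pw beta) N p).
    { apply Rle_trans with (2 := P1).
      replace (kl * ((1 - / a ^ S n) * pw beta ((1 - 2 * eta) * s))) with
        ((1 - / a ^ S n) * (kl * pw beta ((1 - 2 * eta) * s))) by ring.
      apply Rmult_le_compat_r; [|lra]. apply Rmult_le_pos; [lra|apply pw_ge0]. }
    rewrite E2 in F3.
    assert (F4 : (1 - eta) * (kappa * (1 - 2 * eta) ^ 2 * U s) <=
      (1 - eta) * (kappa * Rpower (1 - 2 * eta) beta * U s)) by (apply Rmult_le_compat_l; lra).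
    lra. }
(* The sandwich speaks of [G] at (1 - 2 eta) s and at (1 + eta) s; two choices of [s] bring both to
   the same point [x]. *)
assert (H1 := near0_scale (/ (1 - 2 * eta)) _ ltac:(apply Rinv_0_lt_compat; lra) Hmain).
assert (H2 := near0_scale (/ (1 + eta)) _ ltac:(apply Rinv_0_lt_compat; lra) Hmain).
refine (near0_imp _ _ _ (near0_and _ _ (near0_and _ _ H1 H2) (near0_lt 1 Rlt_0_1))).
intros x Hx (((S1 & _ & S2) & (_ & T1 & T2)) & Hx1).
assert (HU := tauberian_scale_pos x Hx). assert (Px := Rpower_pos x beta).
assert (Lx := Lpos (/ x) ltac:(apply Rinv_0_lt_compat; lra)).
assert (Hi2 : 1 <= / (1 - 2 * eta) <= 2).
{ split.
  - rewrite <- Rinv_1 at 1. apply Rinv_le_contravar; lra.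
  - rewrite <- (Rinv_inv 2). apply Rinv_le_contravar; lra. }
assert (Hi1 : / 2 <= / (1 + eta) <= 1).
{ split.
  - apply Rinv_le_contravar; lra.
  - rewrite <- Rinv_1 at 2. apply Rinv_le_contravar; lra. }
set (i2 := / (1 - 2 * eta)) in *. set (i1 := / (1 + eta)) in *.
assert (Ei2 : (1 - 2 * eta) * i2 = 1) by (unfold i2; field; lra).
assert (Ei1 : (1 + eta) * i1 = 1) by (unfold i1; field; lra).
rewrite <- Rmult_assoc, Ei2, Rmult_1_l in S1.
rewrite <- (Rmult_assoc (1 + eta)), Ei1, Rmult_1_l in T1.
assert (Q1 := S2 x ltac:(nra)). assert (Q2 := T2 x ltac:(nra)).
apply Rabs_le_between in Q1. apply Rabs_le_between in Q2.
assert (UA : U (i2 * x) <= U x / ((1 - eta) * (1 - 2 * eta) ^ 2)).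
{ unfold U. rewrite Rpower_mul_base by lra.
  assert (X1 : L (/ (i2 * x)) <= L (/ x) / (1 - eta)).
  { apply Rmult_le_reg_r with (1 - eta); [lra|]. unfold Rdiv.
    rewrite Rmult_assoc, Rinv_l by lra. lra. }
  assert (X2 : Rpower i2 beta <= / (1 - 2 * eta) ^ 2).
  { rewrite <- pow_inv. fold i2. rewrite <- Rpower_pow by lra. apply Rle_Rpower; simpl; lra. }
  assert (X3 := Rpower_pos i2 beta).
  assert (X4 : 0 < L (/ (i2 * x))) by (apply Lpos, Rinv_0_lt_compat; nra).
  apply Rle_trans with (L (/ x) / (1 - eta) * (/ (1 - 2 * eta) ^ 2 * Rpower x beta)).
  - apply Rmult_le_compat; [lra|apply Rmult_le_pos; lra|exact X1|].
    apply Rmult_le_compat_r; lra.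
  - right. field. lra. }
assert (UB : U x / ((1 + eta) * (1 + eta) ^ 2) <= U (i1 * x)).
{ unfold U. rewrite Rpower_mul_base by lra.
  assert (X1 : L (/ x) / (1 + eta) <= L (/ (i1 * x))).
  { apply Rmult_le_reg_r with (1 + eta); [lra|]. unfold Rdiv.
    rewrite Rmult_assoc, Rinv_l by lra. lra. }
  assert (X2 : / (1 + eta) ^ 2 <= Rpower i1 beta).
  { rewrite <- pow_inv. fold i1. rewrite <- Rpower_pow by lra. unfold Rpower.
    apply exp_le_mono. simpl INR.
    assert (ln i1 <= 0) by (rewrite <- ln_1; apply ln_le; lra). nra. }
  apply Rle_trans with (L (/ x) / (1 + eta) * (/ (1 + eta) ^ 2 * Rpower x beta)).
  - right. field. lra.
  - assert (0 < / (1 + eta) ^ 2) by pos.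
    apply Rmult_le_compat; [apply Rdiv_le_0_compat; lra|apply Rmult_le_pos; lra|exact X1|].
    apply Rmult_le_compat_r; lra. }
assert (HK1 : 0 < kappa * (1 + eta) ^ 2 + 2 * eta) by nra.
assert (Gup : G x <= up eta * U x).
{ apply Rmult_le_reg_l with (1 - eta); [lra|].
  apply Rle_trans with (1 := S1).
  apply Rle_trans with ((kappa * (1 + eta) ^ 2 + 2 * eta) * (U x / ((1 - eta) * (1 - 2 * eta) ^ 2))).
  - apply Rmult_le_compat_l; lra.
  - right. unfold up. field. lra. }
assert (Glo : lo eta * U x <= G x).
{ set (k := kappa * (1 - eta) * (1 - 2 * eta) ^ 2 - 2 * eta) in *.
  destruct (Rle_dec 0 k) as [Hk|Hk].
  - apply Rle_trans with (2 := T1).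
    apply Rle_trans with (k * (U x / ((1 + eta) * (1 + eta) ^ 2))).
    + right. unfold lo. fold k. field. lra.
    + apply Rmult_le_compat_l; assumption.
  - apply Rle_trans with 0.
    + assert (lo eta < 0); [|nra]. unfold lo. fold k. unfold Rdiv.
      assert (0 < / ((1 + eta) * (1 + eta) ^ 2)) by pos. nra.
    + apply nondecreasing_pos_ge0; [exact hG|lra]. }
apply Rabs_def2 in Hu. apply Rabs_def2 in Hl. apply Rabs_le. nra.
Qed.

End Tauberian.

(** * The model measure with distribution function x^beta *)

Lemma pw_inv_pw b x : 0 < b -> 0 <= x -> pw (/ b) (pw b x) = x.
Proof.
intros Hb Hx. destruct (Req_dec x 0) as [->|Hne].
- rewrite (pw_0 b), pw_0 by lra. reflexivity.
- rewrite (pw_pos b) by lra. rewrite pw_pos by apply Rpower_pos.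
  rewrite Rpower_mult, Rinv_r, Rpower_1; lra.
Qed.

Lemma pw_pw_inv b x : 0 < b -> 0 <= x -> pw b (pw (/ b) x) = x.
Proof.
intros Hb Hx. rewrite <- (Rinv_inv b) at 1. apply pw_inv_pw; [apply Rinv_0_lt_compat, Hb|exact Hx].
Qed.

Lemma lipschitz_continuous (f : R -> R) K x :
  (forall y z, Rabs (f y - f z) <= K * Rabs (y - z)) -> continuous f x.
Proof.
intros H. apply continuity_pt_filterlim. intros eps He.
exists (eps / (Rabs K + 1)). assert (P := Rabs_pos K).
split; [apply Rdiv_lt_0_compat; lra|]. intros y [_ Hy]. simpl in *. unfold R_dist in *.
apply Rle_lt_trans with (1 := H y x).
apply Rle_lt_trans with ((Rabs K + 1) * Rabs (y - x)).
- apply Rmult_le_compat_r; [apply Rabs_pos|]. generalize (Rle_abs K). lra.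
- apply Rmult_lt_compat_l with (r := Rabs K + 1) in Hy; [|lra].
  replace ((Rabs K + 1) * (eps / (Rabs K + 1))) with eps in Hy by (field; lra). exact Hy.
Qed.

Section Model.

Variable beta : R.
Hypothesis hbeta : 0 < beta < 2.

Let ib := / beta.
Let p := 2 / beta.

Lemma ib_pos : 0 < ib.
Proof. apply Rinv_0_lt_compat. lra. Qed.

Lemma p_gt1 : 1 < p.
Proof. unfold p. apply Rmult_lt_reg_r with beta; [lra|]. unfold Rdiv. rewrite Rmult_assoc, Rinv_l; lra. Qed.

Lemma continuous_comp_pw (f : R -> R) x : (forall y, continuous f y) -> continuous (fun w => f (pw ib w)) x.
Proof.
intros Hf. apply (continuous_comp (pw ib) f); [|apply Hf]. apply pw_continuous, ib_pos.
Qed.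

Lemma ex_RInt_cont (f : R -> R) a b : (forall y, continuous f y) -> ex_RInt f a b.
Proof. intros H. apply (ex_RInt_continuous (V := R_CompleteNormedModule)). intros; apply H. Qed.

(** Under w = x^beta the Stieltjes sums become Riemann sums of f(w^(1 / beta)) over the image of the
    grid. A cell of the image is one mesh wide in [x], and the Lipschitz bound gives the tag
    error. *)
Lemma model_integral (f : R -> R) K : 0 <= K ->
  (forall x y, Rabs (f x - f y) <= K * Rabs (x - y)) ->
  is_lim_seq (fun N => rs (pw beta) N f) (RInt (fun w => f (pw ib w)) 0 (pw beta PI)).
Proof.
intros HK Hf.
assert (Hfc : forall y, continuous f y) by (intros; apply lipschitz_continuous with K, Hf).
apply is_lim_seq_ev. intros eps He.
assert (PP := PI_RGT_0). assert (HQ := pw_ge0 beta PI).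
set (Q := K * PI * pw beta PI).
destruct (INR_unbounded (Q / eps)) as (N0 & HN0). exists N0. intros N HN.
assert (HSN : INR N0 <= INR (S N)) by (apply le_INR; lia).
assert (HSp : 0 < INR (S N)) by (apply lt_0_INR; lia).
assert (H := riemann_sum_error (fun w => f (pw ib w)) (fun j => pw beta (grid N j))
  (fun j => f (grid N (S j))) (S N) (K * (PI / INR (S N)))).
cbv beta in H. rewrite grid_0, grid_end, (pw_0 beta 0), Rminus_0_r in H by lra.
unfold rs. rewrite (pw_0 beta 0), Rmult_0_r, Rplus_0_l by lra.
apply Rle_trans with (K * (PI / INR (S N)) * pw beta PI).
- apply H.
  + intros i Hi. apply pw_le; [lra|apply grid_le; lia].
  + intros y _. apply continuous_comp_pw, Hfc.
  + intros i y Hi Hy. apply Rle_trans with (1 := Hf _ _).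
    apply Rmult_le_compat_l; [exact HK|].
    assert (G1 := grid_range N i ltac:(lia)). assert (G2 := grid_range N (S i) ltac:(lia)).
    assert (I1 := ib_pos).
    assert (A1 : grid N i <= pw ib y).
    { rewrite <- (pw_inv_pw beta (grid N i)) by lra. apply pw_le; [unfold ib; fold ib; lra|lra]. }
    assert (A2 : pw ib y <= grid N (S i)).
    { rewrite <- (pw_inv_pw beta (grid N (S i))) by lra. apply pw_le; [unfold ib; fold ib; lra|lra]. }
    rewrite grid_S in A2 |- *. apply Rabs_le. lra.
- replace (K * (PI / INR (S N)) * pw beta PI) with (Q / INR (S N)) by (unfold Q; field; lra).
  apply Rmult_le_reg_r with (INR (S N)); [exact HSp|].
  unfold Rdiv. rewrite Rmult_assoc, Rinv_l, Rmult_1_r by lra.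
  apply Rle_trans with (eps * (Q / eps)).
  + right. field. lra.
  + apply Rmult_le_compat_l; lra.
Qed.

(** Homogeneity of the model: dilating x by s dilates w by s^beta. *)
Lemma model_scaling (f : R -> R) s : 0 < s -> (forall y, continuous f y) ->
  RInt (fun w => f (pw ib w)) 0 (pw beta PI) =
  Rpower s beta * RInt (fun w => f (s * pw ib w)) 0 (pw beta (/ s * PI)).
Proof.
intros Hs Hf.
assert (Hfc : forall y, continuous (fun w => f (pw ib w)) y) by (intros; apply continuous_comp_pw, Hf).
assert (H := RInt_comp_lin (fun w => f (pw ib w)) (Rpower s beta) 0 0 (pw beta (/ s * PI))).
rewrite Rmult_0_r, !Rplus_0_r in H.
replace (Rpower s beta * pw beta (/ s * PI)) with (pw beta PI) in H.
2: { rewrite <- pw_scale by exact Hs. f_equal. field. lra. }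
rewrite <- H by (apply ex_RInt_cont, Hfc).
assert (Hfc' : forall y, continuous (fun w => f (s * pw ib w)) y).
{ intros y. apply (continuous_comp_pw (fun u => f (s * u))). intros u.
  apply (continuous_comp (fun u => s * u) f); [|apply Hf].
  apply (continuous_mult (fun _ => s) (fun u => u)); [apply continuous_const|apply continuous_id]. }
assert (E := RInt_scal (fun w => f (s * pw ib w)) 0 (pw beta (/ s * PI)) (Rpower s beta)
  (ex_RInt_cont _ _ _ Hfc')).
unfold scal in E. simpl in E. unfold mult in E. simpl in E. rewrite <- E.
apply RInt_ext. intros w Hw. unfold scal. simpl. unfold mult. simpl. f_equal. f_equal.
assert (0 <= w).
{ rewrite Rmin_left in Hw by apply pw_ge0. lra. }
rewrite Rplus_0_r.
replace (Rpower s beta) with (pw beta s) by (apply pw_pos, Hs).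
destruct (Req_dec w 0) as [->|Hw0]; [rewrite Rmult_0_r, pw_0 by lra; ring|].
rewrite !pw_pos by (try apply Rmult_lt_0_compat; try rewrite pw_pos; try lra; apply Rpower_pos).
rewrite Rpower_mul_base by (try apply Rpower_pos; lra).
rewrite Rpower_mult. unfold ib. rewrite Rinv_r, Rpower_1 by lra. reflexivity.
Qed.

Lemma power_tail a b : 0 < a <= b ->
  RInt (fun w => Rpower w (- p)) a b <= / (p - 1) * Rpower a (1 - p).
Proof.
intros Hab. assert (Hp := p_gt1).
assert (H : is_RInt (fun w => Rpower w (- p)) a b
  (minus (- / (p - 1) * Rpower b (1 - p)) (- / (p - 1) * Rpower a (1 - p)))).
{ apply (is_RInt_derive (fun w => - / (p - 1) * Rpower w (1 - p))).
  - intros x. rewrite Rmin_left, Rmax_right by lra. intros Hx. unfold Rpower. auto_derive; [lra|].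
    replace (exp (- p * ln x)) with (exp ((1 - p) * ln x) * / x).
    + field. lra.
    + replace (- p * ln x) with ((1 - p) * ln x + - ln x) by ring.
      rewrite exp_plus, (exp_Ropp (ln x)), exp_ln by lra. reflexivity.
  - intros x. rewrite Rmin_left, Rmax_right by lra. intros Hx.
    apply (ex_derive_continuous (fun w => Rpower w (- p))). unfold Rpower. auto_derive. lra. }
rewrite (is_RInt_unique _ _ _ _ H). unfold minus, plus, opp. simpl.
assert (0 < / (p - 1)) by pos.
assert (0 < Rpower b (1 - p)) by pos. nra.
Qed.

Lemma ex_RInt_power a b : 0 < a <= b -> ex_RInt (fun w => Rpower w (- p)) a b.
Proof.
intros Hab. apply (ex_RInt_continuous (V := R_CompleteNormedModule)).
intros x. rewrite Rmin_left, Rmax_right by lra. intros Hx.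
apply (ex_derive_continuous (fun w => Rpower w (- p))). unfold Rpower. auto_derive. lra.
Qed.

(** In the variable w quadratic decay becomes w^(-p) with p = 2 / beta above 1, which makes the
    improper integrals converge. *)
Lemma decay_transfer K y w : 0 < w -> y <= K * (/ pw ib w) ^ 2 -> y <= K * Rpower w (- p).
Proof.
intros Hw Hy. apply Rle_trans with (1 := Hy). right. f_equal.
rewrite pw_pos by exact Hw. rewrite <- Rpower_Ropp, <- Rpower_pow by apply Rpower_pos.
rewrite Rpower_mult. f_equal. unfold ib, p. simpl. field. lra.
Qed.

Lemma tail_integral (h : R -> R) K a b : 0 < a <= b -> 0 <= K -> (forall y, continuous h y) ->
  (forall w, a <= w <= b -> 0 <= h w <= K * Rpower w (- p)) ->
  0 <= RInt h a b <= K * / (p - 1) * Rpower a (1 - p).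
Proof.
intros Hab HK Hc Hh. split.
- apply RInt_ge_0; [lra|apply ex_RInt_cont, Hc|]. intros x Hx. apply Hh. lra.
- apply Rle_trans with (RInt (fun w => scal K (Rpower w (- p))) a b).
  + apply RInt_le; [lra|apply ex_RInt_cont, Hc|apply (ex_RInt_scal (fun w => Rpower w (- p))), ex_RInt_power, Hab|].
    intros x Hx. apply Hh. lra.
  + rewrite (RInt_scal (fun w => Rpower w (- p))) by apply ex_RInt_power, Hab.
    unfold scal. simpl. unfold mult. simpl. rewrite Rmult_assoc. apply Rmult_le_compat_l; [exact HK|].
    apply power_tail, Hab.
Qed.

Lemma RInt_split (h : R -> R) a b : (forall y, continuous h y) ->
  RInt h 0 b = RInt h 0 a + RInt h a b.
Proof. intros Hc. symmetry. apply (RInt_Chasles h); apply ex_RInt_cont, Hc. Qed.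

Definition improper_value (h : R -> R) (c : R) : Prop :=
  forall eps, 0 < eps -> exists T0, 1 <= T0 /\ forall T, T0 <= T -> Rabs (RInt h 0 T - c) <= eps.

Lemma Rpower_neg_small a eps : 0 < a -> 0 < eps ->
  exists T0, 1 <= T0 /\ forall T, T0 <= T -> Rpower T (- a) <= eps.
Proof.
intros Ha He. destruct (Rpower_small a eps Ha He) as (d & Hd & H).
exists (Rmax 1 (2 / d)). split; [apply Rmax_l|]. intros T HT.
assert (H1 := Rmax_l 1 (2 / d)). assert (H2 := Rmax_r 1 (2 / d)).
assert (HdT : / T < d).
{ apply Rmult_lt_reg_r with T; [lra|]. rewrite Rinv_l by lra.
  assert (d * (2 / d) = 2) by (field; lra).
  assert (d * (2 / d) <= d * T) by nra. lra. }
left. replace (Rpower T (- a)) with (Rpower (/ T) a).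
- apply H. split; [apply Rinv_0_lt_compat; lra|exact HdT].
- unfold Rpower. rewrite ln_Rinv by lra. f_equal. ring.
Qed.

Lemma improper_exists (h : R -> R) K : 0 <= K -> (forall y, continuous h y) ->
  (forall w, 0 < w -> 0 <= h w <= K * Rpower w (- p)) ->
  exists c, improper_value h c /\ RInt h 0 1 <= c.
Proof.
intros HK Hc Hh. assert (Hp := p_gt1).
assert (Hip : 0 < / (p - 1)) by pos.
assert (Hmono : forall a b, 0 <= a <= b -> RInt h 0 a <= RInt h 0 b).
{ intros a b Hab. rewrite (RInt_split h a b Hc).
  assert (0 <= RInt h a b); [|lra].
  apply RInt_ge_0; [lra|apply ex_RInt_cont, Hc|]. intros x Hx. apply Hh. lra. }
destruct (completeness (fun y => exists b, 0 <= b /\ y = RInt h 0 b)) as (c & Hub & Hlub).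
- exists (RInt h 0 1 + K * / (p - 1)). intros y (b & Hb & ->).
  destruct (Rle_dec b 1) as [Hb1|Hb1].
  + assert (0 <= K * / (p - 1)) by pos.
    generalize (Hmono b 1 ltac:(lra)). lra.
  + rewrite (RInt_split h 1 b Hc). apply Rplus_le_compat_l.
    destruct (tail_integral h K 1 b ltac:(lra) HK Hc) as [_ H].
    * intros w Hw. apply Hh. lra.
    * replace (Rpower 1 (1 - p)) with 1 in H by (unfold Rpower; rewrite ln_1, Rmult_0_r, exp_0; reflexivity).
      lra.
- exists (RInt h 0 0), 0. split; [lra|reflexivity].
- exists c. split; [|apply Hub; exists 1; split; [lra|reflexivity]].
  intros eps He.
  assert (Hex : exists b, 0 <= b /\ c - eps < RInt h 0 b).
  { apply NNPP. intros Hn. assert (c <= c - eps); [|lra].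
    apply Hlub. intros y (b & Hb & ->). apply Rnot_lt_le. intros Hlt. apply Hn. exists b. auto. }
  destruct Hex as (b0 & Hb0 & Hlt). exists (Rmax 1 b0). split; [apply Rmax_l|].
  intros b Hb. assert (H2 := Rmax_r 1 b0).
  assert (H3 := Hmono b0 b ltac:(lra)).
  assert (H4 : RInt h 0 b <= c) by (apply Hub; exists b; split; [lra|reflexivity]).
  apply Rabs_le. lra.
Qed.

(** A kernel [f] of scale [s] with profile [g] integrates to about [c] times s^beta. [B] and [d] are
    fixed before [s]; the Lipschitz constant [Kf], which may grow as [s] shrinks, only influences
    how large [N] has to be. *)
Lemma model_kernel_limit (g : R -> R) K c eps : 0 < eps -> 0 <= K -> (forall y, continuous g y) ->
  (forall y, 0 < y -> 0 <= g y <= K * (/ y) ^ 2) ->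
  improper_value (fun w => g (pw ib w)) c ->
  exists B d, 1 <= B /\ 0 < d /\ near0 (fun s => forall f Kf,
    0 <= Kf -> (forall x y, Rabs (f x - f y) <= Kf * Rabs (x - y)) ->
    (forall x, 0 < x <= PI -> 0 <= f x <= K * (s / x) ^ 2) ->
    (forall y, 0 < y <= B -> Rabs (f (s * y) - g y) <= d) ->
    eventually_nat (fun N => Rabs (rs (pw beta) N f - c * Rpower s beta) <= eps * Rpower s beta)).
Proof.
intros He HK Hg Hgd Hc. assert (Hp := p_gt1). assert (I1 := ib_pos).
assert (Hip : 0 < / (p - 1)) by pos.
destruct (Rpower_neg_small (p - 1) (eps / (5 * (K * / (p - 1) + 1))) ltac:(lra)) as (T1 & HT1 & HP1).
{ apply Rdiv_lt_0_compat; [lra|]. assert (0 <= K * / (p - 1)) by pos. lra. }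
destruct (Hc (eps / 5) ltac:(lra)) as (T2 & HT2 & HC2).
set (T := Rmax T1 T2). assert (HTa : T1 <= T) by apply Rmax_l. assert (HTb : T2 <= T) by apply Rmax_r.
assert (HTail : K * / (p - 1) * Rpower T (1 - p) <= eps / 5).
{ replace (1 - p) with (- (p - 1)) by ring. assert (H := HP1 T HTa).
  assert (0 <= K * / (p - 1)) by pos.
  assert (P := Rpower_pos T (- (p - 1))).
  apply Rle_trans with ((K * / (p - 1) + 1) * (eps / (5 * (K * / (p - 1) + 1)))).
  - apply Rmult_le_compat; lra.
  - right. field. lra. }
set (B := pw ib T).
assert (HB : 1 <= B).
{ unfold B. rewrite pw_pos by lra. apply Rpower_ge_1; lra. }
exists B, (eps / (5 * T)). split; [exact HB|]. split; [apply Rdiv_lt_0_compat; lra|].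
assert (PP := PI_RGT_0).
exists (PI / B). split; [apply Rdiv_lt_0_compat; lra|].
intros s Hs f Kf HKf Hlip Hdec Hclose.
assert (Ps := Rpower_pos s beta).
assert (Hfc : forall y, continuous f y) by (intros; apply lipschitz_continuous with Kf, Hlip).
destruct (proj1 (is_lim_seq_ev _ _) (model_integral f Kf HKf Hlip) (eps / 5 * Rpower s beta)
  ltac:(apply Rmult_lt_0_compat; lra)) as (N0 & HN0).
exists N0. intros N HN. specialize (HN0 N HN). rewrite (model_scaling f s) in HN0 by (try exact Hfc; lra).
set (h := fun w => f (s * pw ib w)) in *.
assert (Hhc : forall y, continuous h y).
{ intros y. apply (continuous_comp_pw (fun u => f (s * u))). intros u.
  apply (continuous_comp (fun u => s * u) f); [|apply Hfc].
  apply (continuous_mult (fun _ => s) (fun u => u)); [apply continuous_const|apply continuous_id]. }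
assert (Hgc : forall y, continuous (fun w => g (pw ib w)) y) by (intros; apply continuous_comp_pw, Hg).
set (E := pw beta (/ s * PI)) in *.
assert (HsB : B * s < PI).
{ destruct Hs as [_ Hs]. apply Rmult_lt_compat_l with (r := B) in Hs; [|lra].
  replace (B * (PI / B)) with PI in Hs by (field; lra). exact Hs. }
assert (HBs : B <= / s * PI).
{ apply Rmult_le_reg_l with s; [lra|]. rewrite <- Rmult_assoc, Rinv_r by lra. lra. }
assert (HTE : T <= E).
{ unfold E. rewrite <- (pw_pw_inv beta T) by lra. apply pw_le; [lra|exact HBs]. }
rewrite (RInt_split h T E Hhc) in HN0.
assert (Hdech : forall w, T <= w <= E -> 0 <= h w <= K * Rpower w (- p)).
{ intros w Hw. assert (Hwp : 0 < pw ib w) by (rewrite pw_pos by lra; apply Rpower_pos).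
  assert (Hle : pw ib w <= / s * PI).
  { rewrite <- (pw_inv_pw beta (/ s * PI)); [apply pw_le; [unfold ib; fold ib; lra|apply Hw]|lra|].
    apply Rmult_le_pos; [left; apply Rinv_0_lt_compat|]; lra. }
  assert (Hr : 0 < s * pw ib w <= PI).
  { split; [apply Rmult_lt_0_compat; lra|].
    apply Rmult_le_compat_l with (r := s) in Hle; [|lra].
    rewrite <- Rmult_assoc, Rinv_r in Hle by lra. lra. }
  destruct (Hdec _ Hr) as [H1 H2]. split; [exact H1|].
  apply decay_transfer; [lra|]. unfold h. apply Rle_trans with (1 := H2). right. f_equal. f_equal.
  field. lra. }
assert (HT' := tail_integral h K T E ltac:(lra) HK Hhc Hdech).
assert (Hmid : Rabs (RInt h 0 T - RInt (fun w => g (pw ib w)) 0 T) <= eps / 5).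
{ replace (RInt h 0 T - RInt (fun w => g (pw ib w)) 0 T) with
    (RInt (fun w => minus (h w) (g (pw ib w))) 0 T).
  2: { rewrite (RInt_minus h (fun w => g (pw ib w))); [reflexivity|apply ex_RInt_cont, Hhc|apply ex_RInt_cont, Hgc]. }
  apply Rle_trans with ((T - 0) * (eps / (5 * T))).
  2: { right. field. lra. }
  apply abs_RInt_le_const; [lra| |].
  - apply (ex_RInt_minus h (fun w => g (pw ib w))); apply ex_RInt_cont; assumption.
  - intros w Hw. change (Rabs (f (s * pw ib w) - g (pw ib w)) <= eps / (5 * T)).
    (* Closeness to the profile is assumed for positive arguments; at 0 it follows by continuity. *)
    destruct (Req_dec w 0) as [->|Hw0].
    + rewrite (pw_0 ib) by lra. apply Rnot_lt_le. intros Hlt.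
      assert (Hcont : continuous (fun y => f (s * y) - g y) 0).
      { apply (continuous_minus (fun y => f (s * y)) g); [|apply Hg].
        apply (continuous_comp (fun u => s * u) f); [|apply Hfc].
        apply (continuous_mult (fun _ => s) (fun u => u)); [apply continuous_const|apply continuous_id]. }
      apply continuity_pt_filterlim in Hcont.
      destruct (Hcont (Rabs (f (s * 0) - g 0) - eps / (5 * T)) ltac:(lra)) as (dl & Hdl & Hd).
      set (y := Rmin (dl / 2) B).
      assert (Hy : 0 < y) by pos.
      assert (Hy1 : y <= dl / 2) by apply Rmin_l. assert (Hy2 : y <= B) by apply Rmin_r.
      specialize (Hd y). simpl in Hd. unfold R_dist in Hd.
      specialize (Hclose y ltac:(lra)).
      assert (Hlt2 : Rabs (f (s * y) - g y - (f (s * 0) - g 0)) < Rabs (f (s * 0) - g 0) - eps / (5 * T)).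
      { apply Hd. split; [split; [exact I|lra]|]. rewrite Rminus_0_r, Rabs_pos_eq; lra. }
      assert (Htri := Rabs_triang (f (s * y) - g y) (- (f (s * y) - g y - (f (s * 0) - g 0)))).
      rewrite Rabs_Ropp in Htri.
      replace (f (s * y) - g y + - (f (s * y) - g y - (f (s * 0) - g 0))) with (f (s * 0) - g 0) in Htri by ring.
      lra.
    + apply Hclose. split; [rewrite pw_pos by lra; apply Rpower_pos|]. apply pw_le; lra. }
assert (HC := HC2 T HTb).
assert (Hall : Rabs (RInt h 0 T + RInt h T E - c) <= 3 * (eps / 5)).
{ apply Rabs_le_between in Hmid. apply Rabs_le_between in HC. apply Rabs_le. lra. }
replace (rs (pw beta) N f - c * Rpower s beta) with
  ((rs (pw beta) N f - Rpower s beta * (RInt h 0 T + RInt h T E)) +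
   Rpower s beta * (RInt h 0 T + RInt h T E - c)) by ring.
apply Rle_trans with (1 := Rabs_triang _ _). rewrite Rabs_mult, (Rabs_pos_eq (Rpower s beta)) by lra.
apply Rmult_le_compat_l with (r := Rpower s beta) in Hall; [|lra].
assert (0 < eps * Rpower s beta) by pos. lra.
Qed.

End Model.

(** * Partial fractions of the cosecant *)

Definition dirichlet (n : nat) (x : R) : R := / 2 + sm (fun k => cos (INR (S k) * x)) n.

Lemma dirichlet_closed n x : 2 * sin (x / 2) * dirichlet n x = sin ((INR n + / 2) * x).
Proof.
induction n as [|n IH].
- unfold dirichlet. simpl. replace ((0 + / 2) * x) with (x / 2) by field. lra.
- unfold dirichlet in *. rewrite sm_S, S_INR.
  replace ((INR n + 1 + / 2) * x) with ((INR n + 1) * x + x / 2) by field.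
  replace ((INR n + / 2) * x) with ((INR n + 1) * x - x / 2) in IH by field.
  rewrite sin_minus in IH. rewrite sin_plus.
  transitivity (2 * sin (x / 2) * (/ 2 + sm (fun k => cos (INR (S k) * x)) n) +
    2 * sin (x / 2) * cos ((INR n + 1) * x)); [ring|]. rewrite IH. ring.
Qed.

Section Cosecant.

Variable b : R.
Hypothesis hb : 0 < b < 1.

(** [P n] is a primitive of cos(b x) times the Dirichlet kernel, [Q n] one of the kernel alone. At
    pi the first is a multiple of the partial fraction sum and the second is pi / 2; their
    difference tends to 0. *)
Let P n x := sin (b * x) / (2 * b) +
  sm (fun k => / 2 * (sin ((b + INR (S k)) * x) / (b + INR (S k)) +
                      sin ((b - INR (S k)) * x) / (b - INR (S k)))) n.
Let Q n x := x / 2 + sm (fun k => sin (INR (S k) * x) / INR (S k)) n.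

Lemma INR_S_ge1 k : 1 <= INR (S k).
Proof. rewrite S_INR. generalize (pos_INR k). lra. Qed.

Lemma is_derive_cos_dirichlet n (x : R) : is_derive (P n) x (cos (b * x) * dirichlet n x).
Proof.
induction n as [|n IH].
- unfold P, dirichlet. simpl. auto_derive; [exact I|]. field. lra.
- set (m := INR (S n)). assert (Hm := INR_S_ge1 n). fold m in Hm.
  apply (is_derive_ext (fun y => P n y + / 2 * (sin ((b + m) * y) / (b + m) + sin ((b - m) * y) / (b - m)))).
  { intros y. unfold P, m. rewrite sm_S. apply Rminus_diag_uniq. ring. }
  replace (cos (b * x) * dirichlet (S n) x) with
    (plus (cos (b * x) * dirichlet n x) (/ 2 * (cos ((b + m) * x) + cos ((b - m) * x)))).
  + apply (is_derive_plus (P n)); [exact IH|]. auto_derive; [exact I|]. field. lra.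
  + change (cos (b * x) * dirichlet n x + / 2 * (cos ((b + m) * x) + cos ((b - m) * x)) =
      cos (b * x) * dirichlet (S n) x).
    unfold dirichlet. rewrite sm_S. fold m.
    rewrite !Rmult_plus_distr_r, Rmult_minus_distr_r, cos_plus, cos_minus. field.
Qed.

Lemma is_derive_dirichlet_primitive n (x : R) : is_derive (Q n) x (dirichlet n x).
Proof.
induction n as [|n IH].
- unfold Q, dirichlet. simpl. auto_derive; [exact I|]. field.
- set (m := INR (S n)). assert (Hm := INR_S_ge1 n). fold m in Hm.
  apply (is_derive_ext (fun y => Q n y + sin (m * y) / m)).
  { intros y. unfold Q, m. rewrite sm_S. apply Rminus_diag_uniq. ring. }
  replace (dirichlet (S n) x) with (plus (dirichlet n x) (cos (m * x))).
  + apply (is_derive_plus (Q n)); [exact IH|]. auto_derive; [exact I|]. field. lra.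
  + change (dirichlet n x + cos (m * x) = dirichlet (S n) x).
    unfold dirichlet, m. rewrite sm_S. ring.
Qed.

Lemma continuous_dirichlet n (x : R) : continuous (dirichlet n) x.
Proof.
induction n as [|n IH].
- apply (continuous_ext (fun _ => / 2)); [intros; unfold dirichlet; simpl; ring|apply continuous_const].
- apply (continuous_ext (fun y => plus (dirichlet n y) (cos (INR (S n) * y)))).
  { intros y. change (dirichlet n y + cos (INR (S n) * y) = dirichlet (S n) y).
    unfold dirichlet. rewrite sm_S. ring. }
  apply (continuous_plus (dirichlet n)); [exact IH|].
  apply (ex_derive_continuous (fun y => cos (INR (S n) * y))). auto_derive. exact I.
Qed.

Let f n x := (cos (b * x) - 1) * dirichlet n x.

Lemma is_derive_difference_primitive n (x : R) : is_derive (fun y => P n y - Q n y) x (f n x).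
Proof.
unfold f. replace ((cos (b * x) - 1) * dirichlet n x) with
  (minus (cos (b * x) * dirichlet n x) (dirichlet n x)) by (unfold minus, plus, opp; simpl; ring).
apply (is_derive_minus (P n) (Q n)); [apply is_derive_cos_dirichlet|apply is_derive_dirichlet_primitive].
Qed.

Lemma continuous_dirichlet_difference n (x : R) : continuous (f n) x.
Proof.
apply (continuous_mult (fun y => cos (b * y) - 1) (dirichlet n)); [|apply continuous_dirichlet].
apply (ex_derive_continuous (fun y => cos (b * y) - 1)). auto_derive. exact I.
Qed.

Lemma RInt_dirichlet_difference n a c : RInt (f n) a c = (P n c - Q n c) - (P n a - Q n a).
Proof.
apply is_RInt_unique. apply (is_RInt_derive (fun y => P n y - Q n y)).
- intros; apply is_derive_difference_primitive.
- intros; apply continuous_dirichlet_difference.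
Qed.

Lemma difference_primitive_0 n : P n 0 - Q n 0 = 0.
Proof.
assert (H1 : P n 0 = 0).
{ unfold P. rewrite (sm_ext _ (fun _ => 0)).
  - rewrite sm_const, Rmult_0_r, sin_0. unfold Rdiv. ring.
  - intros i _. rewrite !Rmult_0_r, sin_0. unfold Rdiv. ring. }
assert (H2 : Q n 0 = 0).
{ unfold Q. rewrite (sm_ext _ (fun _ => 0)).
  - rewrite sm_const. unfold Rdiv. ring.
  - intros i _. rewrite Rmult_0_r, sin_0. unfold Rdiv. ring. }
lra.
Qed.

Lemma sin_cos_INR_PI k : sin (INR k * PI) = 0 /\ cos (INR k * PI) = (-1) ^ k.
Proof.
induction k as [|k [IH1 IH2]].
- simpl. rewrite Rmult_0_l, sin_0, cos_0. auto.
- rewrite S_INR. replace ((INR k + 1) * PI) with (INR k * PI + PI) by ring.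
  rewrite neg_sin, neg_cos, IH1, IH2. simpl. split; ring.
Qed.

(** Partial sums of pi / sin(pi b) = 1 / b + sum over k >= 1 of (-1)^k 2 b / (b^2 - k^2). *)
Definition csc_sum (n : nat) : R :=
  / b + sm (fun k => (-1) ^ S k * (2 * b / (b * b - INR (S k) * INR (S k)))) n.

Lemma difference_primitive_PI n : P n PI - Q n PI = sin (b * PI) / 2 * csc_sum n - PI / 2.
Proof.
assert (H1 : P n PI = sin (b * PI) / 2 * csc_sum n).
{ unfold P, csc_sum. rewrite Rmult_plus_distr_l, <- sm_scal. f_equal; [field; lra|].
  apply sm_ext. intros i _. destruct (sin_cos_INR_PI (S i)) as [Hs Hc].
  rewrite Rmult_plus_distr_r, Rmult_minus_distr_r, sin_plus, sin_minus, Hs, Hc.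
  assert (Hm := INR_S_ge1 i). set (m := INR (S i)) in *. set (w := (-1) ^ S i). field.
  repeat split; try lra; nra. }
assert (H2 : Q n PI = PI / 2).
{ unfold Q. rewrite (sm_ext _ (fun _ => 0)).
  - rewrite sm_const. unfold Rdiv. ring.
  - intros i _. rewrite (proj1 (sin_cos_INR_PI (S i))). unfold Rdiv. ring. }
lra.
Qed.

Lemma two_sin_half_ge x : 0 <= x <= PI -> x / 2 <= 2 * sin (x / 2).
Proof.
intros Hx. assert (H := sin_ge_cubic (x / 2) ltac:(lra)). assert (HP := PI_lt_16_5).
set (u := x / 2) in *. assert (Hu : 0 <= u <= 8 / 5) by (unfold u; lra).
assert (u ^ 3 / 6 <= u / 2); [|lra]. assert (u * u <= 64 / 25) by nra. nra.
Qed.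

(** Subtracting 1 from the cosine tames the origin: 1 - cos(b x) <= x^2 / 2 meets a kernel of
    modulus at most 2 / x. The product is at most x, and pi is below 4. *)
Lemma dirichlet_difference_bounded n x : 0 <= x <= PI -> Rabs (f n x) <= 4.
Proof.
intros Hx. unfold f. destruct (Req_dec x 0) as [->|Hne].
- rewrite Rmult_0_r, cos_0, Rminus_diag, Rmult_0_l, Rabs_R0. lra.
- assert (H1 := dirichlet_closed n x). assert (H2 := two_sin_half_ge x Hx).
  assert (H3 := SIN_bound ((INR n + / 2) * x)). rewrite <- H1 in H3.
  assert (H4 := cos_ge_quadratic (b * x) ltac:(nra)). assert (H5 := COS_bound (b * x)).
  assert (H6 : (b * x) ^ 2 <= x ^ 2) by (apply pow_incr; nra).
  assert (HP := PI_lt_16_5).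
  assert (HD : x / 2 * Rabs (dirichlet n x) <= 1).
  { apply Rle_trans with (2 * sin (x / 2) * Rabs (dirichlet n x)).
    - apply Rmult_le_compat_r; [apply Rabs_pos|exact H2].
    - rewrite <- (Rabs_pos_eq (2 * sin (x / 2))) by lra. rewrite <- Rabs_mult. apply Rabs_le. lra. }
  rewrite Rabs_mult. rewrite Rabs_left1 by lra.
  apply Rle_trans with (x ^ 2 / 2 * Rabs (dirichlet n x)).
  + apply Rmult_le_compat_r; [apply Rabs_pos|]. lra.
  + replace (x ^ 2 / 2 * Rabs (dirichlet n x)) with (x * (x / 2 * Rabs (dirichlet n x))) by field.
    apply Rle_trans with (x * 1); [apply Rmult_le_compat_l; lra|lra].
Qed.

(* Riemann-Lebesgue away from the origin, by parts *)
Lemma RInt_dirichlet_difference_far eta : 0 < eta < PI -> exists C, 0 <= C /\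
  forall n, Rabs (RInt (f n) eta PI) <= C / (INR n + / 2).
Proof.
intros Heta.
set (phi := fun x => (cos (b * x) - 1) / (2 * sin (x / 2))).
set (dphi := fun x => ((- b * sin (b * x)) * (2 * sin (x / 2)) - (cos (b * x) - 1) * cos (x / 2)) /
  (2 * sin (x / 2)) ^ 2).
assert (Hsin : forall x, eta <= x <= PI -> 0 < sin (x / 2)).
{ intros x Hx. generalize (two_sin_half_ge x). lra. }
assert (Hd : forall x, eta <= x <= PI -> is_derive phi x (dphi x)).
{ intros x Hx. specialize (Hsin x Hx). unfold phi, dphi. auto_derive; [unfold Rdiv in Hsin; lra|].
  unfold Rdiv in *. field. lra. }
assert (Hdc : forall x, eta <= x <= PI -> continuous dphi x).
{ intros x Hx. specialize (Hsin x Hx). apply (ex_derive_continuous dphi). unfold dphi. auto_derive.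
  unfold Rdiv in Hsin.
  rewrite ?Rmult_1_r. repeat apply Rmult_integral_contrapositive_currified; lra. }
destruct (continuity_ab_maj (fun x => Rabs (dphi x)) eta PI ltac:(lra)) as (xm & HM & _).
{ intros x Hx. apply continuity_pt_filterlim.
  apply (continuous_comp dphi Rabs); [apply Hdc, Hx|apply continuous_Rabs]. }
set (M := Rabs (dphi xm)) in *.
assert (HM0 : 0 <= M) by pos.
exists (Rabs (phi PI) + Rabs (phi eta) + M * PI).
split.
{ assert (H1 := Rabs_pos (phi PI)). assert (H2 := Rabs_pos (phi eta)). nra. }
intros n. set (w := INR n + / 2). assert (Hw : 0 < w) by (unfold w; generalize (pos_INR n); lra).
assert (HB : is_RInt (fun x => f n x - / w * (dphi x * cos (w * x))) eta PI
  (minus (- / w * (phi PI * cos (w * PI))) (- / w * (phi eta * cos (w * eta))))).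
{ apply (is_RInt_derive (fun x => - / w * (phi x * cos (w * x)))).
  - intros x. rewrite Rmin_left, Rmax_right by lra. intros Hx.
    assert (E : f n x = phi x * sin (w * x)).
    { unfold f, phi, w. rewrite <- dirichlet_closed. field. generalize (Hsin x Hx). lra. }
    rewrite E.
    replace (phi x * sin (w * x) - / w * (dphi x * cos (w * x))) with
      (- / w * (dphi x * cos (w * x) + phi x * (- w * sin (w * x)))) by (field; lra).
    apply (is_derive_scal (fun y => phi y * cos (w * y))).
    apply (is_derive_mult phi (fun y => cos (w * y))); [apply Hd, Hx| |intros; apply Rmult_comm].
    auto_derive; [exact I|ring].
  - intros x. rewrite Rmin_left, Rmax_right by lra. intros Hx.
    apply (continuous_minus (f n)); [apply continuous_dirichlet_difference|].
    apply (continuous_mult (fun _ => / w)); [apply continuous_const|].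
    apply (continuous_mult dphi (fun y => cos (w * y))); [apply Hdc, Hx|].
    apply (ex_derive_continuous (fun y => cos (w * y))). auto_derive. exact I. }
assert (Hex1 : ex_RInt (f n) eta PI).
{ apply (ex_RInt_continuous (V := R_CompleteNormedModule)). intros; apply continuous_dirichlet_difference. }
assert (Hc2 : forall x, eta <= x <= PI -> continuous (fun x => / w * (dphi x * cos (w * x))) x).
{ intros x Hx. apply (continuous_mult (fun _ => / w)); [apply continuous_const|].
  apply (continuous_mult dphi (fun y => cos (w * y))); [apply Hdc, Hx|].
  apply (ex_derive_continuous (fun y => cos (w * y))). auto_derive. exact I. }
assert (Hex2 : ex_RInt (fun x => / w * (dphi x * cos (w * x))) eta PI).
{ apply (ex_RInt_continuous (V := R_CompleteNormedModule)). rewrite Rmin_left, Rmax_right by lra.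
  exact Hc2. }
assert (E : RInt (f n) eta PI - RInt (fun x => / w * (dphi x * cos (w * x))) eta PI =
  (- / w * (phi PI * cos (w * PI))) - (- / w * (phi eta * cos (w * eta)))).
{ rewrite <- (is_RInt_unique _ _ _ _ HB : _ = _ - _). symmetry.
  apply (RInt_minus (f n) (fun x => / w * (dphi x * cos (w * x)))); assumption. }
assert (Hiw : 0 < / w) by pos.
assert (B2 : Rabs (RInt (fun x => / w * (dphi x * cos (w * x))) eta PI) <= (PI - eta) * (/ w * M)).
{ apply abs_RInt_le_const; [lra|exact Hex2|]. intros x Hx.
  rewrite Rabs_mult, (Rabs_pos_eq (/ w)), Rabs_mult by lra. apply Rmult_le_compat_l; [lra|].
  rewrite <- (Rmult_1_r M). apply Rmult_le_compat; try apply Rabs_pos; [apply HM, Hx|].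
  apply Rabs_le, COS_bound. }
assert (Bc : forall y z, Rabs (- / w * (y * cos z)) <= / w * Rabs y).
{ intros y z. rewrite Rabs_mult, Rabs_Ropp, (Rabs_pos_eq (/ w)), Rabs_mult by lra.
  apply Rmult_le_compat_l; [lra|]. rewrite <- (Rmult_1_r (Rabs y)) at 2.
  apply Rmult_le_compat_l; [apply Rabs_pos|]. apply Rabs_le, COS_bound. }
assert (B3 := Bc (phi PI) (w * PI)). assert (B4 := Bc (phi eta) (w * eta)).
apply Rabs_le_between in B2. apply Rabs_le_between in B3. apply Rabs_le_between in B4.
assert (B5 : (PI - eta) * (/ w * M) <= PI * (/ w * M)) by nra.
replace ((Rabs (phi PI) + Rabs (phi eta) + M * PI) / w) with
  (/ w * Rabs (phi PI) + / w * Rabs (phi eta) + PI * (/ w * M)) by (field; lra).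
apply Rabs_le. lra.
Qed.

Lemma csc_sum_lim : is_lim_seq csc_sum (PI / sin (b * PI)).
Proof.
assert (P0 := PI_RGT_0).
assert (Hs : 0 < sin (b * PI)) by (apply sin_gt_0; nra).
assert (H0 : is_lim_seq (fun n => RInt (f n) 0 PI) 0).
{ apply is_lim_seq_ev. intros eps He.
  (* The bound 4 on an interval of length [eps / 8] gives half of [eps]; the other half is left for
     the oscillating part. *)
  set (eta := Rmin 1 (eps / 8)).
  assert (Heta : 0 < eta) by pos.
  assert (He1 : eta <= 1) by apply Rmin_l. assert (He2 : eta <= eps / 8) by apply Rmin_r.
  assert (H1P := PI2_3_2).
  destruct (RInt_dirichlet_difference_far eta ltac:(lra)) as (C & HC & HCn).
  destruct (INR_unbounded (2 * C / eps)) as (n0 & Hn0). exists n0. intros n Hn.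
  rewrite Rminus_0_r.
  assert (E : RInt (f n) 0 PI = RInt (f n) 0 eta + RInt (f n) eta PI) by (rewrite !RInt_dirichlet_difference; apply Rminus_diag_uniq; ring).
  rewrite E. apply Rle_trans with (1 := Rabs_triang _ _).
  assert (A1 : Rabs (RInt (f n) 0 eta) <= (eta - 0) * 4).
  { apply abs_RInt_le_const; [lra| |].
    - apply (ex_RInt_continuous (V := R_CompleteNormedModule)). intros; apply continuous_dirichlet_difference.
    - intros x Hx. apply dirichlet_difference_bounded. lra. }
  assert (Hnn : INR n0 <= INR n) by (apply le_INR, Hn).
  assert (A2 : C / (INR n + / 2) <= eps / 2).
  { assert (0 <= 2 * C / eps) by pos.
    apply Rmult_le_reg_r with (INR n + / 2); [lra|]. unfold Rdiv at 1.
    rewrite Rmult_assoc, Rinv_l, Rmult_1_r by lra.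
    apply Rle_trans with (eps / 2 * (2 * C / eps)); [right; field; lra|].
    apply Rmult_le_compat_l; lra. }
  specialize (HCn n). lra. }
apply (is_lim_seq_ext (fun n => 2 / sin (b * PI) * (RInt (f n) 0 PI + PI / 2))).
- intros n. rewrite RInt_dirichlet_difference, difference_primitive_0, difference_primitive_PI. field. lra.
- replace (PI / sin (b * PI)) with (2 / sin (b * PI) * (0 + PI / 2)) by (field; lra).
  apply is_lim_seq_mult'; [apply is_lim_seq_const|].
  apply is_lim_seq_plus'; [exact H0|apply is_lim_seq_const].
Qed.

End Cosecant.

(** * Constants of the model *)

Lemma is_RInt_Rpower e a b : 0 < a <= b -> e + 1 <> 0 ->
  is_RInt (fun w => Rpower w e) a b ((Rpower b (e + 1) - Rpower a (e + 1)) / (e + 1)).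
Proof.
intros Hab He.
replace ((Rpower b (e + 1) - Rpower a (e + 1)) / (e + 1)) with
  (minus (Rpower b (e + 1) / (e + 1)) (Rpower a (e + 1) / (e + 1)))
  by (unfold minus, plus, opp; simpl; field; exact He).
apply (is_RInt_derive (fun w => Rpower w (e + 1) / (e + 1))).
- intros x. rewrite Rmin_left, Rmax_right by lra. intros Hx. unfold Rpower. auto_derive; [lra|].
  replace (exp (e * ln x)) with (exp ((e + 1) * ln x) * / x).
  + field. lra.
  + replace (e * ln x) with ((e + 1) * ln x + - ln x) by ring.
    rewrite exp_plus, (exp_Ropp (ln x)), exp_ln by lra. reflexivity.
- intros x. rewrite Rmin_left, Rmax_right by lra. intros Hx.
  apply (ex_derive_continuous (fun w => Rpower w e)). unfold Rpower. auto_derive. lra.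
Qed.

Lemma is_RInt_power_sum (c e : nat -> R) n a b : 0 < a <= b -> (forall k, e k + 1 <> 0) ->
  is_RInt (fun w => sm (fun k => c k * Rpower w (e k)) n) a b
    (sm (fun k => c k * ((Rpower b (e k + 1) - Rpower a (e k + 1)) / (e k + 1))) n).
Proof.
intros Hab He. induction n as [|n IH].
- assert (H := is_RInt_const (V := R_NormedModule) a b 0).
  change (is_RInt (fun _ => 0) a b ((b - a) * 0)) in H. rewrite Rmult_0_r in H. exact H.
- apply (is_RInt_plus (fun w => sm (fun k => c k * Rpower w (e k)) n) (fun w => c n * Rpower w (e n)));
    [exact IH|].
  apply (is_RInt_scal (fun w => Rpower w (e n))). apply is_RInt_Rpower; auto.
Qed.

Lemma geometric_remainder x n : 0 <= x ->
  Rabs (/ (1 + x) - sm (fun k => (-1) ^ k * x ^ k) n) <= x ^ n.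
Proof.
intros Hx. assert (E : / (1 + x) - sm (fun k => (-1) ^ k * x ^ k) n = (-1) ^ n * x ^ n / (1 + x)).
{ induction n as [|n IH]; [simpl; field; lra|]. rewrite sm_S.
  replace (/ (1 + x) - (sm (fun k => (-1) ^ k * x ^ k) n + (-1) ^ n * x ^ n)) with
    (/ (1 + x) - sm (fun k => (-1) ^ k * x ^ k) n - (-1) ^ n * x ^ n) by ring.
  rewrite IH. simpl. field. lra. }
rewrite E. unfold Rdiv. rewrite !Rabs_mult, pow_1_abs, Rmult_1_l.
assert (P := pow_le x n Hx). rewrite (Rabs_pos_eq (x ^ n)) by exact P.
assert (H1 : 0 < / (1 + x) <= 1).
{ split; [apply Rinv_0_lt_compat; lra|]. rewrite <- Rinv_1. apply Rinv_le_contravar; lra. }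
rewrite Rabs_pos_eq by lra. nra.
Qed.

(** The geometric series integrated term by term. To the left of 1 it is used with [e = 0] and
    [r = p]; to the right of 1 with [e = r = - p], because 1 / (1 + w^p) = w^(-p) / (1 + w^(-p)). *)
Lemma alternating_expansion (h : R -> R) (e r a b : R) n : 0 < a <= b ->
  (forall k, e + r * INR k + 1 <> 0) -> (forall y, continuous h y) ->
  (forall w, a <= w <= b -> h w = Rpower w e * / (1 + Rpower w r)) ->
  Rabs (RInt h a b - sm (fun k => (-1) ^ k *
    ((Rpower b (e + r * INR k + 1) - Rpower a (e + r * INR k + 1)) / (e + r * INR k + 1))) n) <=
  (Rpower b (e + r * INR n + 1) - Rpower a (e + r * INR n + 1)) / (e + r * INR n + 1).
Proof.
intros Hab He Hc Hh.
assert (I1 := is_RInt_power_sum (fun k => (-1) ^ k) (fun k => e + r * INR k) n a b Hab He).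
assert (I2 : is_RInt h a b (RInt h a b)).
{ apply (RInt_correct h), ex_RInt_cont, Hc. }
assert (I3 := is_RInt_minus _ _ _ _ _ _ I2 I1).
assert (I4 := is_RInt_Rpower (e + r * INR n) a b Hab (He n)).
refine (norm_RInt_le (V := R_NormedModule) _ _ _ _ _ _ (proj2 Hab) _ I3 I4).
intros w Hw. change (Rabs (h w - sm (fun k => (-1) ^ k * Rpower w (e + r * INR k)) n) <=
  Rpower w (e + r * INR n)).
assert (Epow : forall k, Rpower w (e + r * INR k) = Rpower w e * (Rpower w r) ^ k).
{ intros k. rewrite Rpower_plus, <- Rpower_pow, Rpower_mult by apply Rpower_pos. reflexivity. }
rewrite Hh, Epow by exact Hw.
rewrite (sm_ext _ (fun k => Rpower w e * ((-1) ^ k * (Rpower w r) ^ k)))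
  by (intros; rewrite Epow; ring).
rewrite sm_scal, <- Rmult_minus_distr_l, Rabs_mult, (Rabs_pos_eq (Rpower w e))
  by (left; apply Rpower_pos).
apply Rmult_le_compat_l; [left; apply Rpower_pos|]. apply geometric_remainder. left. apply Rpower_pos.
Qed.

Lemma is_lim_seq_Rpower_neg a : 0 < a -> is_lim_seq (fun m => Rpower (INR (S m)) (- a)) 0.
Proof.
intros Ha. apply is_lim_seq_ev. intros eps He.
destruct (Rpower_neg_small a eps Ha He) as (T0 & HT0 & H).
destruct (INR_unbounded T0) as (n0 & Hn0). exists n0. intros n Hn.
rewrite Rminus_0_r, Rabs_pos_eq by (left; apply Rpower_pos). apply H.
assert (INR n0 <= INR (S n)) by (apply le_INR; lia). lra.
Qed.

Section Constants.

Variable beta : R.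
Hypothesis hbeta : 0 < beta < 2.

Let ib := / beta.
Let p := 2 / beta.
Let b := beta / 2.

Definition cauchy_kernel (y : R) : R := / (1 + y ^ 2).

Lemma cauchy_kernel_continuous (y : R) : continuous cauchy_kernel y.
Proof.
apply (ex_derive_continuous cauchy_kernel). unfold cauchy_kernel. auto_derive. nra.
Qed.

(** The constant 8 is the one that the resolvent kernel satisfies through [chord2_ge_eighth];
    [model_kernel_limit] takes a common constant for kernel and profile. *)
Lemma cauchy_kernel_decay y : 0 < y -> 0 <= cauchy_kernel y <= 8 * (/ y) ^ 2.
Proof.
intros Hy. unfold cauchy_kernel. assert (0 < y ^ 2) by pos. split.
- left. apply Rinv_0_lt_compat. lra.
- rewrite pow_inv. assert (/ (1 + y ^ 2) <= / y ^ 2) by (apply Rinv_le_contravar; lra).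
  assert (0 < / y ^ 2) by pos. lra.
Qed.

Let h w := cauchy_kernel (pw ib w).

Lemma cauchy_profile_continuous (w : R) : continuous h w.
Proof. apply continuous_comp_pw; [exact hbeta|]. apply cauchy_kernel_continuous. Qed.

Lemma cauchy_profile_pos w : 0 < w -> h w = / (1 + Rpower w p).
Proof.
intros Hw. unfold h, cauchy_kernel. rewrite pw_pos by exact Hw.
rewrite <- Rpower_pow, Rpower_mult by apply Rpower_pos. do 3 f_equal.
unfold ib, p. simpl. field. lra.
Qed.

Lemma cauchy_profile_bound w : 0 <= h w <= 1.
Proof.
unfold h, cauchy_kernel. assert (H := pow2_ge_0 (pw ib w)). split.
- left. apply Rinv_0_lt_compat. lra.
- rewrite <- Rinv_1. apply Rinv_le_contravar; lra.
Qed.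

(** Term by term integrals of the two geometric series, over [0, 1] and over [1, infinity). *)
Let S_ n := sm (fun k => (-1) ^ k * (/ (p * INR k + 1))) n +
  sm (fun k => (-1) ^ k * (/ (p * INR (S k) - 1))) n.

(** The integral over [[/ T, T]] is expanded on either side of 1. The remainder bounds do not depend
    on [T], so [T] goes to infinity with [n] fixed. *)
Lemma partial_fraction_error c n : improper_value h c ->
  Rabs (c - S_ n) <= / (p * INR n + 1) + / (p * INR (S n) - 1).
Proof.
intros Hc. assert (Hp := p_gt1 beta hbeta). change (1 < p) in Hp.
set (T := fun m => INR (S m)).
assert (HT1 : forall m, 1 <= T m) by apply INR_S_ge1.
assert (Hone : forall x, Rpower 1 x = 1) by (intros; unfold Rpower; rewrite ln_1, Rmult_0_r; apply exp_0).
assert (Hpk : forall k, 0 < 0 + p * INR k + 1).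
{ intros k. assert (0 <= p * INR k) by pos. lra. }
assert (Hpk2 : forall k, - p + - p * INR k + 1 < 0).
{ intros k. assert (0 <= p * INR k) by pos. lra. }
set (A := fun m => sm (fun k => (-1) ^ k *
  ((Rpower 1 (0 + p * INR k + 1) - Rpower (/ T m) (0 + p * INR k + 1)) / (0 + p * INR k + 1))) n).
set (B := fun m => sm (fun k => (-1) ^ k *
  ((Rpower (T m) (- p + - p * INR k + 1) - Rpower 1 (- p + - p * INR k + 1)) / (- p + - p * INR k + 1))) n).
assert (Hbd : forall m, Rabs (RInt h 0 (T m) - RInt h 0 (/ T m) - (A m + B m)) <=
  / (p * INR n + 1) + / (p * INR (S n) - 1)).
{ intros m. assert (Ht := HT1 m).
  assert (Hit : 0 < / T m <= 1).
  { split; [apply Rinv_0_lt_compat; lra|]. rewrite <- Rinv_1. apply Rinv_le_contravar; lra. }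
  assert (E1 := alternating_expansion h 0 p (/ T m) 1 n ltac:(lra)
    (fun k => Rgt_not_eq _ _ (Hpk k)) cauchy_profile_continuous).
  assert (E2 := alternating_expansion h (- p) (- p) 1 (T m) n ltac:(lra)
    (fun k => Rlt_not_eq _ _ (Hpk2 k)) cauchy_profile_continuous).
  fold (A m) in E1. fold (B m) in E2.
  assert (E1' : Rabs (RInt h (/ T m) 1 - A m) <= / (p * INR n + 1)).
  { apply Rle_trans with (1 := E1 ltac:(intros w Hw; rewrite cauchy_profile_pos, Rpower_O by lra; ring)).
    rewrite Hone. specialize (Hpk n).
    assert (P := Rpower_pos (/ T m) (0 + p * INR n + 1)).
    replace (/ (p * INR n + 1)) with (1 / (0 + p * INR n + 1)) by (field; lra).
    apply Rmult_le_compat_r; [left; apply Rinv_0_lt_compat; lra|lra]. }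
  assert (E2' : Rabs (RInt h 1 (T m) - B m) <= / (p * INR (S n) - 1)).
  { apply Rle_trans with (1 := E2 ltac:(intros w Hw; rewrite cauchy_profile_pos, Rpower_Ropp by lra;
      assert (P := Rpower_pos w p); field; lra)).
    rewrite Hone, S_INR. specialize (Hpk2 n).
    assert (P := Rpower_pos (T m) (- p + - p * INR n + 1)).
    replace ((Rpower (T m) (- p + - p * INR n + 1) - 1) / (- p + - p * INR n + 1)) with
      ((1 - Rpower (T m) (- p + - p * INR n + 1)) * / (p * (INR n + 1) - 1)) by (field; lra).
    assert (0 < / (p * (INR n + 1) - 1)) by pos. nra. }
  rewrite (RInt_split h (/ T m) (T m) cauchy_profile_continuous).
  assert (E3 : RInt h (/ T m) (T m) = RInt h (/ T m) 1 + RInt h 1 (T m)).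
  { symmetry. apply (RInt_Chasles h); apply ex_RInt_cont, cauchy_profile_continuous. }
  rewrite E3.
  replace (RInt h 0 (/ T m) + (RInt h (/ T m) 1 + RInt h 1 (T m)) - RInt h 0 (/ T m) - (A m + B m))
    with ((RInt h (/ T m) 1 - A m) + (RInt h 1 (T m) - B m)) by ring.
  apply Rle_trans with (1 := Rabs_triang _ _). lra. }
assert (L1 : is_lim_seq (fun m => RInt h 0 (T m)) c).
{ apply is_lim_seq_ev. intros eps He. destruct (Hc eps He) as (T0 & HT0 & H).
  destruct (INR_unbounded T0) as (n0 & Hn0). exists n0. intros m Hm. apply H. unfold T.
  assert (INR n0 <= INR (S m)) by (apply le_INR; lia). lra. }
assert (L2 : is_lim_seq (fun m => RInt h 0 (/ T m)) 0).
{ apply (is_lim_seq_le_le (fun _ => 0) _ (fun m => Rpower (INR (S m)) (- (1)))).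
  - intros m. specialize (HT1 m). assert (Hi : 0 < / T m) by pos. split.
    + apply RInt_ge_0; [lra|apply ex_RInt_cont, cauchy_profile_continuous|]. intros; apply cauchy_profile_bound.
    + rewrite Rpower_Ropp, Rpower_1 by (fold (T m); lra). fold (T m).
      apply Rle_trans with (1 := Rle_abs _).
      replace (/ T m) with ((/ T m - 0) * 1) at 2 by ring.
      apply abs_RInt_le_const; [lra|apply ex_RInt_cont, cauchy_profile_continuous|].
      intros w _. rewrite Rabs_pos_eq; apply cauchy_profile_bound.
  - apply is_lim_seq_const.
  - apply is_lim_seq_Rpower_neg. lra. }
assert (L3 : is_lim_seq A (sm (fun k => (-1) ^ k * / (p * INR k + 1)) n)).
{ apply (is_lim_seq_sm (fun m k => (-1) ^ k * ((Rpower 1 (0 + p * INR k + 1) -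
    Rpower (/ T m) (0 + p * INR k + 1)) / (0 + p * INR k + 1))) (fun k => (-1) ^ k * / (p * INR k + 1))).
  intros k _. specialize (Hpk k).
  apply is_lim_seq_mult'; [apply is_lim_seq_const|].
  replace (/ (p * INR k + 1)) with ((1 - 0) * / (0 + p * INR k + 1)) by (field; lra).
  apply is_lim_seq_mult'; [|apply is_lim_seq_const].
  apply is_lim_seq_minus'; [rewrite Hone; apply is_lim_seq_const|].
  apply (is_lim_seq_ext (fun m => Rpower (INR (S m)) (- (0 + p * INR k + 1)))).
  - intros m. fold (T m). unfold Rpower. rewrite ln_Rinv by (specialize (HT1 m); lra). f_equal. ring.
  - apply is_lim_seq_Rpower_neg, Hpk. }
assert (L4 : is_lim_seq B (sm (fun k => (-1) ^ k * / (p * INR (S k) - 1)) n)).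
{ apply (is_lim_seq_sm (fun m k => (-1) ^ k * ((Rpower (T m) (- p + - p * INR k + 1) -
    Rpower 1 (- p + - p * INR k + 1)) / (- p + - p * INR k + 1)))
    (fun k => (-1) ^ k * / (p * INR (S k) - 1))).
  intros k _. specialize (Hpk2 k). rewrite S_INR.
  apply is_lim_seq_mult'; [apply is_lim_seq_const|].
  replace (/ (p * (INR k + 1) - 1)) with ((0 - 1) * / (- p + - p * INR k + 1)) by (field; lra).
  apply is_lim_seq_mult'; [|apply is_lim_seq_const].
  apply is_lim_seq_minus'; [|rewrite Hone; apply is_lim_seq_const].
  apply (is_lim_seq_ext (fun m => Rpower (INR (S m)) (- (- (- p + - p * INR k + 1))))).
  - intros m. rewrite Ropp_involutive. reflexivity.
  - apply is_lim_seq_Rpower_neg. lra. }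
assert (L5 : is_lim_seq (fun m => Rabs (RInt h 0 (T m) - RInt h 0 (/ T m) - (A m + B m)))
  (Rabs (c - 0 - S_ n))).
{ apply (is_lim_seq_abs _ (c - 0 - S_ n)). apply is_lim_seq_minus'; [apply is_lim_seq_minus'; assumption|].
  apply is_lim_seq_plus'; assumption. }
rewrite Rminus_0_r in L5.
exact (is_lim_seq_le _ _ _ _ Hbd L5 (is_lim_seq_const _)).
Qed.

(** With p = 1 / b the terms are b / (k + b) and b / (k + 1 - b). The cosecant sum pairs b + k with
    b - k, so the two sums are out of step by one and a single term remains. *)
Lemma partial_fractions_csc n : S_ n = b * (csc_sum b n - (-1) ^ n / (b + INR n)).
Proof.
assert (Hb : 0 < b < 1) by (unfold b; lra).
unfold S_, csc_sum. replace p with (/ b) by (unfold b, p; field; lra).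
induction n as [|n IH].
- simpl. field. lra.
- rewrite !sm_S.
  replace (sm (fun k => (-1) ^ k * / (/ b * INR k + 1)) n + (-1) ^ n * / (/ b * INR n + 1) +
    (sm (fun k => (-1) ^ k * / (/ b * INR (S k) - 1)) n + (-1) ^ n * / (/ b * INR (S n) - 1))) with
    ((sm (fun k => (-1) ^ k * / (/ b * INR k + 1)) n + sm (fun k => (-1) ^ k * / (/ b * INR (S k) - 1)) n) +
     ((-1) ^ n * / (/ b * INR n + 1) + (-1) ^ n * / (/ b * INR (S n) - 1))) by ring.
  rewrite IH. rewrite S_INR. simpl ((-1) ^ S n). assert (P := pos_INR n).
  set (s := sm (fun k => (-1) ^ S k * (2 * b / (b * b - INR (S k) * INR (S k)))) n).
  set (m := INR n) in *. set (u := (-1) ^ n). field.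
  repeat split; try lra; nra.
Qed.

Lemma cauchy_constant c : improper_value h c -> c = b * (PI / sin (b * PI)).
Proof.
intros Hc. assert (Hb : 0 < b < 1) by (unfold b; lra).
assert (Hp := p_gt1 beta hbeta). change (1 < p) in Hp.
assert (Hinv : forall u : nat -> R, (forall n, INR n / 1 <= u n) -> is_lim_seq (fun n => / u n) 0).
{ intros u Hu. replace (Finite 0) with (Rbar_inv p_infty) by reflexivity.
  apply is_lim_seq_inv; [|discriminate].
  apply (is_lim_seq_le_p_loc INR); [|apply is_lim_seq_INR].
  exists 0%nat. intros n _. specialize (Hu n). lra. }
assert (L1 : is_lim_seq S_ (b * (PI / sin (b * PI) - 0))).
{ apply (is_lim_seq_ext (fun n => b * (csc_sum b n - (-1) ^ n * / (b + INR n)))).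
  { intros n. rewrite partial_fractions_csc. reflexivity. }
  apply is_lim_seq_mult'; [apply is_lim_seq_const|].
  apply is_lim_seq_minus'; [apply csc_sum_lim, Hb|].
  apply is_lim_seq_abs_0.
  apply (is_lim_seq_ext (fun n => / (b + INR n))).
  - intros n. assert (P := pos_INR n). rewrite Rabs_mult, pow_1_abs, Rmult_1_l, Rabs_pos_eq; [reflexivity|].
    left. apply Rinv_0_lt_compat. lra.
  - apply Hinv. intros n. lra. }
assert (L2 : is_lim_seq (fun n => Rabs (c - S_ n)) 0).
{ apply (is_lim_seq_le_le (fun _ => 0) _ (fun n => / (p * INR n + 1) + / (p * INR (S n) - 1))).
  - intros n. split; [apply Rabs_pos|apply partial_fraction_error, Hc].
  - apply is_lim_seq_const.
  - replace (Finite 0) with (Finite (0 + 0)) by (f_equal; ring). apply is_lim_seq_plus'; apply Hinv; intros n.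
    + assert (P := pos_INR n). nra.
    + assert (P := pos_INR n). rewrite S_INR. nra. }
apply is_lim_seq_abs_0 in L2.
assert (L3 : is_lim_seq (fun n => c - S_ n) (c - b * (PI / sin (b * PI) - 0))).
{ apply is_lim_seq_minus'; [apply is_lim_seq_const|exact L1]. }
assert (E := is_lim_seq_unique _ _ L2). rewrite (is_lim_seq_unique _ _ L3) in E.
injection E. lra.
Qed.

Lemma stieltjes_model eps : 0 < eps -> near0 (fun s => eventually_nat (fun N =>
  Rabs (rs (pw beta) N (fun x => s ^ 2 / (s ^ 2 + chord2 x)) -
    b * (PI / sin (b * PI)) * Rpower s beta) <= eps * Rpower s beta)).
Proof.
intros He.
destruct (improper_exists beta hbeta h 8 ltac:(lra) cauchy_profile_continuous) as (c & Hc & _).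
{ intros w Hw. split; [apply cauchy_profile_bound|]. apply decay_transfer; try assumption.
  apply cauchy_kernel_decay. rewrite pw_pos by exact Hw. apply Rpower_pos. }
rewrite <- (cauchy_constant c Hc).
destruct (model_kernel_limit beta hbeta cauchy_kernel 8 c eps He ltac:(lra) cauchy_kernel_continuous
  cauchy_kernel_decay Hc) as (B & d & HB & Hd & Hnear).
assert (HB4 : 1 <= B ^ 4) by (apply pow_R1_Rle; exact HB).
refine (near0_imp _ _ _ (near0_and _ _ Hnear (near0_and _ _ (near0_lt 1 Rlt_0_1)
  (near0_and _ _ (near0_lt (12 * d / B ^ 4) ltac:(apply Rdiv_lt_0_compat; lra))
     (near0_lt (/ B) ltac:(apply Rinv_0_lt_compat; lra)))))).
intros s Hs (Hlim & Hs1 & Hs2 & Hs3).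
assert (Hss : 0 < s ^ 2) by pos.
apply (Hlim _ (2 / s ^ 2)).
- apply Rdiv_le_0_compat; lra.
- intros x y. assert (C1 := chord2_ge0 x). assert (C2 := chord2_ge0 y).
  replace (s ^ 2 / (s ^ 2 + chord2 x) - s ^ 2 / (s ^ 2 + chord2 y)) with
    (2 * (cos x - cos y) * (s ^ 2 * (/ (s ^ 2 + chord2 x) * / (s ^ 2 + chord2 y)))).
  2: { unfold chord2 in *. field. split; lra. }
  assert (I1 : 0 < / (s ^ 2 + chord2 x) <= / s ^ 2).
  { split; [apply Rinv_0_lt_compat; lra|apply Rinv_le_contravar; lra]. }
  assert (I2 : 0 < / (s ^ 2 + chord2 y) <= / s ^ 2).
  { split; [apply Rinv_0_lt_compat; lra|apply Rinv_le_contravar; lra]. }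
  assert (I3 : 0 <= s ^ 2 * (/ (s ^ 2 + chord2 x) * / (s ^ 2 + chord2 y)) <= / s ^ 2).
  { split; [apply Rmult_le_pos; [lra|apply Rmult_le_pos; lra]|].
    apply Rle_trans with (s ^ 2 * (/ s ^ 2 * / s ^ 2)).
    - apply Rmult_le_compat_l; [lra|]. apply Rmult_le_compat; lra.
    - right. field. lra. }
  rewrite Rabs_mult, Rabs_mult, (Rabs_pos_eq 2), (Rabs_pos_eq (s ^ 2 * _)) by lra.
  replace (2 / s ^ 2 * Rabs (x - y)) with (2 * Rabs (x - y) * / s ^ 2) by (unfold Rdiv; ring).
  apply Rmult_le_compat; [apply Rmult_le_pos; [lra|apply Rabs_pos]|lra| |lra].
  apply Rmult_le_compat_l; [lra|apply cos_lipschitz].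
- intros x Hx. assert (C2 := chord2_ge_eighth x ltac:(lra)).
  assert (Hx2 : 0 < x ^ 2) by pos.
  split; [apply Rdiv_le_0_compat; lra|].
  replace (8 * (s / x) ^ 2) with (s ^ 2 * / (x ^ 2 / 8)) by (field; lra).
  apply Rmult_le_compat_l; [lra|]. apply Rinv_le_contravar; lra.
- intros y Hy. unfold cauchy_kernel.
  assert (Hsy : 0 <= s * y) by nra.
  assert (C1 := chord2_le (s * y) Hsy). assert (C2 := chord2_ge (s * y) Hsy).
  assert (C0 := chord2_ge0 (s * y)).
  set (q := chord2 (s * y) / s ^ 2).
  assert (Eq : chord2 (s * y) = s ^ 2 * q) by (unfold q; field; lra).
  rewrite Eq in *.
  assert (Q0 : 0 <= q) by nra.
  assert (Q1 : q <= y ^ 2) by nra.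
  assert (Q2 : y ^ 2 - s ^ 2 * y ^ 4 / 12 <= q) by nra.
  replace (s ^ 2 / (s ^ 2 + s ^ 2 * q)) with (/ (1 + q)) by (field; split; nra).
  replace (/ (1 + q) - / (1 + y ^ 2)) with ((y ^ 2 - q) * (/ (1 + q) * / (1 + y ^ 2)))
    by (field; split; nra).
  assert (I1 : 0 < / (1 + q) <= 1).
  { split; [apply Rinv_0_lt_compat; lra|]. rewrite <- Rinv_1. apply Rinv_le_contravar; lra. }
  assert (I2 : 0 < / (1 + y ^ 2) <= 1).
  { split; [apply Rinv_0_lt_compat; lra|]. rewrite <- Rinv_1. apply Rinv_le_contravar; lra. }
  assert (I3 : 0 <= / (1 + q) * / (1 + y ^ 2) <= 1 * 1) by nra.
  rewrite Rabs_pos_eq by (apply Rmult_le_pos; lra).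
  apply Rle_trans with ((s ^ 2 * y ^ 4 / 12) * (1 * 1)).
  + apply Rmult_le_compat; lra.
  + assert (Y4 : y ^ 4 <= B ^ 4) by (apply pow_incr; lra).
    assert (Hs4 : s * B ^ 4 <= 12 * d).
    { apply Rmult_lt_compat_r with (r := B ^ 4) in Hs2; [|lra].
      replace (12 * d / B ^ 4 * B ^ 4) with (12 * d) in Hs2 by (field; lra). lra. }
    assert (s ^ 2 * y ^ 4 <= s * B ^ 4) by nra.
    lra.
Qed.

(** The limit of [fejer n (y / n) / n ^ 2]: the square of sin(y / 2) / (y / 2), with its value 1 at
    the origin. *)
Definition fejer_profile (y : R) : R := if Req_dec_T y 0 then 1 else chord2 y / y ^ 2.

Lemma chord2_even y : chord2 (- y) = chord2 y.
Proof. unfold chord2. rewrite cos_neg. reflexivity. Qed.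

Lemma fejer_profile_near y : Rabs (fejer_profile y - 1) <= y ^ 2 / 12.
Proof.
unfold fejer_profile. destruct (Req_dec_T y 0) as [->|Hy].
- rewrite Rminus_diag, Rabs_R0. lra.
- assert (H : forall z, 0 < z -> Rabs (chord2 z / z ^ 2 - 1) <= z ^ 2 / 12).
  { intros z Hz. assert (Hz2 : 0 < z ^ 2) by nra.
    assert (C1 := chord2_le z (Rlt_le _ _ Hz)). assert (C2 := chord2_ge z (Rlt_le _ _ Hz)).
    assert (D1 : chord2 z / z ^ 2 <= 1).
    { apply Rmult_le_reg_r with (z ^ 2); [exact Hz2|]. unfold Rdiv. rewrite Rmult_assoc, Rinv_l; lra. }
    assert (D2 : 1 - z ^ 2 / 12 <= chord2 z / z ^ 2).
    { apply Rmult_le_reg_r with (z ^ 2); [exact Hz2|]. unfold Rdiv at 2. rewrite Rmult_assoc, Rinv_l; lra. }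
    apply Rabs_le. lra. }
  destruct (Rlt_dec 0 y) as [Hp|Hn]; [apply H, Hp|].
  rewrite <- chord2_even. replace (y ^ 2) with ((- y) ^ 2) by ring. apply H. lra.
Qed.

Lemma fejer_profile_continuous (y : R) : continuous fejer_profile y.
Proof.
destruct (Req_dec_T y 0) as [->|Hy].
- apply continuity_pt_filterlim. intros eps He. exists (Rmin 1 eps).
  split; [apply Rmin_glb_lt; lra|]. intros z [_ Hz]. simpl in *. unfold R_dist in *.
  rewrite Rminus_0_r in Hz.
  assert (H1 := Rmin_l 1 eps). assert (H2 := Rmin_r 1 eps).
  replace (fejer_profile 0) with 1 by (unfold fejer_profile; destruct (Req_dec_T 0 0); [reflexivity|lra]).
  apply Rle_lt_trans with (1 := fejer_profile_near z).
  rewrite <- (pow2_abs z). assert (P := Rabs_pos z). nra.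
- apply (continuous_ext_loc fejer_profile (fun z => chord2 z / z ^ 2) y).
  + exists (mkposreal (Rabs y) (Rabs_pos_lt y Hy)). intros z Hz. unfold fejer_profile.
    destruct (Req_dec_T z 0) as [->|Hz0]; [|reflexivity].
    exfalso. simpl in Hz. unfold ball in Hz. simpl in Hz. unfold AbsRing_ball, abs, minus, plus, opp in Hz.
    simpl in Hz. rewrite Rplus_0_l, Rabs_Ropp in Hz. lra.
  + apply (ex_derive_continuous (fun z => chord2 z / z ^ 2)). unfold chord2. auto_derive.
    rewrite Rmult_1_r. apply Rmult_integral_contrapositive_currified; exact Hy.
Qed.

Lemma fejer_profile_decay y : 0 < y -> 0 <= fejer_profile y <= 32 * (/ y) ^ 2.
Proof.
intros Hy. unfold fejer_profile. destruct (Req_dec_T y 0) as [E|_]; [lra|].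
assert (Hy2 : 0 < y ^ 2) by pos. assert (C := chord2_ge0 y). split.
- apply Rdiv_le_0_compat; lra.
- rewrite pow_inv. apply Rmult_le_compat_r; [left; apply Rinv_0_lt_compat, Hy2|].
  unfold chord2. generalize (COS_bound y). lra.
Qed.

Lemma fejer_profile_pos y : 0 <= y <= 1 -> / 2 <= fejer_profile y.
Proof.
intros Hy. assert (H := fejer_profile_near y). apply Rabs_le_between in H. nra.
Qed.

(** Positivity of [c1] comes from the profile being at least 1/2 on [0, 1]. Its value is identified
    in [fejer_model_constant]. *)
Lemma fejer_model : exists c1, 0 < c1 /\ forall eps, 0 < eps -> eventually_nat (fun n =>
  eventually_nat (fun N => Rabs (rs (pw beta) N (fejer n) - c1 * Rpower (INR n) (2 - beta)) <=
    eps * Rpower (INR n) (2 - beta))).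
Proof.
set (hf := fun w => fejer_profile (pw ib w)).
assert (Hhc : forall w, continuous hf w).
{ intros w. apply continuous_comp_pw; [exact hbeta|]. apply fejer_profile_continuous. }
destruct (improper_exists beta hbeta hf 32 ltac:(lra) Hhc) as (c & Hc & Hc1).
{ intros w Hw. assert (P : 0 < pw ib w) by (rewrite pw_pos by exact Hw; apply Rpower_pos).
  split; [apply fejer_profile_decay, P|]. apply decay_transfer; try assumption.
  apply fejer_profile_decay, P. }
exists c. split.
{ apply Rlt_le_trans with (2 := Hc1).
  apply RInt_gt_0; [lra| |intros; apply Hhc].
  intros w Hw. apply Rlt_le_trans with (/ 2); [lra|]. apply fejer_profile_pos.
  split; [apply pw_ge0|]. apply Rle_trans with (pw ib 1).
  - apply pw_le; [left; apply ib_pos; exact hbeta|lra].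
  - rewrite pw_pos by lra. unfold Rpower. rewrite ln_1, Rmult_0_r, exp_0. lra. }
intros eps He.
destruct (model_kernel_limit beta hbeta fejer_profile 32 c eps He ltac:(lra) fejer_profile_continuous
  fejer_profile_decay Hc) as (B & d & HB & Hd & Hnear).
set (d1 := Rmin 1 d). assert (Hd1 : 0 < d1) by pos.
assert (Hd1a : d1 <= 1) by apply Rmin_l. assert (Hd1b : d1 <= d) by apply Rmin_r.
assert (Hnear2 : near0 (fun s => s < d1 / B ^ 2)).
{ apply near0_lt. apply Rdiv_lt_0_compat; [lra|apply pow_lt; lra]. }
destruct (near0_seq _ (near0_and _ _ Hnear (near0_and _ _ (near0_lt 1 Rlt_0_1) Hnear2))) as (n0 & Hn0).
exists n0. intros n Hn. destruct (Hn0 n Hn) as (Hnpos & Hlim & Hs1 & Hs2).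
assert (Hnp : 0 < INR n) by (apply lt_0_INR, Hnpos).
assert (Hn2 : 0 < INR n ^ 2) by pos.
set (s := / INR n) in *. assert (Hs : 0 < s) by pos.
assert (HB2 : 1 <= B ^ 2) by nra.
assert (HsB : s * B ^ 2 <= d1).
{ apply Rmult_lt_compat_r with (r := B ^ 2) in Hs2; [|lra].
  replace (d1 / B ^ 2 * B ^ 2) with d1 in Hs2 by (field; lra). lra. }
assert (Hmain : eventually_nat (fun N => Rabs (rs (pw beta) N (fun x => / INR n ^ 2 * fejer n x) -
  c * Rpower s beta) <= eps * Rpower s beta)).
{ apply (Hlim _ (INR n)).
  - lra.
  - intros x y. rewrite <- Rmult_minus_distr_l, Rabs_mult, Rabs_pos_eq
      by (left; apply Rinv_0_lt_compat, Hn2).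
    apply Rle_trans with (/ INR n ^ 2 * (INR n ^ 3 * Rabs (x - y))).
    + apply Rmult_le_compat_l; [left; apply Rinv_0_lt_compat, Hn2|apply fejer_lipschitz].
    + right. field. lra.
  - intros x Hx. split.
    + apply Rmult_le_pos; [left; apply Rinv_0_lt_compat, Hn2|apply fejer_ge0; lra].
    + apply Rle_trans with (/ INR n ^ 2 * (32 / x ^ 2)).
      * apply Rmult_le_compat_l; [left; apply Rinv_0_lt_compat, Hn2|apply fejer_decay, Hx].
      * right. unfold s. field. split; lra.
  - intros y Hy.
    assert (Hsy : 0 < s * y) by pos.
    assert (C1 := chord2_le (s * y) (Rlt_le _ _ Hsy)). assert (C2 := chord2_ge (s * y) (Rlt_le _ _ Hsy)).
    assert (Ef := chord2_fejer n (s * y)).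
    replace (INR n * (s * y)) with y in Ef by (unfold s; field; lra).
    fold (chord2 y) in Ef.
    unfold fejer_profile. destruct (Req_dec_T y 0) as [E|_]; [lra|].
    assert (Y2 : 0 < y ^ 2) by pos.
    assert (YB : y ^ 2 <= B ^ 2) by nra.
    assert (Hsq : s * s * y ^ 2 <= d1) by nra.
    (* At n = 1 / s the rescaled kernel is exactly its profile times [/ q], and [q] is close to 1
       when [s * y] is small. *)
    set (q := chord2 (s * y) / (s * y) ^ 2).
    assert (Hsy2 : 0 < (s * y) ^ 2) by pos.
    assert (Eq : chord2 (s * y) = (s * y) ^ 2 * q) by (unfold q; field; lra).
    rewrite Eq in *.
    assert (Q1 : q <= 1) by nra.
    assert (Q2 : 1 - (s * y) ^ 2 / 12 <= q) by nra.
    replace ((s * y) ^ 2) with (s * s * y ^ 2) in Q2 by ring.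
    assert (EF : / INR n ^ 2 * fejer n (s * y) = chord2 y / y ^ 2 * / q).
    { rewrite <- Ef. unfold s. field. repeat split; lra. }
    rewrite EF.
    replace (chord2 y / y ^ 2 * / q - chord2 y / y ^ 2) with (chord2 y / y ^ 2 * ((1 - q) * / q))
      by (field; split; lra).
    assert (F0 : 0 <= chord2 y / y ^ 2 <= 1).
    { split; [apply Rdiv_le_0_compat; [apply chord2_ge0|lra]|].
      apply Rmult_le_reg_r with (y ^ 2); [exact Y2|]. unfold Rdiv. rewrite Rmult_assoc, Rinv_l by lra.
      generalize (chord2_le y ltac:(lra)). lra. }
    assert (Hiq : 0 < / q <= 2).
    { split; [apply Rinv_0_lt_compat; lra|]. rewrite <- (Rinv_inv 2). apply Rinv_le_contravar; lra. }
    assert (F1 : 0 <= (1 - q) * / q <= (d1 / 12) * 2).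
    { split; [apply Rmult_le_pos; lra|apply Rmult_le_compat; lra]. }
    rewrite Rabs_pos_eq by (apply Rmult_le_pos; lra).
    apply Rle_trans with (1 * (d1 / 12 * 2)); [apply Rmult_le_compat; lra|lra]. }
refine (ev_imp _ _ _ Hmain). intros N HN.
assert (EP : Rpower (INR n) (2 - beta) = INR n ^ 2 * Rpower s beta).
{ unfold Rminus. rewrite Rpower_plus, Rpower_Ropp. rewrite <- (Rpower_pow 2) by exact Hnp. simpl INR.
  unfold s. f_equal. unfold Rpower. rewrite ln_Rinv, <- exp_Ropp by exact Hnp. f_equal. ring. }
rewrite EP. rewrite rs_scal in HN.
replace (rs (pw beta) N (fejer n) - c * (INR n ^ 2 * Rpower s beta)) with
  (INR n ^ 2 * (/ INR n ^ 2 * rs (pw beta) N (fejer n) - c * Rpower s beta)) by (field; lra).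
rewrite Rabs_mult, (Rabs_pos_eq (INR n ^ 2)) by lra.
replace (eps * (INR n ^ 2 * Rpower s beta)) with (INR n ^ 2 * (eps * Rpower s beta)) by ring.
apply Rmult_le_compat_l; [lra|exact HN].
Qed.

End Constants.

(** * Equivalence of the two asymptotics *)

Lemma lim_close u (l a e : R) : is_lim_seq u l ->
  eventually_nat (fun N => Rabs (u N - a) <= e) -> Rabs (l - a) <= e.
Proof.
intros Hl (N0 & HN). apply le_epsilon. intros d Hd.
destruct (proj1 (is_lim_seq_ev _ _) Hl d Hd) as (N1 & HN1).
assert (A := HN (N0 + N1)%nat ltac:(lia)). assert (B := HN1 (N0 + N1)%nat ltac:(lia)).
apply Rabs_le_between in A. apply Rabs_le_between in B. apply Rabs_le. lra.
Qed.

Lemma locally_uniform_one : locally_uniform_sv (fun _ => 1).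
Proof.
intros eps B He HB. exists 1. split; [lra|]. intros x lam _ _.
replace (1 / 1 - 1) with 0 by field. rewrite Rabs_R0. exact He.
Qed.

Lemma potter_one : potter_bounds (fun _ => 1).
Proof.
intros a Ha. exists 1, 1. split; [lra|]. split; [lra|]. intros x y Hx Hxy.
assert (1 <= Rpower (y / x) a); [|lra].
apply Rpower_ge_1; [|lra]. apply Rmult_le_reg_r with x; [lra|].
unfold Rdiv. rewrite Rmult_assoc, Rinv_l; lra.
Qed.

(** The reciprocal of [Cgamma gamma], and the factor of n^gamma in the variance of the model x^(2 -
    gamma). *)
Definition model_constant (gamma : R) : R := PI * (2 - gamma) / (Gamma (1 + gamma) * sin (gamma * PI / 2)).

Lemma sin_gamma_pos gamma : 0 < gamma < 2 -> 0 < sin (gamma * PI / 2).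
Proof. intros Hg. assert (P := PI_RGT_0). apply sin_gt_0; nra. Qed.

(** The resolvent integral of the model, with [L = 1], has two asymptotic constants:
    [c1 * Gamma (1 + gamma) / 2] from the Abel means and a cosecant from [stieltjes_model]. Equating
    them determines [c1]. *)
Lemma fejer_model_constant gamma : 0 < gamma < 2 -> forall eps, 0 < eps ->
  eventually_nat (fun n => eventually_nat (fun N =>
    Rabs (rs (pw (2 - gamma)) N (fejer n) - model_constant gamma * Rpower (INR n) gamma) <=
    eps * Rpower (INR n) gamma)).
Proof.
intros Hg. set (beta := 2 - gamma). assert (Hb : 0 < beta < 2) by (unfold beta; lra).
destruct (fejer_model beta Hb) as (c1 & Hc1 & Hfm).
replace (2 - beta) with gamma in Hfm by (unfold beta; ring).
assert (HGa := Gamma_pos gamma Hg).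
assert (E : c1 * Gamma (1 + gamma) / 2 = beta / 2 * (PI / sin (beta / 2 * PI))).
{ set (v := fun n => RInt (fun w => fejer n (pw (/ beta) w)) 0 (pw beta PI)).
  assert (Hlim : forall n, is_lim_seq (fun N => rs (pw beta) N (fejer n)) (v n)).
  { intros n. apply model_integral with (INR n ^ 3); [exact Hb|apply pow_le, pos_INR|].
    apply fejer_lipschitz. }
  assert (Hv : forall eps, 0 < eps -> eventually_nat (fun n =>
    Rabs (v n - c1 * (1 * Rpower (INR n) gamma)) <= eps * (1 * Rpower (INR n) gamma))).
  { intros eps He. refine (ev_imp _ _ _ (Hfm eps He)). intros n Hn. rewrite !Rmult_1_l.
    exact (lim_close _ _ _ _ (Hlim n) Hn). }
  assert (R1 := resolvent_limit (fun _ => 1) gamma c1 (pw beta) v Hg (fun _ _ => Rlt_0_1)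
    locally_uniform_one potter_one Hc1 (pw_nondecreasing beta ltac:(lra)) Hlim Hv).
  apply Rminus_diag_uniq, Rabs_eq_0. apply Rle_antisym; [|apply Rabs_pos].
  apply le_epsilon. intros eps He. rewrite Rplus_0_l.
  (* For each [eps] a single scale [d / 2] and a single [N] suffice to compare the two constants. *)
  destruct (near0_and _ _ (R1 (eps / 2) ltac:(lra)) (stieltjes_model beta Hb (eps / 2) ltac:(lra)))
    as (d & Hd & H).
  destruct (H (d / 2) ltac:(lra)) as [A B].
  destruct (ev_and _ _ A B) as (N & HN). destruct (HN N (le_n N)) as [A1 B1].
  fold beta in A1. rewrite !Rmult_1_l in A1.
  assert (P := Rpower_pos (d / 2) beta). set (p := Rpower (d / 2) beta) in *.
  set (X := rs (pw beta) N _) in *.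
  apply Rabs_le_between in A1. apply Rabs_le_between in B1.
  apply Rmult_le_reg_r with p; [exact P|]. rewrite <- (Rabs_pos_eq p) at 1 by lra.
  rewrite <- Rabs_mult. apply Rabs_le. lra. }
assert (Es : sin (beta / 2 * PI) = sin (gamma * PI / 2)).
{ replace (beta / 2 * PI) with (PI - gamma * PI / 2) by (unfold beta; field).
  apply sin_PI_x. }
assert (Hs := sin_gamma_pos gamma Hg).
rewrite Es in E.
assert (Ec : c1 = model_constant gamma).
{ unfold model_constant. fold beta. apply Rmult_eq_reg_r with (Gamma (1 + gamma) / 2); [|lra].
  replace (c1 * (Gamma (1 + gamma) / 2)) with (c1 * Gamma (1 + gamma) / 2) by field.
  rewrite E. field. lra. }
rewrite <- Ec. exact Hfm.
Qed.

Lemma stieltjes_constant gamma : 0 < gamma < 2 ->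
  (2 - gamma) / 2 * (PI / sin ((2 - gamma) / 2 * PI)) =
  model_constant gamma * Gamma (1 + gamma) / 2.
Proof.
intros Hg. assert (HGa := Gamma_pos gamma Hg). assert (Hs := sin_gamma_pos gamma Hg).
replace ((2 - gamma) / 2 * PI) with (PI - gamma * PI / 2) by field.
rewrite sin_PI_x. unfold model_constant. field. lra.
Qed.

Section Equivalence.

Variables (L : R -> R) (gamma kappa : R) (G : R -> R) (v : nat -> R).
Hypothesis hgamma : 0 < gamma < 2.
Hypothesis Lpos : forall x, 0 < x -> 0 < L x.
Hypothesis Lunif : locally_uniform_sv L.
Hypothesis Lpot : potter_bounds L.
Hypothesis hkappa : 0 < kappa.
Hypothesis hG : nondecreasing_pos G.
Hypothesis hlim : forall n, is_lim_seq (fun N => rs G N (fejer n)) (v n).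

Let beta := 2 - gamma.
Let c1 := model_constant gamma.

Definition cdf_asymptotics : Prop := forall eps, 0 < eps ->
  near0 (fun x => Rabs (G x - kappa * (L (/ x) * Rpower x beta)) <= eps * (L (/ x) * Rpower x beta)).

Definition variance_asymptotics : Prop := forall eps, 0 < eps -> eventually_nat (fun n =>
  Rabs (v n - kappa * c1 * (L (INR n) * Rpower (INR n) gamma)) <=
    eps * (L (INR n) * Rpower (INR n) gamma)).

(** The Fejer kernel divided by n^2 is a kernel of scale 1 / n in the sense of [kernel_comparison];
    32 is the constant of [fejer_decay]. *)
Lemma abelian_direction : cdf_asymptotics -> variance_asymptotics.
Proof.
intros Has eps He. assert (Hb : 0 < beta < 2) by (unfold beta; lra).
assert (Hcmp := kernel_comparison L beta Hb Lpos Lunif Lpot G kappa hG hkappa Has 32 (eps / 2)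
  ltac:(lra) ltac:(lra)).
destruct (near0_seq _ Hcmp) as (n0 & Hn0).
assert (Hk : 0 < eps / (2 * kappa)) by pos.
destruct (fejer_model_constant gamma hgamma (eps / (2 * kappa)) Hk) as (n1 & Hn1).
exists (n0 + n1)%nat. intros n Hn.
destruct (Hn0 n ltac:(lia)) as [Hnp0 Hc]. clear Hn0.
assert (Hm := Hn1 n ltac:(lia)). fold beta c1 in Hm.
assert (Hn' : 0 < INR n) by (apply lt_0_INR, Hnp0).
assert (Hn2 : 0 < INR n ^ 2) by pos.
assert (Hin2 : 0 < / INR n ^ 2) by pos.
rewrite !Rinv_inv in Hc.
assert (Ls := Lpos (INR n) Hn').
set (l := L (INR n)) in *. set (png := Rpower (INR n) gamma) in *.
assert (EP : Rpower (/ INR n) beta = / INR n ^ 2 * png).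
{ unfold png, beta, Rminus. rewrite Rpower_plus, Rpower_Ropp.
  replace (Rpower (/ INR n) 2) with (/ INR n ^ 2).
  - f_equal. unfold Rpower. rewrite ln_Rinv, <- exp_Ropp by exact Hn'. f_equal. ring.
  - rewrite <- (Rpower_pow 2) by exact Hn'. simpl INR. rewrite <- Rpower_Ropp.
    unfold Rpower. rewrite ln_Rinv by exact Hn'. f_equal. ring. }
rewrite EP in Hc.
apply (lim_close _ _ _ _ (hlim n)). refine (ev_imp _ _ _ Hm). intros N HN.
assert (HG' : Rabs (rs G N (fun x => / INR n ^ 2 * fejer n x) -
  kappa * l * rs (pw beta) N (fun x => / INR n ^ 2 * fejer n x)) <= eps / 2 * (l * (/ INR n ^ 2 * png))).
{ apply Hc.
  - intros x _. rewrite Rabs_mult, (Rabs_pos_eq (/ INR n ^ 2)) by lra.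
    apply Rmult_le_reg_l with (INR n ^ 2); [exact Hn2|].
    rewrite <- Rmult_assoc, Rinv_r, Rmult_1_l, Rmult_1_r by lra. apply fejer_abs_le.
  - intros x y _ _. rewrite <- Rmult_minus_distr_l, Rabs_mult, (Rabs_pos_eq (/ INR n ^ 2)) by lra.
    apply Rle_trans with (/ INR n ^ 2 * (INR n ^ 3 * Rabs (x - y))).
    + apply Rmult_le_compat_l; [lra|apply fejer_lipschitz].
    + replace (/ INR n ^ 2 * (INR n ^ 3 * Rabs (x - y))) with (INR n * Rabs (x - y)) by (field; lra).
      apply Rmult_le_compat_r; [apply Rabs_pos|]. unfold Rdiv. rewrite Rinv_inv. lra.
  - intros x Hx. rewrite Rabs_mult, (Rabs_pos_eq (/ INR n ^ 2)) by lra.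
    rewrite Rabs_pos_eq by (apply fejer_ge0; lra).
    apply Rle_trans with (/ INR n ^ 2 * (32 / x ^ 2)).
    + apply Rmult_le_compat_l; [lra|apply fejer_decay, Hx].
    + right. field. lra. }
rewrite !rs_scal in HG'.
assert (HG2 : Rabs (rs G N (fejer n) - kappa * l * rs (pw beta) N (fejer n)) <= eps / 2 * (l * png)).
{ apply Rmult_le_reg_l with (/ INR n ^ 2); [exact Hin2|].
  rewrite <- (Rabs_pos_eq (/ INR n ^ 2)) at 1 by lra. rewrite <- Rabs_mult.
  replace (/ INR n ^ 2 * (rs G N (fejer n) - kappa * l * rs (pw beta) N (fejer n))) with
    (/ INR n ^ 2 * rs G N (fejer n) - kappa * l * (/ INR n ^ 2 * rs (pw beta) N (fejer n))) by ring.
  apply Rle_trans with (1 := HG'). right. ring. }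
assert (Hkl : 0 < kappa * l) by pos.
apply Rmult_le_compat_l with (r := kappa * l) in HN; [|lra].
rewrite <- (Rabs_pos_eq (kappa * l)) in HN at 1 by lra. rewrite <- Rabs_mult in HN.
replace (kappa * l * (eps / (2 * kappa) * png)) with (eps / 2 * (l * png)) in HN by (field; lra).
replace (rs G N (fejer n) - kappa * c1 * (l * png)) with
  ((rs G N (fejer n) - kappa * l * rs (pw beta) N (fejer n)) +
   kappa * l * (rs (pw beta) N (fejer n) - c1 * png)) by ring.
apply Rle_trans with (1 := Rabs_triang _ _). lra.
Qed.

(** The resolvent integrals of [G] and of the model have the constants [kappa * I0] and [I0]. Their
    ratio is [kappa], which is the hypothesis of [tauberian] on the Stieltjes kernel. *)
Lemma tauberian_direction : variance_asymptotics -> cdf_asymptotics.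
Proof.
intros Hva. assert (Hb : 0 < beta < 2) by (unfold beta; lra).
assert (HGa := Gamma_pos gamma hgamma). assert (Hsin := sin_gamma_pos gamma hgamma).
assert (Hc1 : 0 < c1).
{ unfold c1, model_constant. assert (P := PI_RGT_0).
  apply Rdiv_lt_0_compat; apply Rmult_lt_0_compat; lra. }
set (I0 := c1 * Gamma (1 + gamma) / 2).
assert (HI0 : 0 < I0) by pos.
assert (HW : 0 < kappa * c1) by pos.
assert (Hres := resolvent_limit L gamma (kappa * c1) G v hgamma Lpos Lunif Lpot HW hG hlim Hva).
assert (Hmod := stieltjes_model beta Hb).
assert (HSc := stieltjes_constant gamma hgamma). fold beta c1 in HSc. fold I0 in HSc.
rewrite HSc in Hmod.
assert (Hk : forall H N s, 0 < s -> rs H N (fun x => / (1 + chord2 x / s ^ 2)) =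
  rs H N (fun x => s ^ 2 / (s ^ 2 + chord2 x))).
{ intros H N s Hs. apply rs_ext. intros x _. assert (C := chord2_ge0 x).
  assert (0 < s ^ 2) by pos. field. split; lra. }
intros eps He.
refine (tauberian L beta kappa G Hb Lpos Lunif hG hkappa _ (I0 + 1) ltac:(lra) _ eps He).
- intros e Hep. assert (He2 : 0 < e / (2 * kappa)) by pos.
  refine (near0_imp _ _ _ (near0_and _ _ (Hres (e / 2) ltac:(lra)) (Hmod _ He2))).
  intros s Hs [A B]. refine (ev_imp _ _ _ (ev_and _ _ A B)). intros N [A1 B1].
  rewrite !Hk by exact Hs. fold beta in A1.
  assert (Ls := Lpos (/ s) ltac:(apply Rinv_0_lt_compat; lra)).
  set (l := L (/ s)) in *. set (p := Rpower s beta) in *.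
  set (X := rs G N (fun x => s ^ 2 / (s ^ 2 + chord2 x))) in *.
  set (Y := rs (pw beta) N (fun x => s ^ 2 / (s ^ 2 + chord2 x))) in *.
  assert (Hkl : 0 < kappa * l) by pos.
  apply Rmult_le_compat_l with (r := kappa * l) in B1; [|lra].
  rewrite <- (Rabs_pos_eq (kappa * l)) in B1 at 1 by lra. rewrite <- Rabs_mult in B1.
  replace (kappa * l * (e / (2 * kappa) * p)) with (e / 2 * (l * p)) in B1 by (field; lra).
  replace (kappa * c1 * Gamma (1 + gamma) / 2 * (l * p)) with (kappa * l * (I0 * p)) in A1
    by (unfold I0; field).
  apply Rabs_le_between in A1. apply Rabs_le_between in B1. apply Rabs_le. lra.
- refine (near0_imp _ _ _ (Hmod 1 Rlt_0_1)). intros s Hs. apply ev_imp. intros N HN.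
  rewrite Hk by exact Hs. apply Rabs_le_between in HN. lra.
Qed.

Lemma asymptotics_equiv : cdf_asymptotics <-> variance_asymptotics.
Proof. split; [apply abelian_direction|apply tauberian_direction]. Qed.

End Equivalence.

Lemma relative_error_le a b eps : 0 < b -> 0 < eps -> Rabs (a / b - 1) < eps -> Rabs (a - b) <= eps * b.
Proof.
intros Hb He H. replace (a - b) with ((a / b - 1) * b) by (field; lra).
rewrite Rabs_mult, (Rabs_pos_eq b) by lra. apply Rmult_le_compat_r; lra.
Qed.

Lemma relative_error_lt a b eps : 0 < b -> 0 < eps -> Rabs (a - b) <= eps / 2 * b -> Rabs (a / b - 1) < eps.
Proof.
intros Hb He H. replace (a / b - 1) with ((a - b) * / b) by (field; lra).
assert (Hi : 0 < / b) by pos.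
rewrite Rabs_mult, (Rabs_pos_eq (/ b)) by lra.
apply Rle_lt_trans with (eps / 2 * b * / b); [apply Rmult_le_compat_r; lra|].
rewrite Rmult_assoc, Rinv_r; lra.
Qed.

Lemma Cgamma_pos gamma : 0 < gamma < 2 -> 0 < Cgamma gamma.
Proof.
intros Hg. unfold Cgamma. assert (P := PI_RGT_0).
apply Rdiv_lt_0_compat; apply Rmult_lt_0_compat; try lra; [apply Gamma_pos|apply sin_gamma_pos]; exact Hg.
Qed.

Lemma Cgamma_model gamma : 0 < gamma < 2 -> Cgamma gamma * model_constant gamma = 1.
Proof.
intros Hg. assert (H1 := Gamma_pos gamma Hg). assert (H2 := sin_gamma_pos gamma Hg).
assert (P := PI_RGT_0). unfold Cgamma, model_constant. field. repeat split; lra.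
Qed.

Lemma Cgamma_1 : Cgamma 1 = / PI.
Proof.
unfold Cgamma. replace (1 + 1) with 2 by ring. rewrite Gamma_2.
replace (1 * PI / 2) with (PI / 2) by field. rewrite sin_PI2. field. apply PI_neq0.
Qed.

Theorem theorem1 (G : R -> R) (r : nat -> R)
  (hG : symm_spectral_cdf G) (hr : is_spectral_cov G r)
  (gamma K0 : R) (L : R -> R)
  (hgamma : 0 < gamma < 2) (hK0 : 0 < K0)
  (hLm : measurable_pos L) (hL : slowly_varying L) :
  ((forall eps, 0 < eps -> exists d, 0 < d /\ forall x, 0 < x < d ->
       Rabs (G x / (Cgamma gamma * K0 * Rpower x (2 - gamma) * L (/ x)) - 1) < eps)
   <->
   Un_cv (fun n => var_S r n / (K0 * Rpower (INR n) gamma * L (INR n))) 1)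
  /\
  (Un_cv (fun n => var_S r n / INR n) K0
   <->
   (forall eps, 0 < eps -> exists d, 0 < d /\ forall x, 0 < x < d ->
       Rabs (G x / x - K0 / PI) < eps)).
Proof.
assert (hG' : nondecreasing_pos G) by (split; apply hG).
assert (hlim := fun n => rs_fejer_lim G r n hr).
split.
- assert (Lpos := proj1 hL).
  assert (HC := Cgamma_pos gamma hgamma). assert (HCm := Cgamma_model gamma hgamma).
  set (kappa := Cgamma gamma * K0).
  assert (Hk : 0 < kappa) by pos.
  assert (Hkc : kappa * model_constant gamma = K0).
  { unfold kappa. transitivity (K0 * (Cgamma gamma * model_constant gamma)); [ring|]. rewrite HCm. ring. }
  assert (Heq := asymptotics_equiv L gamma kappa G (var_S r) hgamma Lpos
    (slowly_varying_uniform L hLm hL) (slowly_varying_potter L hLm hL) Hk hG' hlim).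
  unfold variance_asymptotics in Heq. rewrite Hkc in Heq.
  assert (HU : forall x, 0 < x -> 0 < L (/ x) * Rpower x (2 - gamma)).
  { intros x Hx. apply Rmult_lt_0_compat; [apply Lpos, Rinv_0_lt_compat, Hx|apply Rpower_pos]. }
  transitivity (cdf_asymptotics L gamma kappa G); [|rewrite Heq].
  + split; intros H eps He.
    * destruct (H (eps / kappa) ltac:(apply Rdiv_lt_0_compat; lra)) as (d & Hd & Hx).
      exists d. split; [exact Hd|]. intros x Hxd. specialize (HU x ltac:(lra)). specialize (Hx x Hxd).
      replace (kappa * Rpower x (2 - gamma) * L (/ x)) with
        (kappa * (L (/ x) * Rpower x (2 - gamma))) in Hx by ring.
      apply relative_error_le in Hx; [|apply Rmult_lt_0_compat; lra|apply Rdiv_lt_0_compat; lra].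
      apply Rle_trans with (1 := Hx). right. field. lra.
    * destruct (H (eps / 2 * kappa) ltac:(nra)) as (d & Hd & Hx).
      exists d. split; [exact Hd|]. intros x Hxd. specialize (HU x ltac:(lra)). specialize (Hx x Hxd).
      replace (kappa * Rpower x (2 - gamma) * L (/ x)) with
        (kappa * (L (/ x) * Rpower x (2 - gamma))) by ring.
      apply relative_error_lt; [apply Rmult_lt_0_compat; lra|exact He|].
      apply Rle_trans with (1 := Hx). right. ring.
  + assert (HV : forall n, (0 < n)%nat -> 0 < L (INR n) * Rpower (INR n) gamma).
    { intros n Hn. apply Rmult_lt_0_compat; [apply Lpos, lt_0_INR, Hn|apply Rpower_pos]. }
    split; intros H eps He.
    (* [S n0] excludes [n = 0], where the comparison function need not be positive. *)
    * destruct (H (eps / 2 * K0) ltac:(nra)) as (n0 & Hn0). exists (S n0). intros n Hn.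
      specialize (HV n ltac:(lia)). specialize (Hn0 n ltac:(lia)). unfold R_dist.
      replace (K0 * Rpower (INR n) gamma * L (INR n)) with
        (K0 * (L (INR n) * Rpower (INR n) gamma)) by ring.
      apply relative_error_lt; [apply Rmult_lt_0_compat; lra|exact He|].
      apply Rle_trans with (1 := Hn0). right. ring.
    * destruct (H (eps / K0) ltac:(apply Rdiv_lt_0_compat; lra)) as (n0 & Hn0).
      exists (S n0). intros n Hn. specialize (HV n ltac:(lia)). specialize (Hn0 n ltac:(lia)).
      unfold R_dist in Hn0.
      replace (K0 * Rpower (INR n) gamma * L (INR n)) with
        (K0 * (L (INR n) * Rpower (INR n) gamma)) in Hn0 by ring.
      apply relative_error_le in Hn0; [|apply Rmult_lt_0_compat; lra|apply Rdiv_lt_0_compat; lra].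
      apply Rle_trans with (1 := Hn0). right. field. lra.
(* The linear case is the equivalence with [L = 1], exponent 1 and [kappa = K0 / PI]; [Cgamma_1]
   turns the variance constant into [K0]. *)
- assert (P := PI_RGT_0). assert (H1 : 0 < 1 < 2) by lra.
  assert (Hk : 0 < K0 / PI) by pos.
  assert (Hkc : K0 / PI * model_constant 1 = K0).
  { assert (HCm := Cgamma_model 1 H1). rewrite Cgamma_1 in HCm.
    transitivity (K0 * (/ PI * model_constant 1)); [unfold Rdiv; ring|]. rewrite HCm. ring. }
  assert (Heq := asymptotics_equiv (fun _ => 1) 1 (K0 / PI) G (var_S r) H1 (fun _ _ => Rlt_0_1)
    locally_uniform_one potter_one Hk hG' hlim).
  unfold variance_asymptotics, cdf_asymptotics in Heq. rewrite Hkc in Heq.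
  replace (2 - 1) with 1 in Heq by ring.
  assert (Hdiv : forall a b c, 0 < b -> Rabs (a / b - c) = Rabs (a - c * b) / b).
  { intros a b c Hb. replace (a / b - c) with ((a - c * b) / b) by (field; lra).
    unfold Rdiv. rewrite Rabs_mult, (Rabs_pos_eq (/ b)); [reflexivity|].
    left. apply Rinv_0_lt_compat, Hb. }
  split; intros H.
  + intros eps He. destruct (proj2 Heq) with (eps / 2) as (d & Hd & Hx); [|lra|].
    * intros e Hep. destruct (H e Hep) as (n0 & Hn0). exists (S n0). intros n Hn.
      assert (Hnp : 0 < INR n) by (apply lt_0_INR; lia).
      specialize (Hn0 n ltac:(lia)). unfold R_dist in Hn0. rewrite Hdiv in Hn0 by exact Hnp.
      rewrite Rpower_1, !Rmult_1_l by exact Hnp.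
      apply Rmult_lt_compat_r with (r := INR n) in Hn0; [|exact Hnp].
      unfold Rdiv in Hn0. rewrite Rmult_assoc, Rinv_l in Hn0 by lra. lra.
    * exists d. split; [exact Hd|]. intros x Hxd. specialize (Hx x Hxd).
      rewrite Rpower_1, !Rmult_1_l in Hx by lra. rewrite Hdiv by lra.
      apply Rmult_lt_reg_r with x; [lra|]. unfold Rdiv at 1. rewrite Rmult_assoc, Rinv_l by lra. nra.
  + intros eps He. destruct (proj1 Heq) with (eps / 2) as (n0 & Hn0); [|lra|].
    * intros e Hep. destruct (H e Hep) as (d & Hd & Hx). exists d. split; [exact Hd|].
      intros x Hxd. specialize (Hx x Hxd). rewrite Hdiv in Hx by lra.
      rewrite Rpower_1, !Rmult_1_l by lra.
      apply Rmult_lt_compat_r with (r := x) in Hx; [|lra].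
      unfold Rdiv at 1 in Hx. rewrite Rmult_assoc, Rinv_l in Hx by lra. lra.
    * exists (S n0). intros n Hn. assert (Hnp : 0 < INR n) by (apply lt_0_INR; lia).
      specialize (Hn0 n ltac:(lia)). rewrite Rpower_1, !Rmult_1_l in Hn0 by exact Hnp.
      unfold R_dist. rewrite Hdiv by exact Hnp.
      apply Rmult_lt_reg_r with (INR n); [exact Hnp|]. unfold Rdiv at 1.
      rewrite Rmult_assoc, Rinv_l by lra. nra.
Qed.
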